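(* Consider either (a) the $\mathbb Z$-valued $p$-SOS model ($p>0$) on $\mathcal T^d$ with $d\ge d(p,M,d_{\max})$ as in Theorem 1, ground-state class $\mathcal G^0(d_{\max},d,M)$; or (b) the $\mathbb Z_q$-valued finite-spin model on $\mathcal T^d$ satisfying $(d-1)u>d_{\max}(U+u)$ as in Theorem 2, ground-state class $\mathcal G^0_q(d_{\max},d)$; in either case perturbed by single-site potentials $\Psi_v:\Omega_0\to\mathbb R$, i.e. with Hamiltonian $\sum_{v\sim w}\Phi(\omega_v,\omega_w)+\sum_v\Psi_v(\omega_v)$. Then there is a threshold $\epsilon^*>0$ such that for every family $(\Psi_v)_{v\in V}$ with $$\sup_{v\in V}\sup_{k,l\in\Omega_0}|\Psi_v(k)-\Psi_v(l)|\le\epsilon^*,$$ and all $\beta$ sufficiently large, there is a family of Gibbs measures $(\mu^{\omega^0}_\beta[\Psi])$ indexed by the respective ground-state class, which are extremal, pairwise distinct for distinct $\omega^0$, and concentrated around $\omega^0$: in case (a) $\mu^{\omega^0}_\beta[\Psi](\sigma_v-\omega^0_v=k)\le Ce^{-c\beta|k|^p}$ for all $v,k$, and in case (b) $\mu^{\omega^0}_\beta[\Psi](\sigma_v=\omega^0_v)\ge1-Ce^{-c\beta}$ for all $v$, for some constants $c,C>0$.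
   Context: $\mathcal T^d=(V,E)$ is the Cayley tree of order $d$ (every vertex has $d+1$ neighbours). $\Omega_0=\mathbb Z$ with $\Phi(a,b)=|a-b|^p$ in case (a); $\Omega_0=\mathbb Z_q$ with $\Phi(a,b)=u_{a,b}$, $u_{k,\ell}\ge0$, $u_{k,k}=0$, $u=\min_{k\ne\ell}u_{k,\ell}$, $U=\max u_{k,\ell}$ in case (b). For $D\subset E$, $d_D$ is the maximal number of edges of $D$ at a vertex. $\mathcal G^0(d_{\max},d,M)$: $\omega^0\in\mathbb Z^V$ with broken-edge set $D$ satisfying $d_D\le d_{\max}$ and $\max_{v\sim w}|\omega^0_v-\omega^0_w|\le M$; $\mathcal G^0_q(d_{\max},d)$: $\omega^0\in\mathbb Z_q^V$ with $d_D\le d_{\max}$. With $c_p=\min\{2^{1-p},1\}$, $d(p,M,d_{\max})=1+\lfloor c_p^{-2}+(c_p^{-1}+c_p^{-2})d_{\max}M^p\rfloor$. Gibbs measures: DLR-consistent with $\gamma_\Lambda(\omega_\Lambda\mid\tau)\propto e^{-\beta H_\Lambda(\omega_\Lambda\tau_{\Lambda^c})}$, $H_\Lambda$ containing edge terms touching $\Lambda$ and single-site terms in $\Lambda$. *)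

(* Defs.v *)
From HB Require Import structures.
From mathcomp Require Import all_boot all_order all_algebra.
From mathcomp Require Import all_classical all_reals all_analysis.
Set Implicit Arguments. Unset Strict Implicit. Unset Printing Implicit Defensive.
Import Order.TTheory GRing.Theory Num.Theory.
Local Open Scope ring_scope.
Local Open Scope classical_set_scope.

(* Spin spaces must be pointed to build the configuration sigma-algebra. *)
HB.instance Definition _ := classical_sets.isPointed.Build int 0%R.
HB.instance Definition _ n := classical_sets.isPointed.Build 'I_n.+1 ord0.

(* Vertices: reduced words over the alphabet 'I_(d+1) (no two consecutive
   equal letters), i.e. the Cayley graph of the free product of d+1 copies
   of Z/2.  The root is the empty word. *)
Definition reduced (d : nat) (s : seq 'I_d.+1) : bool :=
  sorted (fun a b => a != b) s.

Definition vertex (d : nat) := {s : seq 'I_d.+1 | reduced s}.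

(* children: append one letter (insub fails exactly when the letter repeats
   the last one); parent: drop the last letter. *)
Definition children (d : nat) (v : vertex d) : seq (vertex d) :=
  pmap (@insub _ (@reduced d) (vertex d))
       [seq rcons (val v) a | a <- enum 'I_d.+1].

Definition parent (d : nat) (v : vertex d) : seq (vertex d) :=
  if val v is _ :: _ then
    pmap (@insub _ (@reduced d) (vertex d)) [:: take (size (val v)).-1 (val v)]
  else [::].

Definition nbrs (d : nat) (v : vertex d) : seq (vertex d) :=
  children v ++ parent v.

Definition cyl (d : nat) (S : Type) : set (set (vertex d -> S)) :=
  fun A => exists (v : vertex d) (k : S), A = [set s | s v = k].

Definition ConfSpace (d : nat) (S : pointedType) :=
  g_sigma_algebraType (@cyl d S).

Section Model.
Variables (R : realType) (d : nat) (S : pointedType).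
Variables (Phi : S -> S -> R) (Psi : vertex d -> S -> R) (beta : R).

(* energy of the edge {v,w}, evaluated as Phi(parent value, child value) *)
Definition edgeE (om : vertex d -> S) (v w : vertex d) : R :=
  if (size (val v) < size (val w))%N then Phi (om v) (om w)
  else Phi (om w) (om v).

(* H_Lambda: all edge terms touching Lambda (each edge counted once) plus the
   single-site terms in Lambda.  Lambda is a finite duplicate-free list. *)
Definition HLam (Lam : seq (vertex d)) (om : vertex d -> S) : R :=
  \sum_(v <- Lam)
     (\sum_(w <- nbrs v | (w \notin Lam) || (size (val v) < size (val w))%N)
          edgeE om v w
      + Psi v (om v)).

Definition agree (Lam : seq (vertex d)) (tau : vertex d -> S) :
  set (vertex d -> S) :=
  [set eta | forall v, v \notin Lam -> eta v = tau v].

Definition gamma (Lam : seq (vertex d)) (A : set (vertex d -> S))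
  (tau : vertex d -> S) : \bar R :=
  (fine (\esum_(eta in agree Lam tau)
            ((eta \in A)%:R * expR (- beta * HLam Lam eta))%:E)
   / fine (\esum_(eta in agree Lam tau) (expR (- beta * HLam Lam eta))%:E))%:E.

Definition is_gibbs (mu : probability (ConfSpace d S) R) : Prop :=
  forall Lam : seq (vertex d), uniq Lam ->
  forall A : set (ConfSpace d S), measurable A ->
    mu A = (\int[mu]_tau gamma Lam A tau)%E.

Definition extremal_gibbs (mu : probability (ConfSpace d S) R) : Prop :=
  is_gibbs mu /\
  forall (mu1 mu2 : probability (ConfSpace d S) R) (t : R),
    is_gibbs mu1 -> is_gibbs mu2 -> 0 < t < 1 ->
    (forall A : set (ConfSpace d S), measurable A ->
        mu A = (t%:E * mu1 A + (1 - t)%:E * mu2 A)%E) ->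
    forall A : set (ConfSpace d S), measurable A ->
      mu1 A = mu A /\ mu2 A = mu A.

Definition distinct_measures (mu1 mu2 : probability (ConfSpace d S) R) : Prop :=
  exists A : set (ConfSpace d S), measurable A /\ mu1 A <> mu2 A.

End Model.

Definition sosPhi (R : realType) (p : R) (a b : int) : R :=
  (`| (a - b)%:~R | : R) `^ p.

Definition c_p (R : realType) (p : R) : R := Num.min (2 `^ (1 - p)) 1.

Definition d_threshold (R : realType) (p : R) (M dmax : nat) : int :=
  1 + Num.floor ((c_p p)^-2 + ((c_p p)^-1 + (c_p p)^-2) * dmax%:R
                 * (M%:R `^ p)).

Definition broken_deg_le (d : nat) (S : eqType) (dmax : nat)
  (om0 : vertex d -> S) : Prop :=
  forall v : vertex d, (count (fun w => om0 w != om0 v) (nbrs v) <= dmax)%N.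

Definition G0 (d dmax M : nat) (om0 : vertex d -> int) : Prop :=
  broken_deg_le dmax om0 /\
  forall v w : vertex d, w \in nbrs v -> (absz (om0 v - om0 w) <= M)%N.

Definition Umax (q : nat) (R : realType) (u : 'I_q -> 'I_q -> R) : R :=
  \big[Num.max/0]_(k : 'I_q) \big[Num.max/0]_(l : 'I_q) u k l.

Definition umin (q : nat) (R : realType) (u : 'I_q -> 'I_q -> R) : R :=
  \big[Num.min/Umax u]_(k : 'I_q) \big[Num.min/Umax u]_(l : 'I_q | l != k) u k l.

Definition G0q (q d dmax : nat) (om0 : vertex d -> 'I_q) : Prop :=
  broken_deg_le dmax om0.

(* Main.v *)
(**
  Fix a reference configuration [a] in the ground-state class and root the tree.
  If each vertex has enough unbroken edges, the messages that the subtrees send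
  towards the root, normalised to be 1 at the reference spin, obey an a priori
  Peierls bound, and the message recursion contracts by 1/2 in the distance
  weighted by that bound; its fixed point is a boundary law.  The boundary law
  defines a tree-indexed Markov chain, which is a Gibbs measure because the
  normalisations telescope along the edges.  Multiplying the bounds on the d+1
  messages entering a vertex gives concentration around [a], and hence distinct
  measures for distinct references.

  Extremality: let mu1 be a Gibbs measure with t mu1 <= mu.  The density of mu1
  with respect to mu on a finite prefix of the tree is a martingale with values
  in [0, 1/t].  By the DLR equations it does not depend on the interior spins;
  averaging out one level of spins halves its variation under resetting a spin
  to its reference value, in a suitable weight.  Iterating from arbitrarily deep
  levels shows that the density is constant.

  The thresholds (d-1) u > d_max (U+u) and d c_p^2 > 1 + (1+c_p) d_max M^p say
  that the d messages entering a vertex outweigh the remaining edge.  The slack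
  in these strict inequalities absorbs the single-site potentials.
*)
Require Import Defs.
From HB Require Import structures.
From mathcomp Require Import all_boot all_order all_algebra.
From mathcomp Require Import all_classical all_reals all_analysis.
From mathcomp Require Import measurable_realfun ring lra zify.
Set Implicit Arguments. Unset Strict Implicit. Unset Printing Implicit Defensive.
Import Order.TTheory GRing.Theory Num.Theory.
Import numFieldNormedType.Exports.
Local Open Scope ring_scope.
Local Open Scope classical_set_scope.

(** * Sums over a discrete spin space *)

(** Spins are unbounded in case (a), so neither the messages nor the transition kernels are close to
    each other uniformly in the spin of the parent. Contraction rests on another fact: messages are
    normalised to 1 at the reference spin, so the summand at that spin is the same for all of them,
    and all variation sits in the excited summands, whose total is a share [th] of the bound. The
    value [th = 1 / (4 (d+1))] is a count: at most d+1 factors of a product vary, numerator and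
    denominator of the recursion both vary, and the outcome has to be halved. The same count serves
    for extremality, where d+1 bounds the children of a vertex and the second factor 2 comes from
    comparing the actual with the reference spin of the parent. The models enter only through lower
    bounds on the cost of changing a spin. Half of the slack in the threshold is the admissible
    oscillation of the potentials, the other half the rate of decay. *)

Section DiscreteSums.
Variables (R : realType) (S : choiceType).
Implicit Types (f g : S -> R) (a : S).

Definition summ f : Prop :=
  (forall k, 0 <= f k) /\ (\esum_(k in [set: S]) (f k)%:E < +oo)%E.

Definition tot f : R := fine (\esum_(k in [set: S]) (f k)%:E).

(** Peierls estimates control only the excited spins; the reference spin is removed before summing
    and restored by [tot_split]. *)
Definition off a f : S -> R := fun k => if k == a then 0 else f k.

Lemma esum_tot f : summ f -> \esum_(k in [set: S]) (f k)%:E = (tot f)%:E.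
Proof.
move=> [f0 fo]; rewrite /tot fineK// ge0_fin_numE// esum_ge0// => k _.
by rewrite lee_fin.
Qed.

Lemma summ_esum f x : (forall k, 0 <= f k) ->
  \esum_(k in [set: S]) (f k)%:E = x%:E -> summ f /\ tot f = x.
Proof. by move=> f0 fx; split; [split => //; rewrite fx ltry|rewrite /tot fx]. Qed.

Lemma summ_le f g : (forall k, 0 <= f k) -> (forall k, f k <= g k) ->
  summ g -> summ f /\ tot f <= tot g.
Proof.
move=> f0 fg gs.
have fs : summ f.
  split=> //; apply: (le_lt_trans _ gs.2).
  by apply: le_esum => k _; rewrite lee_fin.
split=> //; rewrite -lee_fin -!esum_tot//.
by apply: le_esum => k _; rewrite lee_fin.
Qed.

Lemma summ_bound f x : (forall k, 0 <= f k) ->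
  (\esum_(k in [set: S]) (f k)%:E <= x%:E)%E -> summ f /\ tot f <= x.
Proof.
move=> f0 fx; have fs : summ f by split=> //; apply: le_lt_trans fx _; rewrite ltry.
by split=> //; rewrite -lee_fin -esum_tot.
Qed.

Lemma totD f g : summ f -> summ g ->
  summ (fun k => f k + g k) /\ tot (fun k => f k + g k) = tot f + tot g.
Proof.
move=> fs gs; apply: summ_esum => [k|].
  by rewrite addr_ge0 //; [exact: fs.1|exact: gs.1].
rewrite EFinD -!esum_tot// -esumD// => k _; rewrite lee_fin; [exact: fs.1|exact: gs.1].
Qed.

Lemma esumZl (D : set S) c (f : S -> \bar R) : 0 <= c -> (forall i, 0 <= f i)%E ->
  (\esum_(i in D) (c%:E * f i) = c%:E * \esum_(i in D) f i)%E.
Proof.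
move=> c0 f0; have [->|cn0] := eqVneq c 0.
  by rewrite mul0e esum1// => i _; rewrite mul0e.
have cp : 0 < c by rewrite lt_neqAle eq_sym cn0.
(* One inequality holds for every nonnegative factor; applied with [c^-1] to the scaled family it
   yields the other. *)
have le_mul (h : S -> \bar R) x : 0 <= x -> (forall k, 0 <= h k)%E ->
   (\esum_(k in D) (x%:E * h k) <= x%:E * \esum_(k in D) h k)%E.
  move=> x0 h0; apply: ge_ereal_sup => _ [X [finX XI] <-].
  rewrite -ge0_mule_fsumr; last exact: h0.
  rewrite lee_wpmul2l ?lee_fin//; apply: ereal_sup_ubound; exists X => //.
apply/eqP; rewrite eq_le; apply/andP; split; first exact: le_mul.
have ci0 : 0 <= c^-1 by rewrite invr_ge0.
have cf0 k : (0 <= c%:E * f k)%E by rewrite mule_ge0 ?lee_fin.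
have /lee_wpmul2l := le_mul (fun k => c%:E * f k)%E c^-1 ci0 cf0.
have c0e : (0 <= c%:E)%E by rewrite lee_fin.
move=> /(_ _ c0e); rewrite muleA -EFinM divff// mul1e.
by under eq_esum do rewrite muleA -EFinM mulVf// mul1e.
Qed.

Lemma totZ c f : 0 <= c -> summ f ->
  summ (fun k => c * f k) /\ tot (fun k => c * f k) = c * tot f.
Proof.
move=> c0 fs; apply: summ_esum => [k|]; first by rewrite mulr_ge0// fs.1.
rewrite EFinM -esum_tot// -esumZl// => k; rewrite lee_fin; exact: fs.1.
Qed.

Lemma tot_ge0 f : (forall k, 0 <= f k) -> 0 <= tot f.
Proof. by move=> f0; apply: fine_ge0; apply: esum_ge0 => k _; rewrite lee_fin. Qed.

Lemma tot_split a f : summ (off a f) -> 0 <= f a ->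
  summ f /\ tot f = f a + tot (off a f).
Proof.
move=> fs fa.
have f0 k : 0 <= f k.
  by case: (eqVneq k a) => [->//|ka]; have := fs.1 k; rewrite /off (negPf ka).
apply: summ_esum => //.
rewrite EFinD -esum_tot// (esumID [set a]); last by move=> i _; rewrite lee_fin.
rewrite setTI esum_set1 ?lee_fin//; congr (_ + _)%E.
rewrite esum_mkcond; apply: eq_esum => k _; rewrite /off.
rewrite setTI; case: ifPn => [|]; rewrite ?inE ?notin_setE/=.
  by case: eqVneq.
by move=> /contrapT ->; rewrite eqxx.
Qed.

Lemma summ_off a f : summ f -> summ (off a f).
Proof.
move=> fs; have [] // := @summ_le (off a f) f _ _ fs.
  by move=> k; rewrite /off; case: ifP => // _; exact: fs.1.
by move=> k; rewrite /off; case: ifP => // _; exact: fs.1.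
Qed.

Lemma tot_term f a : summ f -> f a <= tot f.
Proof.
move=> fs; have [_ ->] := tot_split (summ_off a fs) (fs.1 a).
by rewrite lerDl tot_ge0 //; exact: (summ_off a fs).1.
Qed.

Lemma eq_tot f g : f =1 g -> tot f = tot g.
Proof. by move=> /funext ->. Qed.

Lemma summ0 : summ (fun=> 0) /\ tot (fun=> 0) = 0.
Proof. by apply: summ_esum => //; rewrite esum1. Qed.

Lemma tot_sum (I : eqType) (s : seq I) (F : I -> S -> R) :
  (forall i, i \in s -> summ (F i)) ->
  summ (fun k => \sum_(i <- s) F i k) /\
  tot (fun k => \sum_(i <- s) F i k) = \sum_(i <- s) tot (F i).
Proof.
elim: s => [_|i s IH Fs].
  by under eq_fun do rewrite big_nil; rewrite big_nil; exact: summ0.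
have [] := IH (fun j js => Fs j (mem_behead (s := i :: s) js)) => s1 s2.
under eq_fun do rewrite big_cons; rewrite big_cons -s2.
by apply: totD => //; apply: Fs; rewrite mem_head.
Qed.

End DiscreteSums.

(** * The rooted tree *)

Lemma uniq_flatten_map (A B : eqType) (f : A -> seq B) (s : seq A) :
  uniq s -> (forall x, uniq (f x)) ->
  (forall x y z, z \in f x -> z \in f y -> x = y) -> uniq (flatten (map f s)).
Proof.
move=> + fu finj; elim: s => //= x s IH /andP[xs us].
rewrite cat_uniq fu IH// andbT /=; apply/hasPn => z /flattenP[_ /mapP[y ys ->] zy].
by apply: contra xs => zx; rewrite (finj _ _ _ zx zy).
Qed.

Section Tree.
Variable d : nat.
Implicit Types v w x : vertex d.

Definition troot : vertex d := exist _ [::] isT.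
Definition lvl v := size (val v).
Definition par v : vertex d := insubd troot (take (lvl v).-1 (val v)).

Lemma reduced_take n (s : seq 'I_d.+1) : reduced s -> reduced (take n s).
Proof. exact: take_sorted. Qed.

Lemma val_par v : val (par v) = take (lvl v).-1 (val v).
Proof. by rewrite val_insubd reduced_take//; exact: (valP v). Qed.

Lemma lvl_par v : lvl (par v) = (lvl v).-1.
Proof. by rewrite /lvl val_par size_takel// leq_pred. Qed.

Lemma lvl_eq0 v : (lvl v == 0) = (v == troot).
Proof. by rewrite size_eq0 -val_eqE. Qed.

Lemma par_root : par troot = troot.
Proof. by apply: val_inj; rewrite val_par. Qed.

Lemma parentE v : parent v = if lvl v == 0 then [::] else [:: par v].
Proof.
rewrite /parent /lvl; case E : (val v) => [|a s] //=.
have h : reduced (take (size s) (a :: s)) by rewrite -E reduced_take//; exact: (valP v).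
rewrite insubT /=; congr [:: _]; apply: val_inj.
by rewrite SubK val_par /lvl E.
Qed.

Lemma mem_children v w : (w \in children v) = (lvl w != 0) && (par w == v).
Proof.
rewrite mem_pmap_sub /=; apply/mapP/andP => [[a _ wE]|[w0 /eqP <-]].
  have {}wE : val w = rcons (val v) a by [].
  rewrite /lvl wE size_rcons; split=> //; apply/eqP/val_inj.
  by rewrite val_par /lvl wE size_rcons /= -cats1 take_size_cat.
move: w0; rewrite val_par /lvl -[sval w]/(val w); case/lastP: (val w) => // s a _.
exists a; first by rewrite mem_enum.
rewrite size_rcons /=; by rewrite -[in take _ _]cats1 take_size_cat.
Qed.

Lemma children_uniq v : uniq (children v).
Proof.
apply: pmap_sub_uniq; rewrite map_inj_uniq ?enum_uniq// => a b.
by move/rcons_inj => [].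
Qed.

Lemma size_children v : size (children v) = if lvl v == 0 then d.+1 else d.
Proof.
rewrite size_pmap_sub count_map /lvl; case E : (val v) => [|b s] /=.
  rewrite (eq_count (a2 := predT)) ?count_predT ?size_enum_ord// => a.
rewrite (eq_count (a2 := predC1 (last b s))) => [|a /=].
  rewrite -[RHS]/(d.+1.-1) -[X in X.-1](size_enum_ord d.+1) -(count_predC (pred1 (last b s))).
  by rewrite (count_uniq_mem _ (enum_uniq _)) mem_enum.
rewrite /reduced /= rcons_path; have := valP v; rewrite E /= => -> /=.
by rewrite eq_sym.
Qed.

Lemma nbrsE v : nbrs v = children v ++ (if lvl v == 0 then [::] else [:: par v]).
Proof. by rewrite /nbrs parentE. Qed.

Lemma size_nbrs v : size (nbrs v) = d.+1.
Proof. by rewrite nbrsE size_cat size_children; case: eqP => _ /=; rewrite ?addn0 ?addn1. Qed.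

Lemma mem_nbrs v w : (w \in nbrs v) = (w \in children v) || (v \in children w).
Proof.
rewrite nbrsE mem_cat; congr (_ || _); rewrite mem_children.
by case: eqP => //= _; rewrite inE eq_sym.
Qed.

Lemma nbrs_sym v w : (w \in nbrs v) = (v \in nbrs w).
Proof. by rewrite !mem_nbrs orbC. Qed.

Lemma par_notin_children v : par v \notin children v.
Proof.
rewrite mem_children lvl_par; apply/negP => /andP[+ /eqP/(congr1 lvl)].
by rewrite !lvl_par; case: (lvl v) => [|[|n]] //= _; lia.
Qed.

Lemma nbrs_uniq v : uniq (nbrs v).
Proof.
rewrite nbrsE cat_uniq children_uniq /=; case: eqP => _ //=.
by rewrite orbF andbT par_notin_children.
Qed.

Lemma par_nbrs v : v != troot -> par v \in nbrs v.
Proof. by rewrite -lvl_eq0 => v0; rewrite mem_nbrs [X in _ || X]mem_children v0 eqxx orbT. Qed.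

Lemma rest_par v : v != troot -> [seq x <- nbrs v | x != par v] = children v.
Proof.
rewrite -lvl_eq0 => v0; rewrite nbrsE (negPf v0) filter_cat /= eqxx /= cats0.
apply/all_filterP/allP => x xv; apply: contraTneq xv => ->.
exact: par_notin_children.
Qed.

Lemma size_rest v x : x \in nbrs v -> size [seq y <- nbrs v | y != x] = d.
Proof.
move=> xv; have := count_predC (pred1 x) (nbrs v).
by rewrite (count_uniq_mem _ (nbrs_uniq v)) xv size_nbrs add1n size_filter => -[] ->.
Qed.

Fixpoint lev n : seq (vertex d) :=
  if n is m.+1 then flatten (map (@children d) (lev m)) else [:: troot].

(** Only levels strictly below n: the ball is empty for n = 0, and its outer boundary is exactly
    [lev n]. *)
Fixpoint tball n : seq (vertex d) := if n is m.+1 then tball m ++ lev m else [::].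

Lemma mem_lev n v : (v \in lev n) = (lvl v == n).
Proof.
elim: n v => [|n IH] v; first by rewrite inE lvl_eq0.
apply/flattenP/eqP => [[_ /mapP[x +] -> ]|vn].
  rewrite IH mem_children => /eqP xn /andP[v0 /eqP vx].
  by rewrite -xn -vx lvl_par prednK// lt0n.
exists (children (par v)); last by rewrite mem_children vn eqxx.
by apply: map_f; rewrite IH lvl_par vn.
Qed.

Lemma lev_uniq n : uniq (lev n).
Proof.
elim: n => //= n IH; apply: uniq_flatten_map => // [x|x y z].
  exact: children_uniq.
by rewrite !mem_children => /andP[_ /eqP <-] /andP[_ /eqP <-].
Qed.

Lemma mem_tball n v : (v \in tball n) = (lvl v < n)%N.
Proof.
elim: n => [|n IH] /=; first by rewrite ltn0.
by rewrite mem_cat IH mem_lev ltnS orbC -leq_eqVlt.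
Qed.

Lemma tball_uniq n : uniq (tball n).
Proof.
elim: n => [|n IH] //=; rewrite cat_uniq IH lev_uniq andbT /=.
by apply/hasPn => x; rewrite mem_lev mem_tball => /eqP ->; rewrite ltnn.
Qed.

(** Every vertex but the root is the child of exactly one vertex. A product over the children of a
    ball thus becomes a product over the next ball, which makes the normalisations of the chain
    cancel. *)
Lemma tball_children n : tball n.+1 = troot :: flatten (map (@children d) (tball n)).
Proof.
elim: n => // n IH; transitivity (tball n.+1 ++ lev n.+1) => //.
by rewrite {1}IH -[tball n.+1]/(tball n ++ lev n) map_cat flatten_cat.
Qed.

Hypothesis d_gt0 : (0 < d)%N.

Lemma lev_nonempty n : lev n != [::].
Proof.
elim: n => // n; case E : (lev n) => [|x s] //= _; rewrite E /=.
have : (0 < size (children x))%N by rewrite size_children; case: ifP.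
by case: (children x).
Qed.

Lemma size_tball n : (n <= size (tball n))%N.
Proof.
elim: n => [|n IH] //=; rewrite size_cat -addn1 leq_add// lt0n size_eq0.
exact: lev_nonempty.
Qed.

(** Breadth-first enumeration. The balls extend one another as lists and, for [0 < d], [tball i.+1]
    has more than [i] entries, so the position exists and every larger ball gives the same
    vertex. *)
Definition venum i : vertex d := nth troot (tball i.+1) i.
Definition bsize n := size (tball n).

Lemma bsize_mono m n : (m <= n)%N -> (bsize m <= bsize n)%N.
Proof.
move=> mn; rewrite -(subnKC mn); elim: (n - m)%N => [|k IH]; first by rewrite addn0.
by rewrite addnS /bsize /= size_cat (leq_trans IH)// leq_addr.
Qed.

Lemma nth_tball m n i : (m <= n)%N -> (i < bsize m)%N ->
  nth troot (tball n) i = nth troot (tball m) i.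
Proof.
move=> mn im; rewrite -(subnKC mn); elim: (n - m)%N => [|k IH]; first by rewrite addn0.
rewrite addnS -[tball (m + k).+1]/(tball (m + k) ++ lev (m + k)) nth_cat IH.
by rewrite (leq_trans im (bsize_mono (leq_addr k m))).
Qed.

Lemma venumE n i : (i < bsize n)%N -> venum i = nth troot (tball n) i.
Proof.
move=> ib; rewrite /venum; have [ni|ni] := leqP n i.+1; first by rewrite (nth_tball ni).
by rewrite [RHS](nth_tball (ltnW ni))// (leq_trans _ (size_tball i.+1)).
Qed.

Definition vprefix n := map venum (iota 0 n).

Lemma tball_vprefix n : tball n = vprefix (bsize n).
Proof.
apply: (@eq_from_nth _ troot); first by rewrite size_map size_iota.
move=> i ib; rewrite (nth_map 0%N) ?size_iota// nth_iota// add0n.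
by rewrite (venumE ib).
Qed.

Lemma venum_inj : injective venum.
Proof.
move=> i j; pose n := (maxn i j).+1.
have hi : (i < bsize n)%N by rewrite (leq_trans _ (size_tball n))// ltnS leq_maxl.
have hj : (j < bsize n)%N by rewrite (leq_trans _ (size_tball n))// ltnS leq_maxr.
rewrite (venumE hi) (venumE hj) => /eqP.
by rewrite nth_uniq ?tball_uniq// => /eqP.
Qed.

Lemma venum_index n v : (lvl v < n)%N -> exists2 i, (i < bsize n)%N & venum i = v.
Proof.
rewrite -mem_tball => vn; exists (index v (tball n)); first by rewrite /bsize index_mem.
by rewrite (@venumE n) /bsize ?index_mem// nth_index.
Qed.

Lemma venum_lt_bsize n i : (i < bsize n)%N = (lvl (venum i) < n)%N.
Proof.
apply/idP/idP => [ib|/venum_index[j jb /venum_inj <-]//].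
by rewrite -mem_tball (venumE ib) mem_nth.
Qed.

Lemma venum0 : venum 0 = troot.
Proof. by []. Qed.

Lemma venum_root i : (venum i == troot) = (i == 0%N).
Proof. by rewrite -venum0 (inj_eq venum_inj). Qed.

(** Levels are enumerated in order, so the spin of the parent is already drawn when a vertex is
    reached. *)
Lemma venum_par i : (0 < i)%N -> exists2 j, (j < i)%N & venum j = par (venum i).
Proof.
move=> i0; have := venum_root i; rewrite -lvl_eq0 -(negbK (i == 0)%N) -lt0n i0 /= => l0.
have [|j jb jE] := @venum_index (lvl (venum i)) (par (venum i)).
  by rewrite lvl_par prednK// lt0n l0.
exists j => //; apply: leq_trans jb _; rewrite leqNgt venum_lt_bsize.
by rewrite ltnn.
Qed.

Lemma vprefixS n : vprefix n.+1 = vprefix n ++ [:: venum n].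
Proof.
have e : iota 0 n.+1 = iota 0 n ++ [:: n] by rewrite -addn1 iotaD.
by rewrite /vprefix e map_cat.
Qed.

Lemma mem_vprefix n i : (venum i \in vprefix n) = (i < n)%N.
Proof. by rewrite mem_map ?mem_iota//; exact: venum_inj. Qed.

End Tree.

(** * Sequential construction of measures *)

Definition upd (V : eqType) (S : Type) (eta : V -> S) (v : V) (k : S) : V -> S :=
  fun w => if w == v then k else eta w.

Lemma upd_eq (V : eqType) (S : Type) (eta : V -> S) v k : upd eta v k v = k.
Proof. by rewrite /upd eqxx. Qed.

Lemma upd_neq (V : eqType) (S : Type) (eta : V -> S) v k w : w != v -> upd eta v k w = eta w.
Proof. by rewrite /upd => /negPf ->. Qed.

(** * Cumulative weights of a probability vector on a coded set *)

Section CumulativeWeight.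
Variables (R : realType) (S : choiceType) (code : S -> nat).
Hypothesis code_inj : injective code.

(** [code] need not be onto, so decoding is partial; a number that is no code gets weight 0 in
    [cweight]. *)
Definition codeinv j : option S :=
  if pselect (exists k, code k = j) is left h then Some (sval (cid h)) else None.

Lemma codeinv_code k : codeinv (code k) = Some k.
Proof.
rewrite /codeinv; case: pselect => [h|[]]; last by exists k.
by congr Some; apply: code_inj; case: cid.
Qed.

Lemma codeinvK j k : codeinv j = Some k -> code k = j.
Proof. by rewrite /codeinv; case: pselect => // h [<-]; case: cid. Qed.

Lemma esum_code (F : S -> \bar R) : (forall k, 0 <= F k)%E ->
  (\esum_(k in [set: S]) F k =
   \sum_(j <oo) (if codeinv j is Some k then F k else 0))%E.
Proof.
move=> F0; rewrite nneseries_esumT => [|n]; last by case: codeinv.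
have -> : (\esum_(k in [set: S]) F k =
    \esum_(k in [set: S]) (if codeinv (code k) is Some k' then F k' else 0))%E.
  by apply: eq_esum => k _; rewrite codeinv_code.
rewrite -(esum_image _ code (fun j => if codeinv j is Some k' then F k' else 0)%E);
  last by move=> x y _ _; exact: code_inj.
rewrite esum_mkcond; apply: eq_esum => j _.
case: ifPn => //; rewrite notin_setE => h.
by case E : (codeinv j) => [k|//]; exfalso; apply: h; exists k => //; exact: codeinvK.
Qed.

Definition cweight (f : S -> R) j := if codeinv j is Some k then f k else 0.
Definition cumul (f : S -> R) j := \sum_(0 <= i < j) cweight f i.

Variable f : S -> R.
Hypothesis fs : summ f.
Hypothesis f1 : tot f = 1.

Lemma cweight_ge0 j : 0 <= cweight f j.
Proof. by rewrite /cweight; case: codeinv => // k; exact: fs.1. Qed.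

Lemma cumul_ge0 j : 0 <= cumul f j.
Proof. by apply: sumr_ge0 => i _; exact: cweight_ge0. Qed.

Lemma cumulS k : cumul f (code k).+1 = cumul f (code k) + f k.
Proof. by rewrite /cumul big_nat_recr //= /cweight codeinv_code. Qed.

Lemma cumul_mono i j : (i <= j)%N -> cumul f i <= cumul f j.
Proof.
move=> ij; rewrite /cumul (big_cat_nat (leq0n i) ij) /= lerDl.
by apply: sumr_ge0 => n _; exact: cweight_ge0.
Qed.

Lemma series_cweight : (\sum_(j <oo) (cweight f j)%:E = 1)%E.
Proof.
rewrite -f1 -(esum_tot fs) esum_code => [|k]; last by rewrite lee_fin fs.1.
by apply: eq_eseriesr => j _; rewrite /cweight; case: codeinv.
Qed.

Lemma cumul_le1 j : cumul f j <= 1.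
Proof.
rewrite -lee_fin -series_cweight /cumul -sumEFin.
by apply: nneseries_lim_ge => i _; rewrite lee_fin cweight_ge0.
Qed.

(** The cumulative weights tend to 1, so one of them exceeds [t]; the last weight added to the least
    such sum is positive, hence belongs to a spin. *)
Lemma cumul_cover t : 0 <= t < 1 ->
  exists k, cumul f (code k) <= t < cumul f (code k) + f k.
Proof.
move=> /andP[t0 t1].
have [j tj] : exists j, t < cumul f j.
  apply: contrapT => /forallNP h.
  have : (\sum_(j <oo) (cweight f j)%:E <= t%:E)%E.
    apply: lime_le; first by apply: is_cvg_nneseries => i _; rewrite lee_fin cweight_ge0.
    apply: nearW => n; rewrite sumEFin lee_fin leNgt; apply/negP; exact: h.
  by rewrite series_cweight lee_fin leNgt t1.
case: (ex_minnP (ex_intro (fun j => t < cumul f j) j tj)) => -[|n] tn hn.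
  by move: tn; rewrite /cumul big_geq// ltNge t0.
have nt : cumul f n <= t by rewrite leNgt; apply/negP => /hn; rewrite ltnn.
have : 0 < cweight f n.
  by have := le_lt_trans nt tn; rewrite /cumul big_nat_recr //= ltrDl.
rewrite {1}/cweight; case E : codeinv => [k|]; last by rewrite ltxx.
by move=> _; exists k; rewrite -cumulS (codeinvK E) nt tn.
Qed.

End CumulativeWeight.

(** * Random configurations selected by a uniform point *)

Section SequentialMeasure.
Variables (R : realType) (d : nat) (S : pointedType) (code : S -> nat).
Hypothesis code_inj : injective code.
Hypothesis d_gt0 : (0 < d)%N.
Variable (K : nat -> (vertex d -> S) -> S -> R).
Let e := @venum d.

Definition agreen n (eta eta' : vertex d -> S) := forall i, (i < n)%N -> eta (e i) = eta' (e i).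

Hypothesis K_local : forall n eta eta', agreen n eta eta' -> K n eta = K n eta'.
Hypothesis K_summ : forall n eta, summ (K n eta).
Hypothesis K_tot : forall n eta, tot (K n eta) = 1.

(* [0, 1[ is cut successively: the spins at the first n vertices determine the
   interval [cint n eta], which starts at [cleft n eta] and has length
   [cprob n eta].  A uniform point thus selects a configuration. *)
Definition cprob n eta : R := \prod_(i < n) K i eta (eta (e i)).
Definition cleft n eta : R :=
  \sum_(i < n) cprob i eta * cumul code (K i eta) (code (eta (e i))).
Definition cint n eta (x : R) := cleft n eta <= x < cleft n eta + cprob n eta.

Lemma agreenS n eta eta' :
  agreen n.+1 eta eta' <-> agreen n eta eta' /\ eta (e n) = eta' (e n).
Proof.
split=> [h|[h hn] i]; last by rewrite ltnS leq_eqVlt => /orP[/eqP ->//|/h].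
by split=> [i /ltnW ni|]; apply: h.
Qed.

Lemma agreen_le m n eta eta' : (m <= n)%N -> agreen n eta eta' -> agreen m eta eta'.
Proof. by move=> mn h i im; apply: h; apply: leq_trans mn. Qed.

Lemma agreen_sym n eta eta' : agreen n eta eta' -> agreen n eta' eta.
Proof. by move=> h i im; rewrite h. Qed.

Lemma agreen_upd n eta k : agreen n (upd eta (e n) k) eta.
Proof.
move=> i ni; rewrite upd_neq//; apply: contraTneq ni => /(venum_inj d_gt0) ->.
by rewrite ltnn.
Qed.

Lemma cprob_local n eta eta' : agreen n eta eta' -> cprob n eta = cprob n eta'.
Proof.
move=> h; apply: eq_bigr => i _; rewrite (K_local (agreen_le (ltnW (ltn_ord i)) h)).
by rewrite h.
Qed.

Lemma cleft_local n eta eta' : agreen n eta eta' -> cleft n eta = cleft n eta'.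
Proof.
move=> h; apply: eq_bigr => i _.
have hi := agreen_le (ltnW (ltn_ord i)) h.
by rewrite (cprob_local hi) (K_local hi) h.
Qed.

Lemma cint_local n eta eta' x : agreen n eta eta' -> cint n eta x -> cint n eta' x.
Proof. by move=> h; rewrite /cint (cprob_local h) (cleft_local h). Qed.

Lemma cprobS n eta : cprob n.+1 eta = cprob n eta * K n eta (eta (e n)).
Proof. by rewrite /cprob big_ord_recr. Qed.

Lemma cleftS n eta :
  cleft n.+1 eta = cleft n eta + cprob n eta * cumul code (K n eta) (code (eta (e n))).
Proof. by rewrite /cleft big_ord_recr. Qed.

Lemma cprob_ge0 n eta : 0 <= cprob n eta.
Proof. by apply: prodr_ge0 => i _; exact: (K_summ _ _).1. Qed.

Lemma cint_prev n eta x : cint n.+1 eta x -> cint n eta x.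
Proof.
rewrite /cint cleftS cprobS => /andP[h1 h2].
have c0 := cumul_ge0 code (K_summ n eta) (code (eta (e n))).
have := cumul_le1 code_inj (K_summ n eta) (K_tot n eta) (code (eta (e n))).+1.
rewrite cumulS// => c1; have p0 := cprob_ge0 n eta; apply/andP; split.
  by rewrite (le_trans _ h1)// lerDl mulr_ge0.
rewrite (lt_le_trans h2)// -addrA -mulrDr lerD2l -[leRHS]mulr1.
by rewrite ler_wpM2l.
Qed.

Lemma cint_next n eta x : cint n eta x -> exists k, cint n.+1 (upd eta (e n) k) x.
Proof.
move=> /andP[h1 h2].
have p0 : 0 < cprob n eta by rewrite -(ltrD2l (cleft n eta)) addr0 (le_lt_trans h1).
have ht : 0 <= (x - cleft n eta) / cprob n eta < 1.
  by rewrite ltr_pdivrMr// mul1r ltrBlDl h2 divr_ge0 ?subr_ge0// (ltW p0).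
have [k] := cumul_cover code_inj (K_summ n eta) (K_tot n eta) ht.
rewrite ler_pdivlMr// ltr_pdivrMr// => /andP[k1 k2].
exists k; rewrite /cint cleftS cprobS upd_eq.
have ag := @agreen_upd n eta k.
rewrite (cprob_local ag) (cleft_local ag) (K_local ag).
by apply/andP; split; lra.
Qed.

(** At the first disagreement the two intervals are disjoint: the cumulative weight at the larger
    code already includes the whole weight of the smaller one. *)
Lemma cint_uniq n eta eta' x : cint n eta x -> cint n eta' x -> agreen n eta eta'.
Proof.
elim: n => [|n IH] h h'; first by [].
have ag := IH (cint_prev h) (cint_prev h').
apply/agreenS; split=> //; apply: contrapT => /eqP ne; clear IH.
wlog lt : eta eta' h h' ag ne / (code (eta (e n)) < code (eta' (e n)))%N => [hw|].
  case: (ltngtP (code (eta (e n))) (code (eta' (e n)))) => [lt|lt|/code_inj eq].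
  - exact: (hw eta eta').
  - by apply: (hw eta' eta) => //; [exact: agreen_sym|rewrite eq_sym].
  - by rewrite eq eqxx in ne.
move: h h'; rewrite /cint !cleftS !cprobS (cprob_local ag) (cleft_local ag) (K_local ag).
have c1 := cumul_mono code (K_summ n eta') lt; rewrite cumulS// in c1.
have := ler_wpM2l (cprob_ge0 n eta') c1; rewrite mulrDr => c2 /andP[_ h1] /andP[h2 _].
by have := lt_le_trans h1 (le_trans _ h2); rewrite -addrA lerD2l => /(_ c2); rewrite ltxx.
Qed.

Definition cnext n x eta : vertex d -> S :=
  if pselect (exists k, cint n.+1 (upd eta (e n) k) x) is left h
  then upd eta (e n) (sval (cid h)) else eta.

Fixpoint cstate n x : vertex d -> S :=
  if n is m.+1 then cnext m x (cstate m x) else fun=> point.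

Lemma cint0 eta x : (0 <= x < 1) -> cint 0 eta x.
Proof. by rewrite /cint /cleft /cprob !big_ord0 add0r. Qed.

Lemma cint_state n x : 0 <= x < 1 -> cint n (cstate n x) x.
Proof.
move=> x01; elim: n => [|n IH]; first exact: cint0.
rewrite /= /cnext; case: pselect => [h|[]]; first by case: cid.
exact: cint_next.
Qed.

Lemma cstate_agree m n x : (m <= n)%N -> agreen m (cstate n x) (cstate m x).
Proof.
move=> mn; rewrite -(subnKC mn); elim: (n - m)%N => [|k IH]; first by rewrite addn0.
rewrite addnS => i im; rewrite -IH//= /cnext; case: pselect => // h.
by apply: agreen_upd; rewrite (leq_trans im)// leq_addr.
Qed.

Lemma ex_index v : exists i, e i = v.
Proof. by have [i _ iv] := venum_index d_gt0 (ltnSn (lvl v)); exists i. Qed.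

Definition vindex v : nat := sval (cid (ex_index v)).

Lemma vindexK v : e (vindex v) = v.
Proof. by rewrite /vindex; case: cid. Qed.

Lemma venumK i : vindex (e i) = i.
Proof. by apply: (venum_inj d_gt0); exact: vindexK. Qed.

Definition sampler (x : R) : ConfSpace d S := fun v =>
  if (0 <= x < 1) then cstate (vindex v).+1 x v else point.

Lemma sampler_int n x : 0 <= x < 1 -> cint n (sampler x) x.
Proof.
move=> x01; apply: cint_local (cint_state n x01) => i ni.
by rewrite /sampler x01 venumK (cstate_agree x ni).
Qed.

Lemma sampler_agree n eta x : 0 <= x < 1 -> (agreen n eta (sampler x) <-> cint n eta x).
Proof.
move=> x01; split=> h; last exact: cint_uniq h (sampler_int n x01).
exact: cint_local (agreen_sym h) (sampler_int n x01).
Qed.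

Lemma measurable_cint n eta : @measurable _ (measurableTypeR R) [set x : R | cint n eta x].
Proof.
have -> : [set x : R | cint n eta x] = `[cleft n eta, (cleft n eta + cprob n eta)[%classic.
  by apply/seteqP; split => x /=; rewrite in_itv.
exact: measurable_itv.
Qed.

(** Configurations are uncountable, but finite lists of codes are countable and realise every
    prefix; preimages of cylinders become countable unions of intervals. *)
Definition codeinv_conf (s : seq nat) : vertex d -> S := fun v =>
  odflt point (codeinv code (nth 0%N s (vindex v))).

Lemma measurable_sampler :
  @measurable_fun _ _ (measurableTypeR R) (ConfSpace d S) [set: R] sampler.
Proof.
apply: (@measurability _ _ _ (ConfSpace d S) _ _ (@cyl d S)) => //.
move=> _ [_ [v [k ->] <-]]; rewrite setTI.
pose i := vindex v.
have m01 : @measurable _ (measurableTypeR R) [set x : R | 0 <= x < 1].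
  have -> : [set x : R | 0 <= x < 1] = `[0, 1[%classic.
    by apply/seteqP; split => x /=; rewrite in_itv.
  exact: measurable_itv.
have -> : sampler @^-1` [set s | s v = k] =
  ([set x : R | 0 <= x < 1] `&` \bigcup_(s : seq nat)
     ([set x | cint i.+1 (codeinv_conf s) x] `&` [set x | codeinv_conf s v = k])) `|`
  (~` [set x : R | 0 <= x < 1] `&` [set x | point = k]).
  apply/seteqP; split=> [x /= xk|x /=].
    case: (boolP (0 <= x < 1)) => x01; last by right; rewrite -xk /sampler (negPf x01).
    left; split=> //.
    pose s := [seq code (sampler x (e j)) | j <- iota 0 i.+1].
    have sE : agreen i.+1 (codeinv_conf s) (sampler x).
      move=> j ji; rewrite /codeinv_conf venumK /s (nth_map 0%N) ?size_iota//.
      by rewrite nth_iota// add0n codeinv_code.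
    exists s => //; split=> /=; first exact/sampler_agree.
    by rewrite -xk -[in RHS](vindexK v) -sE// vindexK.
  case=> [[x01 [s _ [h <-]]]|[x01 <-]]; last by rewrite /sampler; case: ifP.
  by have := (sampler_agree _ _ x01).2 h i (ltnSn _); rewrite vindexK => ->.
apply: measurableU; apply: measurableI => //.
- apply: countable_bigcupT_measurable => // s; apply: measurableI; first exact: measurable_cint.
  case: (pselect (codeinv_conf s v = k)) => h.
    by have -> : [set _ : R | codeinv_conf s v = k] = setT; [by apply/seteqP; split => // x|].
  by have -> : [set _ : R | codeinv_conf s v = k] = set0; [by apply/seteqP; split => // x|].
- exact: measurableC.
- case: (pselect (point = k)) => h.
    by have -> : [set _ : R | point = k] = setT; [by apply/seteqP; split => // x|].
  by have -> : [set _ : R | point = k] = set0; [by apply/seteqP; split => // x|].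
Qed.

Lemma sequential_measure : exists mu : probability (ConfSpace d S) R,
  forall n eta, mu [set s | agreen n eta s] = (cprob n eta)%:E.
Proof.
have m01 : measurable (`[0, 1[%classic : set R) by exact: measurable_itv.
pose nu := pushforward (mrestr lebesgue_measure m01) sampler.
have nuE n eta : nu [set s | agreen n eta s] = (cprob n eta)%:E.
  rewrite /nu /pushforward /mrestr.
  have -> : sampler @^-1` [set s | agreen n eta s] `&` `[0, 1[%classic =
      `[cleft n eta, (cleft n eta + cprob n eta)[%classic.
    apply/seteqP; split=> x /=; rewrite !in_itv /=.
      by move=> [h x01]; exact/(sampler_agree _ _ x01).
    move=> h; suff x01 : 0 <= x < 1 by split=> //; apply/(sampler_agree _ _ x01).
    elim: n h => [|n IH] h; last by apply: IH; exact: cint_prev.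
    by move: h; rewrite /cint /cleft /cprob !big_ord0 add0r.
  rewrite lebesgue_measure_itv /= lte_fin ltrDl -EFinD addrAC subrr add0r.
  by case: ifPn => //; rewrite -leNgt => h; congr EFin; apply/eqP; rewrite eq_le h cprob_ge0.
(* The mass is already 1; normalising leaves the measure unchanged and supplies the probability
   structure. *)
pose P : probability (measurableTypeR R) R := mnormalize (mrestr lebesgue_measure m01) point.
have PE A : P A = mrestr lebesgue_measure m01 A.
  have n1 : mrestr lebesgue_measure m01 [set: measurableTypeR R] = 1%E.
    by rewrite /mrestr setTI lebesgue_measure_itv /= lte_fin ltr01 sube0.
  by rewrite /P /= /mnormalize; move: n1 => /= ->; rewrite onee_eq0 /= invr1 mule1.
exists (distribution P 
  (@mfun_Sub _ _ (measurableTypeR R) (ConfSpace d S) _ (mem_set measurable_sampler))) => n eta.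
rewrite /distribution /pushforward /= [LHS]PE; exact: nuE.
Qed.
End SequentialMeasure.

(** * Boundary laws *)

(** Factors are exchanged one at a time; each exchange costs [e * B i] times the bounds of the other
    factors. *)
Lemma prodr_perturb (R : realType) (I : eqType) (s : seq I) (f f' B : I -> R) (e : R) :
  0 <= e -> (forall i, 0 <= f i <= B i) -> (forall i, 0 <= f' i <= B i) ->
  (forall i, f i <= f' i + e * B i) ->
  \prod_(i <- s) f i <= \prod_(i <- s) f' i + (size s)%:R * e * \prod_(i <- s) B i.
Proof.
move=> e0 fB f'B ff'; elim: s => [|i s IH].
  by rewrite !big_nil mul0r mul0r addr0.
rewrite !big_cons /=.
have p0 (h : I -> R) : (forall i, 0 <= h i <= B i) -> 0 <= \prod_(j <- s) h j.
  by move=> hB; apply: prodr_ge0 => j _; case/andP: (hB j).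
have pB (h : I -> R) : (forall i, 0 <= h i <= B i) -> \prod_(j <- s) h j <= \prod_(j <- s) B j.
  by move=> hB; apply: ler_prod => j _.
have := p0 f fB; have := p0 f' f'B; have := pB f fB; have := pB f' f'B.
have := ff' i; have /andP[] := fB i; have /andP[] := f'B i; move: IH.
set X := \prod_(j <- s) f j; set Y := \prod_(j <- s) f' j; set Z := \prod_(j <- s) B j.
move: (f i) (f' i) (B i) => x y z IH y0 yz x0 xz xy YZ XZ Y0 X0.
rewrite -addn1 natrD.
have h1 : x * X <= (y + e * z) * X by rewrite ler_wpM2r.
have h2 : y * X <= y * (Y + (size s)%:R * e * Z) by rewrite ler_wpM2l.
have nz : 0 <= (size s)%:R :> R by [].
have ez : 0 <= e * z by rewrite mulr_ge0// (le_trans y0).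
have h3 : e * z * X <= e * z * Z by rewrite ler_wpM2l.
have h4 : y * ((size s)%:R * e * Z) <= z * ((size s)%:R * e * Z).
  by rewrite ler_wpM2r// mulr_ge0 ?mulr_ge0// (le_trans X0).
by nra.
Qed.

Lemma half_expr_small (R : realType) (c y : R) : 0 < y -> exists n, c * (1 / 2) ^+ n < y.
Proof.
move=> y0; have [c0|c0] := leP c 0.
  by exists 0%N; rewrite expr0 mulr1 (le_lt_trans c0).
have cy0 : 0 <= c / y by rewrite divr_ge0 ?ltW.
have := archi_boundP cy0; set n := Num.bound _ => H; exists n.
rewrite expr_div_n expr1n mulrA mulr1 ltr_pdivrMr ?exprn_gt0//.
have : (n%:R : R) <= 2 ^+ n by rewrite -natrX ler_nat ltnW// ltn_expl.
rewrite ltr_pdivrMr// in H.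
by move=> h; rewrite (lt_le_trans H)// mulrC ler_wpM2l// ltW.
Qed.

Lemma le_half_expr (R : realType) (c y : R) : (forall n, y <= c * (1 / 2) ^+ n) -> y <= 0.
Proof.
move=> h; rewrite leNgt; apply/negP => /(half_expr_small c)[n].
by rewrite ltNge h.
Qed.

(** The intervals of radius [e n] around [x n] meet pairwise, so the supremum of the left ends lies
    in all of them. The limit comes with its rate. *)
Lemma nested_point (R : realType) (x e : nat -> R) :
  (forall n m, x n - e n <= x m + e m) -> exists L, forall n, `|L - x n| <= e n.
Proof.
move=> h; pose A := [set y | exists n, y = x n - e n].
have ubA m : ubound A (x m + e m) by move=> _ [n ->].
exists (sup A) => n; rewrite ler_norml; apply/andP; split.
  rewrite lerBrDr addrC; apply: ub_le_sup; first by exists (x 0%N + e 0%N).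
  by exists n.
rewrite lerBlDr addrC; apply: ge_sup => //; first by exists (x 0%N - e 0%N), 0%N.
Qed.

(* [M w k] stands for the message of the subtree at [w] when the parent of [w]
   has spin [k]; [a w] is the reference spin at [w], [b w] the one at its parent,
   and [B] the a priori bound. *)
Section BoundaryLaw.
Variables (R : realType) (V : eqType) (S : choiceType) (ch : V -> seq V).
Variables (phi : V -> S -> S -> R) (g : V -> S -> R) (a b : V -> S).
Variables (B : V -> S -> R) (D : nat) (th : R).

Definition bweight (M : V -> S -> R) w l := g w l * \prod_(x <- ch w) M x l.

Hypothesis phi_gt0 : forall w k l, 0 < phi w k l.
Hypothesis g_gt0 : forall w l, 0 < g w l.
Hypothesis g_a : forall w, g w (a w) = 1.
Hypothesis B_gt0 : forall w k, 0 < B w k.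
Hypothesis B_b : forall w, B w (b w) = 1.
Hypothesis ch_b : forall w x, x \in ch w -> b x = a w.
Hypothesis size_ch : forall w, (size (ch w) <= D)%N.
Hypothesis th_ge0 : 0 <= th.
Hypothesis thD : 4 * D%:R * th <= 1.
Hypothesis H1 : forall w k, k != b w ->
  phi w k (a w) <= (1 - th) * B w k * phi w (b w) (a w).
Hypothesis H2 : forall w k, 
  summ (off (a w) (fun l => phi w k l * bweight B w l)) /\
  tot (off (a w) (fun l => phi w k l * bweight B w l)) <= th * B w k * phi w (b w) (a w).

Definition admissible (M : V -> S -> R) :=
  (forall w k, 0 <= M w k <= B w k) /\ (forall w, M w (b w) = 1).

Definition bnorm (M : V -> S -> R) w k := tot (fun l => phi w k l * bweight M w l).
Definition bstep (M : V -> S -> R) w k := bnorm M w k / bnorm M w (b w).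

Lemma bweight_ge0 M w l : admissible M -> 0 <= bweight M w l.
Proof.
move=> [MB _]; rewrite mulr_ge0 ?(ltW (g_gt0 _ _))//.
by apply: prodr_ge0 => x _; case/andP: (MB x l).
Qed.

Lemma bweight_a M w : (forall w, M w (b w) = 1) -> bweight M w (a w) = 1.
Proof.
move=> M1; rewrite /bweight g_a mul1r big_seq big1// => x xw.
by rewrite -(ch_b xw) M1.
Qed.

Lemma bweight_le M w l : admissible M -> bweight M w l <= bweight B w l.
Proof.
move=> [MB _]; rewrite ler_wpM2l ?(ltW (g_gt0 _ _))//.
by apply: ler_prod => x _; exact: MB.
Qed.

Lemma off_bnorm M w k : admissible M ->
  summ (off (a w) (fun l => phi w k l * bweight M w l)) /\
  tot (off (a w) (fun l => phi w k l * bweight M w l)) <= th * B w k * phi w (b w) (a w).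
Proof.
move=> aM; have [s1 s2] := H2 w k.
have [] := @summ_le _ _ (off (a w) (fun l => phi w k l * bweight M w l)) _ _ _ s1.
- move=> l; rewrite /off; case: ifP => // _.
  by rewrite mulr_ge0 ?bweight_ge0// ltW.
- move=> l; rewrite /off; case: ifP => // _.
  by rewrite ler_wpM2l ?bweight_le// ltW.
by move=> ? s3; split=> //; apply: le_trans s3 s2.
Qed.

Lemma bnormE M w k : admissible M ->
  summ (fun l => phi w k l * bweight M w l) /\
  bnorm M w k = phi w k (a w) + tot (off (a w) (fun l => phi w k l * bweight M w l)).
Proof.
move=> aM; have [s1 _] := off_bnorm w k aM.
have [] := tot_split s1; first by rewrite mulr_ge0 ?bweight_ge0// ltW.
by rewrite (bweight_a _ aM.2) mulr1.
Qed.

Lemma bnorm_ge M w k : admissible M -> phi w k (a w) <= bnorm M w k.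
Proof.
move=> aM; have [_ ->] := bnormE w k aM; rewrite lerDl tot_ge0//.
exact: (off_bnorm w k aM).1.1.
Qed.

Lemma bnorm_gt0 M w k : admissible M -> 0 < bnorm M w k.
Proof. by move=> aM; apply: lt_le_trans (bnorm_ge w k aM). Qed.

(** The reference summand takes at most the share [1 - th] of the bound and the excited ones at most
    [th]; the denominator is at least [phi w (b w) (a w)]. *)
Lemma bstep_admissible M : admissible M -> admissible (bstep M).
Proof.
move=> aM; split=> w; last by rewrite /bstep divff// gt_eqF ?bnorm_gt0.
move=> k; rewrite /bstep; apply/andP; split.
  by rewrite divr_ge0 ?ltW ?bnorm_gt0.
have [->|kb] := eqVneq k (b w); first by rewrite B_b divff ?lexx// gt_eqF ?bnorm_gt0.
rewrite ler_pdivrMr ?bnorm_gt0//.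
apply: (@le_trans _ _ (B w k * phi w (b w) (a w))); last first.
  by rewrite ler_wpM2l ?bnorm_ge// ltW.
have [_ ->] := bnormE w k aM; have [_ h2] := off_bnorm w k aM.
by have h1 := H1 kb; lra.
Qed.

(* The term at the reference spin does not depend on the messages; the others
   carry the factor [th]. *)
Lemma bnorm_perturb M M' e w k : admissible M -> admissible M' -> 0 <= e ->
  (forall x k, M x k <= M' x k + e * B x k) ->
  bnorm M w k <= bnorm M' w k + D%:R * e * (th * B w k * phi w (b w) (a w)).
Proof.
move=> aM aM' e0 MM'; have [_ ->] := bnormE w k aM; have [_ ->] := bnormE w k aM'.
rewrite -addrA lerD2l.
have [s1 _] := off_bnorm w k aM; have [s2 _] := off_bnorm w k aM'.
have [s3 h3] := H2 w k.
have De0 : 0 <= D%:R * e by rewrite mulr_ge0.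
have [s4 t4] := totZ De0 s3; have [s5 t5] := totD s2 s4.
have [] := summ_le s1.1 _ s5.
  move=> l; rewrite /off; case: ifP => _; first by rewrite mulr0 addr0.
  rewrite /bweight; set X := \prod_(x <- _) M x l; set Y := \prod_(x <- _) M' x l.
  set Z := \prod_(x <- _) B x l.
  have -> : phi w k l * (g w l * Y) + D%:R * e * (phi w k l * (g w l * Z)) =
     phi w k l * (g w l * (Y + D%:R * e * Z)) by ring.
  do 2 (apply: ler_wpM2l; first exact: ltW).
  apply: (le_trans (prodr_perturb (ch w) e0 (aM.1^~ l) (aM'.1^~ l) (MM'^~ l))).
  rewrite lerD2l ler_wpM2r//; first by apply: prodr_ge0 => x _; rewrite ltW.
  by rewrite ler_wpM2r// ler_nat.
rewrite t5 t4 => _ /le_trans; apply.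
by rewrite lerD2l ler_wpM2l.
Qed.

(** With [t = D * e * th], the numerator moves by at most [t * B w k] and the denominator by at most
    [t], both relative to the denominator. As the quotient is at most [B w k], the total is
    [2 * t * B w k], and [4 * D * th <= 1] makes this [e / 2 * B w k]. *)
Lemma bstep_contract M M' e : admissible M -> admissible M' -> 0 <= e ->
  (forall x k, `|M x k - M' x k| <= e * B x k) ->
  (forall x k, `|bstep M x k - bstep M' x k| <= e / 2 * B x k).
Proof.
move=> aM aM' e0 MM' w k.
have h1 x l : M x l <= M' x l + e * B x l.
  by have := MM' x l; rewrite ler_norml => /andP[_]; rewrite lerBlDl.
have h2 x l : M' x l <= M x l + e * B x l.
  by have := MM' x l; rewrite distrC ler_norml => /andP[_]; rewrite lerBlDl.
have := bnorm_perturb w k aM aM' e0 h1; have := bnorm_perturb w k aM' aM e0 h2.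
have := bnorm_perturb w (b w) aM aM' e0 h1; have := bnorm_perturb w (b w) aM' aM e0 h2.
have /andP[] := (bstep_admissible aM').1 w k.
have := bnorm_ge w (b w) aM; have := bnorm_gt0 w (b w) aM; have := bnorm_gt0 w (b w) aM'.
have := phi_gt0 w (b w) (a w); have := B_gt0 w k.
rewrite B_b /bstep mulr1.
move: (bnorm M w k) (bnorm M w (b w)) (bnorm M' w k) (bnorm M' w (b w)).
move: (phi w (b w) (a w)) (B w k) => p Bk n m n' m' Bp pp m'p mp pm q0 qB c1 c2 c3 c4.
set t := D%:R * e * th; have t0 : 0 <= t by rewrite !mulr_ge0.
have te : t * 4 <= e.
  have -> : t * 4 = (4 * D%:R * th) * e by rewrite /t; ring.
  by rewrite -[leRHS]mul1r ler_wpM2r.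
set q := n' / m' in q0 qB *.
have n'E : n' = q * m' by rewrite /q divfK// gt_eqF.
have {}c1 : m' - m <= t * m by rewrite (le_trans (y := t * p))// ?ler_wpM2l// /t; lra.
have {}c2 : m - m' <= t * m by rewrite (le_trans (y := t * p))// ?ler_wpM2l// /t; lra.
have tBm : t * Bk * p <= t * Bk * m by rewrite ler_wpM2l// mulr_ge0// ltW.
have {}c3 : n' - n <= t * Bk * m by rewrite (le_trans _ tBm)// /t; lra.
have {}c4 : n - n' <= t * Bk * m by rewrite (le_trans _ tBm)// /t; lra.
have -> : n / m - q = ((n - n') + q * (m' - m)) / m.
  by rewrite n'E; field; rewrite gt_eqF.
rewrite normrM (gtr0_norm (x := m^-1)) ?invr_gt0// ler_pdivrMr//.
have h5 : `|m' - m| <= t * m by rewrite ler_norml; apply/andP; split; lra.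
have h6 : `|n - n'| <= t * Bk * m by rewrite ler_norml; apply/andP; split; lra.
have h7 : `|q * (m' - m)| <= Bk * (t * m).
  by rewrite normrM (ger0_norm q0) ler_pM.
rewrite (le_trans (ler_normD _ _))// (le_trans (lerD h6 h7))//.
have : t * 4 * (Bk * m) <= e * (Bk * m) by rewrite ler_wpM2r// mulr_ge0 ?ltW.
by lra.
Qed.

Lemma boundary_law : exists M : V -> S -> R,
  [/\ forall w k, 0 < M w k <= B w k, forall w, M w (b w) = 1 &
   forall w k, summ (fun l => phi w k l * bweight M w l) /\
     bnorm M w k = M w k * bnorm M w (b w)].
Proof.
(* The indicator of the parent's reference spin is admissible, and the first step moves it by at
   most [B]. *)
pose it n := iter n bstep (fun w k => if k == b w then 1 else 0).
have ait n : admissible (it n).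
  elim: n => [|n IH]; last by rewrite /it iterS; exact: bstep_admissible.
  split=> [w k|w]; rewrite /it /=; last by rewrite eqxx.
  by have [->|] := eqVneq k (b w); rewrite ?B_b ?lexx ?ler01 ?ltW.
have itd n w k : `|it n.+1 w k - it n w k| <= (1/2) ^+ n * B w k.
  elim: n w k => [|n IH] w k.
    rewrite expr0 mul1r; have /andP[? ?] := (ait 1%N).1 w k.
    have /andP[? ?] := (ait 0%N).1 w k; rewrite ler_norml; apply/andP; split; lra.
  rewrite /it !iterS -/(it n); have -> : (1/2 : R) ^+ n.+1 = (1/2) ^+ n / 2.
    by rewrite exprS; field.
  have e0 : 0 <= (1/2) ^+ n :> R by rewrite exprn_ge0// divr_ge0.
  exact: (bstep_contract (ait n.+1) (ait n) e0 IH).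
have itm n m w k : `|it (n + m)%N w k - it n w k| <= 2 * (1/2) ^+ n * B w k.
  suff : `|it (n + m)%N w k - it n w k| <= 2 * ((1/2) ^+ n - (1/2) ^+ (n + m)) * B w k.
    move=> /le_trans; apply; apply: ler_wpM2r; first exact: ltW.
    by apply: ler_wpM2l => //; rewrite gerBl exprn_ge0// divr_ge0.
  elim: m => [|m IH]; first by rewrite addn0 !subrr mulr0 mul0r normr0.
  rewrite addnS -(subrKA (it (n + m)%N w k)) (le_trans (ler_normD _ _))//.
  rewrite (le_trans (lerD (itd _ _ _) IH))// exprS.
  by rewrite -mulrDl; apply: ler_wpM2r; [exact: ltW|lra].
have /choice[M HM] : forall wk : V * S, exists L,
    forall n, `|L - it n wk.1 wk.2| <= 2 * (1/2) ^+ n * B wk.1 wk.2.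
  move=> [w k]; apply: (@nested_point _ (fun n => it n w k)) => n m /=.
  wlog nm : n m / (n <= m)%N => [hw|].
    case: (leqP n m) => [|/ltnW] nm; first exact: hw.
    have := itm m (n - m)%N w k; rewrite subnKC// ler_norml => /andP[_ h].
    have : 0 <= 2 * (1/2) ^+ n * B w k by rewrite !mulr_ge0 ?exprn_ge0 ?divr_ge0// ltW.
    by lra.
  have := itm n (m - n)%N w k; rewrite subnKC// ler_norml => /andP[h _].
  have : 0 <= 2 * (1/2) ^+ m * B w k by rewrite !mulr_ge0 ?exprn_ge0 ?divr_ge0// ltW.
  by lra.
pose M' w k := M (w, k).
have MI n w k : `|M' w k - it n w k| <= 2 * (1/2) ^+ n * B w k by exact: (HM (w, k) n).
have aM : admissible M'.
  split=> [w k|w].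
    apply/andP; split; rewrite -subr_le0; apply: (@le_half_expr _ (2 * B w k)) => n.
      have /andP[+ _] := (ait n).1 w k; have := MI n w k.
      by rewrite ler_norml => /andP[? ?] ?; lra.
    have /andP[_ +] := (ait n).1 w k; have := MI n w k.
    by rewrite ler_norml => /andP[? ?] ?; lra.
  apply/eqP; rewrite -subr_eq0 -normr_le0; apply: (@le_half_expr _ (2 * B w (b w))) => n.
  by have := MI n w (b w); rewrite (ait n).2; lra.
have fixM w k : M' w k = bstep M' w k.
  apply/eqP; rewrite -subr_eq0 -normr_le0; apply: (@le_half_expr _ (2 * B w k)) => n.
  have e0 : 0 <= 2 * (1/2) ^+ n :> R by rewrite mulr_ge0 ?exprn_ge0 ?divr_ge0.
  have := bstep_contract aM (ait n) e0 (MI n) w k.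
  have -> : bstep (it n) w k = it n.+1 w k by [].
  have := MI n.+1 w k; rewrite exprS => h1 h2.
  rewrite -(subrKA (it n.+1 w k)) (le_trans (ler_normD _ _))//.
  by rewrite (distrC (it n.+1 w k)); lra.
exists M'; split=> [w k||w k]; last 2 first.
- exact: aM.2.
- split; first by have [] := bnormE w k aM.
  by rewrite fixM /bstep divfK// gt_eqF ?bnorm_gt0.
(* Strict positivity need not survive a limit; it comes from the fixed-point equation, a quotient of
   positive sums. *)
- have /andP[_ ->] := aM.1 w k; rewrite andbT fixM /bstep.
  by rewrite divr_gt0 ?bnorm_gt0.
Qed.
End BoundaryLaw.

(** * Cylinders *)

Section Cylinders.
Variables (R : realType) (d : nat) (S : pointedType) (code : S -> nat).
Hypothesis code_inj : injective code.
Implicit Types (s Lam : seq (vertex d)) (eta tau : vertex d -> S) (A : set (ConfSpace d S)).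

Definition cylinder s eta : set (ConfSpace d S) :=
  [set sg | forall v, v \in s -> sg v = eta v].

Definition site v (k : S) : set (ConfSpace d S) := [set sg | sg v = k].

Lemma measurable_site v k : measurable (site v k).
Proof. by apply: sub_sigma_algebra; exists v, k. Qed.

Lemma cylinder_nil eta : cylinder [::] eta = setT.
Proof. by apply/seteqP; split=> // sg _ v; rewrite in_nil. Qed.

Lemma cylinder_cons v s eta : cylinder (v :: s) eta = site v (eta v) `&` cylinder s eta.
Proof.
apply/seteqP; split=> sg /=.
  by move=> h; split=> [|w ws]; apply: h; rewrite ?mem_head// in_cons ws orbT.
by move=> [h1 h2] w; rewrite in_cons => /predU1P[->//|/h2].
Qed.

Lemma measurable_cylinder s eta : measurable (cylinder s eta).
Proof.
elim: s => [|v s IH]; first by rewrite cylinder_nil; exact: measurableT.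
by rewrite cylinder_cons; apply: measurableI => //; exact: measurable_site.
Qed.

Lemma eq_cylinder s s' eta : s =i s' -> cylinder s eta = cylinder s' eta.
Proof. by move=> ss'; apply/seteqP; split => sg h v vs; apply: h; [rewrite ss'|rewrite -ss']. Qed.

Lemma cylinder_local s eta eta' : {in s, eta =1 eta'} -> cylinder s eta = cylinder s eta'.
Proof. by move=> h; apply/seteqP; split => sg hs v vs; rewrite hs// h. Qed.

Lemma cylinder_site v s eta k : v \notin s ->
  cylinder s eta `&` site v k = cylinder (v :: s) (upd eta v k).
Proof.
move=> vs; rewrite cylinder_cons upd_eq setIC; congr (_ `&` _).
by apply: cylinder_local => w ws; rewrite upd_neq//; apply: contraTneq ws => ->.
Qed.

Definition coded (F : S -> set (ConfSpace d S)) n :=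
  if codeinv code n is Some k then F k else set0.

Lemma coded_site A v : trivIset setT (coded (fun k => A `&` site v k)).
Proof.
apply/trivIsetP => i j _ _ ij; rewrite /coded.
case Ei : codeinv => [k|]; case Ej : codeinv => [l|]; rewrite ?setI0 ?set0I//.
rewrite setIACA -subset0 => sg [_ [/= h1 h2]].
by move/eqP: ij; rewrite -(codeinvK Ei) -(codeinvK Ej) -h1 h2.
Qed.

Lemma bigcup_coded_site A v : \bigcup_n coded (fun k => A `&` site v k) n = A.
Proof.
apply/seteqP; split=> sg.
  by move=> [n _]; rewrite /coded; case: codeinv => // k [].
by move=> Asg; exists (code (sg v)) => //; rewrite /coded codeinv_code.
Qed.

Lemma measure_split (mu : {measure set (ConfSpace d S) -> \bar R}) A v : measurable A ->
  (mu A = \esum_(k in [set: S]) mu (A `&` site v k))%E.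
Proof.
move=> mA; rewrite -{1}(bigcup_coded_site A v) measure_semi_bigcup.
- rewrite (esum_code code_inj)//; apply: eq_eseriesr => n _.
  by rewrite /coded; case: codeinv => //; rewrite measure0.
- move=> n; rewrite /coded; case: codeinv => // k.
  by apply: measurableI => //; exact: measurable_site.
- exact: coded_site.
- by rewrite bigcup_coded_site.
Qed.

(** * Induction over the measurable sets of configurations *)

Section Dynkin.
Variable Q : set (set (ConfSpace d S)).
Variable n0 : nat.
Hypothesis QC : forall A, Q A -> Q (~` A).
Hypothesis QU : forall F : nat -> set (ConfSpace d S), trivIset setT F -> (forall n, Q (F n))
  -> Q (\bigcup_n F n).
Hypothesis QB : forall n eta, (n0 <= n)%N -> Q (cylinder (tball d n) eta).

Lemma Q_split A v : Q set0 -> (forall k, Q (A `&` site v k)) -> Q A.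
Proof.
move=> Q0 h; rewrite -(bigcup_coded_site A v); apply: QU; first exact: coded_site.
by move=> n; rewrite /coded; case: codeinv.
Qed.

Hypothesis Q0 : Q set0.

(** The base [s] is enlarged to a ball, where the property is given. The added vertices are then
    dropped one by one, each time as a countable disjoint union over the spin there. *)
Lemma Q_cylinder s eta : Q (cylinder s eta).
Proof.
suff H t eta' : (forall eta, Q (cylinder (t ++ s) eta)) -> Q (cylinder s eta').
  pose n := maxn n0 (\max_(v <- s) lvl v).+1.
  apply: (H (tball d n)) => eta'; rewrite (@eq_cylinder _ (tball d n)).
    by apply: QB; rewrite leq_maxl.
  move=> v; rewrite mem_cat orb_idr// => vs; rewrite mem_tball leq_max ltnS orbC.
  have -> // : (lvl v <= \max_(v <- s) lvl v)%N by exact: leq_bigmax_seq.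
elim: t eta' => [|v t IH] eta' h; first exact: h.
apply: IH => eta1; have [vs|vs] := boolP (v \in t ++ s).
  rewrite (@eq_cylinder _ (v :: t ++ s)); first exact: h.
  by move=> w; rewrite in_cons orb_idl// => /eqP ->.
by apply: (@Q_split _ v) => // k; rewrite cylinder_site//; exact: h.
Qed.

Lemma conf_dynkin A : measurable A -> Q A.
Proof.
pose G : set (set (ConfSpace d S)) := [set A | A = set0 \/ exists s eta, A = cylinder s eta].
have GI : setI_closed G.
  move=> A1 A2 [->|[s [eta ->]]]; first by rewrite set0I; left.
  move=> [->|[s' [eta' ->]]]; first by rewrite setI0; left.
  case: (pselect (exists sg, (cylinder s eta `&` cylinder s' eta') sg)) => [[sg [h h']]|h].
    right; exists (s ++ s'), sg; apply/seteqP; split=> x.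
      by move=> [x1 x2] v; rewrite mem_cat => /orP[vs|vs]; [rewrite x1 ?h|rewrite x2 ?h'].
    by move=> hx; split=> v vs; rewrite hx ?mem_cat ?vs ?orbT//; [exact: h|exact: h'].
  by left; apply/seteqP; split=> // x hx; case: h; exists x.
move=> mA; have : <<d G >> A.
  rewrite setI_closed_g_dynkin_g_sigma_algebra//.
  apply: (sub_smallest2r _ _ mA); first exact: smallest_sigma_algebra.
  move=> _ [v [k ->]]; right; exists [:: v], (fun=> k).
  by rewrite cylinder_cons cylinder_nil setIT.
apply: smallest_sub; last by move=> _ [->//|[s [eta ->]]]; exact: Q_cylinder.
split; [by have := QC Q0; rewrite setC0|exact: QC|by move=> F tF QF; exact: QU].
Qed.

End Dynkin.

Lemma conf_measure_unique (mu nu : probability (ConfSpace d S) R) n0 :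
  (forall n eta, (n0 <= n)%N -> mu (cylinder (tball d n) eta) = nu (cylinder (tball d n) eta)) ->
  forall A, measurable A -> mu A = nu A.
Proof.
move=> h A mA; pose Q : set (set (ConfSpace d S)) := [set A | measurable A /\ mu A = nu A].
suff [] : Q A by [].
apply: (@conf_dynkin _ n0) => //.
- by move=> B [mB eB]; split; [exact: measurableC|rewrite !probability_setC// eB].
- move=> F tF QF; split; first by apply: bigcupT_measurable => n; case: (QF n).
  rewrite !measure_semi_bigcup//; try by [move=> n; case: (QF n)|
    apply: bigcupT_measurable => n; case: (QF n)].
  by apply: eq_eseriesr => n _; case: (QF n).
- by move=> n eta n0n; split; [exact: measurable_cylinder|exact: h].
- by split=> //; rewrite !measure0.
Qed.

Lemma agree_nil tau : agree [::] tau = [set tau].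
Proof. by apply/seteqP; split=> eta /= h; [apply/funext => v; exact: h|rewrite h]. Qed.

(** The spin chosen at [v] becomes part of the boundary condition for [Lam]; this reduces sums over
    configurations to iterated sums over single spins. *)
Lemma esum_agree_cons v Lam tau (F : (vertex d -> S) -> \bar R) : v \notin Lam ->
  (forall eta, 0 <= F eta)%E ->
  (\esum_(eta in agree (v :: Lam) tau) F eta =
   \esum_(k in [set: S]) \esum_(eta in agree Lam (upd tau v k)) F eta)%E.
Proof.
move=> vL F0; rewrite (esum_esum (a := fun _ => F))//.
apply: reindex_esum; split=> /=.
- move=> [k eta] /= [_ h] w; rewrite in_cons negb_or => /andP[wv wL].
  by rewrite h// upd_neq.
- move=> [k eta] [k' eta']; rewrite !inE /= => -[_ h] [_ h'] e; rewrite e in h *.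
  by congr (_, _); have := h v vL; rewrite (h' v vL) !upd_eq.
- move=> eta h; exists (eta v, eta) => //; split=> // w wL /=.
  have [->|wv] := eqVneq w v; first by rewrite upd_eq.
  by rewrite upd_neq// h// in_cons negb_or wv.
Qed.

Lemma esum_agree_local Lam (X : seq (vertex d)) tau tau' (F : (vertex d -> S) -> \bar R) :
  uniq Lam -> {subset Lam <= X} -> (forall eta, 0 <= F eta)%E ->
  (forall eta eta', {in X, eta =1 eta'} -> F eta = F eta') ->
  {in X, forall v, v \notin Lam -> tau v = tau' v} ->
  (\esum_(eta in agree Lam tau) F eta = \esum_(eta in agree Lam tau') F eta)%E.
Proof.
elim: Lam tau tau' => [|v Lam IH] tau tau' uL LX F0 Floc tt'.
  rewrite !agree_nil !esum_set1//; apply: Floc => v vX; exact: tt'.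
move: uL => /= /andP[vL uL]; rewrite !esum_agree_cons//.
apply: eq_esum => k _; apply: IH => // [w wL|w wX wL].
  by apply: LX; rewrite in_cons wL orbT.
have [->|wv] := eqVneq w v; first by rewrite !upd_eq.
by rewrite !upd_neq// tt'// in_cons negb_or wv.
Qed.

Lemma measure_agree (mu : {measure set (ConfSpace d S) -> \bar R}) Lam s eta :
  uniq Lam -> (forall v, v \in Lam -> v \notin s) ->
  (mu (cylinder s eta) = \esum_(eta' in agree Lam eta) mu (cylinder (Lam ++ s) eta'))%E.
Proof.
elim: Lam s eta => [|v Lam IH] s eta; first by rewrite agree_nil esum_set1.
move=> /= /andP[vL uL] Ls; rewrite esum_agree_cons//.
rewrite (measure_split mu v); last exact: measurable_cylinder.
apply: eq_esum => k _; rewrite cylinder_site; last by apply: Ls; rewrite mem_head.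
rewrite (IH (v :: s))// => [|w wL].
  apply: eq_esum => eta' _; congr (mu _); apply: eq_cylinder => w.
  by rewrite !(mem_cat, in_cons) orbCA.
rewrite in_cons negb_or Ls ?in_cons ?wL ?orbT// andbT.
by apply: contraNneq vL => <-.
Qed.

End Cylinders.

(** * A criterion for Gibbs measures *)

Section GibbsCriterion.
Variables (R : realType) (d : nat) (S : pointedType) (code : S -> nat).
Hypothesis code_inj : injective code.
Variables (Phi : S -> S -> R) (Psi : vertex d -> S -> R) (beta : R).
Implicit Types (Lam : seq (vertex d)) (eta tau : vertex d -> S) (A : set (ConfSpace d S)).

Definition wt Lam eta : R := expR (- beta * HLam Phi Psi Lam eta).
Definition Zsum Lam tau : \bar R := \esum_(eta in agree Lam tau) (wt Lam eta)%:E.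

Lemma wt_gt0 Lam eta : 0 < wt Lam eta.
Proof. exact: expR_gt0. Qed.

Lemma lvl_nbrs (v w : vertex d) : w \in nbrs v -> (lvl w <= (lvl v).+1)%N.
Proof.
rewrite mem_nbrs !mem_children => /orP[/andP[_ /eqP <-]|/andP[_ /eqP <-]];
  rewrite lvl_par; lia.
Qed.

(** The Hamiltonian reads [Lam] and its neighbours, at most one level deeper; hence the margin
    [(lvl v).+1 < n]. *)
Lemma HLam_local Lam n eta eta' : (forall v, v \in Lam -> (lvl v).+1 < n)%N ->
  {in tball d n, eta =1 eta'} -> HLam Phi Psi Lam eta = HLam Phi Psi Lam eta'.
Proof.
move=> Ln h; apply: eq_big_seq => v vL.
have hv : eta v = eta' v by apply: h; rewrite mem_tball; have := Ln v vL; lia.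
rewrite hv; congr (_ + _); rewrite big_seq_cond [RHS]big_seq_cond.
apply: eq_bigr => w /andP[wv _]; rewrite /edgeE hv h// mem_tball.
by have := Ln v vL; have := lvl_nbrs wv; lia.
Qed.

Lemma gammaE Lam (A : set (vertex d -> S)) tau : gamma Phi Psi beta Lam A tau =
  (fine (\esum_(eta in agree Lam tau `&` A) (wt Lam eta)%:E) / fine (Zsum Lam tau))%:E.
Proof.
rewrite /gamma; congr ((fine _ / _)%:E); rewrite esum_mkcondr.
by apply: eq_esum => eta _; case: ifP => _; rewrite ?mul1r ?mul0r.
Qed.

Section Finite.
Variable Lam : seq (vertex d).
Hypothesis ZF : forall tau, (Zsum Lam tau < +oo)%E.
Hypothesis Lam_uniq : uniq Lam.

Lemma Zsum_gt0 tau : (0 < Zsum Lam tau)%E.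
Proof.
apply: (@lt_le_trans _ _ (wt Lam tau)%:E); first by rewrite lte_fin wt_gt0.
rewrite /Zsum (esumID [set tau]) => [|eta _]; last by rewrite lee_fin ltW// wt_gt0.
rewrite (_ : agree Lam tau `&` [set tau] = [set tau]); last first.
  by apply/seteqP; split=> [eta []//|eta /= ->]; split=> // v.
rewrite esum_set1 ?lee_fin ?(ltW (wt_gt0 _ _))// leeDl//.
by apply: esum_ge0 => eta _; rewrite lee_fin ltW// wt_gt0.
Qed.

Lemma Zsum_fin tau : Zsum Lam tau \is a fin_num.
Proof. by rewrite ge0_fin_numE ?ZF// ltW// Zsum_gt0. Qed.

Lemma fine_Zsum_gt0 tau : 0 < fine (Zsum Lam tau).
Proof. by apply: fine_gt0; rewrite Zsum_gt0 ZF. Qed.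

Lemma gammaEe (A : set (vertex d -> S)) tau : gamma Phi Psi beta Lam A tau =
  ((fine (Zsum Lam tau))^-1%:E * \esum_(eta in agree Lam tau `&` A) (wt Lam eta)%:E)%E.
Proof.
rewrite gammaE mulrC EFinM fineK// ge0_fin_numE; last first.
  by apply: esum_ge0 => eta _; rewrite lee_fin ltW// wt_gt0.
apply: le_lt_trans (ZF tau); rewrite esum_mkcondr; apply: le_esum => eta _.
by case: ifP => // _; rewrite lee_fin ltW// wt_gt0.
Qed.

Lemma gamma_ge0 (A : set (vertex d -> S)) tau : (0 <= gamma Phi Psi beta Lam A tau)%E.
Proof.
rewrite gammaEe mule_ge0 ?lee_fin ?invr_ge0 ?(ltW (fine_Zsum_gt0 _))//.
by apply: esum_ge0 => eta _; rewrite lee_fin ltW// wt_gt0.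
Qed.

Lemma gammaT tau : gamma Phi Psi beta Lam setT tau = 1%E.
Proof. by rewrite gammaE setIT divff// gt_eqF ?fine_Zsum_gt0. Qed.

Lemma gamma_bigcup (F : nat -> set (vertex d -> S)) tau : trivIset setT F ->
  gamma Phi Psi beta Lam (\bigcup_n F n) tau =
  (\sum_(n <oo) gamma Phi Psi beta Lam (F n) tau)%E.
Proof.
move=> tF; rewrite gammaEe setI_bigcupr.
rewrite esum_bigcup; first last.
- by move=> eta _; rewrite lee_fin ltW// wt_gt0.
- apply: (sub_trivIset (subsetT _)).
  by apply/trivIsetP => i j _ _ ij; move/trivIsetP: tF => /(_ i j I I ij) FE;
    rewrite setIACA FE setI0.
rewrite -nneseries_esumT => [|n]; last first.
  by apply: esum_ge0 => eta _; rewrite lee_fin ltW// wt_gt0.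
rewrite -nneseriesZl => [|n _]; last first.
  by apply: esum_ge0 => eta _; rewrite lee_fin ltW// wt_gt0.
by apply: eq_eseriesr => n _; rewrite gammaEe.
Qed.

Lemma gammaC (A : set (vertex d -> S)) tau :
  (gamma Phi Psi beta Lam A tau + gamma Phi Psi beta Lam (~` A) tau = 1)%E.
Proof.
rewrite !gammaEe -muleDr//; last first.
  by apply: ge0_adde_def; rewrite inE; apply: esum_ge0 => eta _; rewrite lee_fin ltW// wt_gt0.
rewrite -esumID => [|eta _]; last by rewrite lee_fin ltW// wt_gt0.
by rewrite -(gammaT tau) gammaEe setIT.
Qed.

Variable n : nat.
Hypothesis Lam_n : forall v, v \in Lam -> ((lvl v).+1 < n)%N.

Definition outside := [seq v <- tball d n | v \notin Lam].

Lemma Zsum_local eta tau : cylinder outside eta tau -> Zsum Lam tau = Zsum Lam eta.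
Proof.
move=> h; apply: (@esum_agree_local _ _ _ _ (tball d n)) => //.
- by move=> v /Lam_n vn; rewrite mem_tball; lia.
- by move=> eta'; rewrite lee_fin ltW// wt_gt0.
- by move=> eta1 eta2 e12; congr (expR (_ * _))%:E; exact: HLam_local e12.
- by move=> v vn vL; apply: h; rewrite mem_filter vL.
Qed.

(** At most one configuration that agrees with [tau] off [Lam] lies in the cylinder, and it exists
    exactly if [tau] matches [eta] on the rest of the ball. *)
Lemma gamma_cylinder eta tau : gamma Phi Psi beta Lam (cylinder (tball d n) eta) tau =
  (wt Lam eta / fine (Zsum Lam eta) * \1_(cylinder outside eta) tau)%:E.
Proof.
rewrite indicE; have [|h] := boolP (tau \in cylinder outside eta); last first.
  rewrite mulr0 gammaE (_ : _ `&` _ = set0) ?esum_set0 ?mul0r//.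
  apply/seteqP; split=> // eta' [h1 h2]; move: h; rewrite notin_setE; apply.
  move=> v; rewrite mem_filter => /andP[vL vn].
  by rewrite -h1// h2.
rewrite inE mulr1 => h; rewrite gammaE (Zsum_local h); congr (_ / _)%:E.
pose eta' : vertex d -> S := fun v => if v \in Lam then eta v else tau v.
have eE : {in tball d n, eta' =1 eta}.
  by move=> v vn; rewrite /eta'; case: ifPn => // vL; apply: h; rewrite mem_filter vL.
rewrite (_ : _ `&` _ = [set eta']).
  rewrite esum_set1 ?lee_fin ?(ltW (wt_gt0 _ _))//= /wt.
  by rewrite (HLam_local Lam_n eE).
apply/seteqP; split=> [eta1 [/= h1 h2]|_ ->].
  apply/funext => v; rewrite /eta'; case: ifPn => [vL|/h1//].
  by apply: h2; rewrite mem_tball; have := Lam_n vL; lia.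
by split=> [v vL|v vn]; [rewrite /eta' (negPf vL)|exact: eE].
Qed.

Lemma outside_cat : tball d n =i Lam ++ outside.
Proof.
move=> v; rewrite mem_cat mem_filter; case: (boolP (v \in Lam)) => //= /Lam_n.
by rewrite mem_tball => /ltnW.
Qed.

Lemma measure_outside (mu : probability (ConfSpace d S) R) eta :
  (mu (cylinder outside eta) = \esum_(eta' in agree Lam eta) mu (cylinder (tball d n) eta'))%E.
Proof.
rewrite (measure_agree code_inj mu (Lam := Lam))//; last first.
  by move=> v vL; rewrite mem_filter vL.
by apply: eq_esum => eta' _; rewrite (eq_cylinder _ outside_cat).
Qed.

Lemma int_gamma_cylinder (mu : probability (ConfSpace d S) R) eta :
  (\int[mu]_tau gamma Phi Psi beta Lam (cylinder (tball d n) eta) tau =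
   (wt Lam eta / fine (Zsum Lam eta))%:E * mu (cylinder outside eta))%E.
Proof.
under eq_integral do rewrite gamma_cylinder EFinM.
rewrite ge0_integralZl_EFin//; last 2 first.
- by apply/measurable_EFinP; apply: measurable_indic; exact: measurable_cylinder.
- by rewrite divr_ge0 ?(ltW (wt_gt0 _ _)) ?(ltW (fine_Zsum_gt0 _)).
by rewrite integral_indic// ?setIT//; exact: measurable_cylinder.
Qed.

(** The kernel on a ball cylinder depends on the spins in [Lam] only through the weight in its
    numerator. Applied to a competing Gibbs measure, this makes its density insensitive to interior
    spins. *)
Lemma gibbs_ratio (mu : probability (ConfSpace d S) R) eta eta' :
  is_gibbs Phi Psi beta mu -> agree Lam eta eta' ->
  (mu (cylinder (tball d n) eta') * (wt Lam eta)%:E =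
   mu (cylinder (tball d n) eta) * (wt Lam eta')%:E)%E.
Proof.
move=> G h.
have out : cylinder outside eta eta' by move=> v; rewrite mem_filter => /andP[vL _]; exact: h.
rewrite !(G Lam Lam_uniq) ?int_gamma_cylinder; try exact: measurable_cylinder.
rewrite (Zsum_local out).
rewrite -(@cylinder_local _ _ outside eta') => [|v vo]; last exact: out.
by rewrite muleAC -EFinM [RHS]muleAC -EFinM; congr (_%:E * _)%E; ring.
Qed.

End Finite.

(* Finiteness of the partition functions comes for free: by the second hypothesis
   they are proportional to masses of cylinders of positive measure. *)
Lemma gibbs_criterion (mu : probability (ConfSpace d S) R) :
  (forall n eta, (0 < mu (cylinder (tball d n) eta))%E) ->
  (forall Lam n eta eta', uniq Lam -> (forall v, v \in Lam -> (lvl v).+1 < n)%N ->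
     agree Lam eta eta' ->
    (mu (cylinder (tball d n) eta') * (wt Lam eta)%:E =
     mu (cylinder (tball d n) eta) * (wt Lam eta')%:E)%E) ->
  is_gibbs Phi Psi beta mu /\ forall Lam, uniq Lam -> forall tau, (Zsum Lam tau < +oo)%E.
Proof.
move=> mu0 key.
pose n0 Lam := (\max_(v <- Lam) lvl v).+2.
have n0P Lam n v : (n0 Lam <= n)%N -> v \in Lam -> ((lvl v).+1 < n)%N.
  move=> nn vL; apply: leq_trans nn; rewrite /n0 !ltnS.
  by have -> // : (lvl v <= \max_(v <- Lam) lvl v)%N by exact: leq_bigmax_seq.
have mufin n eta : mu (cylinder (tball d n) eta) \is a fin_num.
  by rewrite fin_num_measure//; exact: measurable_cylinder.
have mupos n eta : 0 < fine (mu (cylinder (tball d n) eta)).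
  by apply: fine_gt0; rewrite mu0 /= -ge0_fin_numE// mufin.
(* The proportionality is summed over the spins in [Lam]: the weights add up to the partition
   function, the masses to that of the outer cylinder, which is finite. *)
have ZE Lam n tau : uniq Lam -> (n0 Lam <= n)%N ->
    Zsum Lam tau = ((wt Lam tau / fine (mu (cylinder (tball d n) tau)))%:E *
      mu (cylinder (outside Lam n) tau))%E.
  move=> uL nn; have Ln v : v \in Lam -> ((lvl v).+1 < n)%N by exact: n0P.
  rewrite (measure_outside uL Ln).
  set c := wt Lam tau / _; have c0 : 0 < c by rewrite divr_gt0 ?wt_gt0.
  pose f eta := fine (mu (cylinder (tball d n) eta)).
  have -> : Zsum Lam tau = \esum_(eta in agree Lam tau) (c%:E * (f eta)%:E)%E.
    apply: eq_esum => eta /= h; have := key Lam n tau eta uL Ln h.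
    rewrite -(fineK (mufin n eta)) -(fineK (mufin n tau)) -EFinM -EFinM => -[e].
    rewrite -EFinM; congr EFin; rewrite /c /f mulrAC [wt Lam tau * _]mulrC e.
    by rewrite mulrAC divff ?mul1r// gt_eqF.
  rewrite esumZl; first by congr (_ * _)%E; apply: eq_esum => eta _; rewrite /f fineK.
  - exact: ltW.
  - by move=> eta; rewrite lee_fin fine_ge0.
have ZF Lam : uniq Lam -> forall tau, (Zsum Lam tau < +oo)%E.
  move=> uL tau; rewrite (ZE Lam (n0 Lam))// -ge0_fin_numE; last first.
    by rewrite mule_ge0// lee_fin divr_ge0 ?(ltW (wt_gt0 _ _)) ?(ltW (mupos _ _)).
  by rewrite fin_numM// fin_num_measure//; exact: measurable_cylinder.
split; last exact: ZF.
move=> Lam uL A mA.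
(* Measurability of the kernel is carried along, since the integrals for complements and unions need
   it. *)
pose Q : set (set (ConfSpace d S)) := [set B : set (ConfSpace d S) |
  [/\ measurable B, measurable_fun [set: ConfSpace d S] (gamma Phi Psi beta Lam B) &
  (mu B = \int[mu]_tau gamma Phi Psi beta Lam B tau)%E]].
suff [] : Q A by [].
apply: (@conf_dynkin _ _ code code_inj Q (n0 Lam)) => //.
- move=> B [mB mgB eB]; have mBC : measurable (~` B) by exact: measurableC.
  have gE tau : gamma Phi Psi beta Lam (~` B) tau = (1 - gamma Phi Psi beta Lam B tau)%E.
    by rewrite -(gammaC (ZF Lam uL) B tau) addeAC subee ?add0e// gammaE.
  have mg : measurable_fun [set: ConfSpace d S] (gamma Phi Psi beta Lam (~` B)).
    rewrite (_ : gamma _ _ _ _ _ = (fun tau => 1 - gamma Phi Psi beta Lam B tau)%E).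
      exact: emeasurable_funB.
    exact/funext.
  split=> //.
  have : (\int[mu]_tau (gamma Phi Psi beta Lam B tau + gamma Phi Psi beta Lam (~` B) tau) = 1)%E.
    under eq_integral do rewrite (gammaC (ZF Lam uL)).
    by rewrite integral_cst// mul1e; exact: probability_setT.
  rewrite ge0_integralD//; try by move=> tau _; apply: gamma_ge0; exact: ZF.
  rewrite -eB probability_setC// => <-.
  by rewrite addeAC subee ?add0e// fin_num_measure.
- move=> F tF QF; have mF n : measurable (F n) by case: (QF n).
  have mgF n : measurable_fun [set: ConfSpace d S] (gamma Phi Psi beta Lam (F n)) by case: (QF n).
  have g0 n tau : (0 <= gamma Phi Psi beta Lam (F n) tau)%E by apply: gamma_ge0; exact: ZF.
  have gE : gamma Phi Psi beta Lam (\bigcup_n F n) =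
      (fun tau => \sum_(n <oo) gamma Phi Psi beta Lam (F n) tau)%E.
    by apply/funext => tau; rewrite gamma_bigcup//; exact: ZF.
  split.
  + exact: bigcupT_measurable.
  + rewrite gE; apply: (@emeasurable_fun_cvg _ (ConfSpace d S) _ _
      (fun m tau => \sum_(0 <= n < m) gamma Phi Psi beta Lam (F n) tau)%E).
      by move=> m; exact: emeasurable_sum.
    by move=> tau _; apply: is_cvg_nneseries => n _.
  + rewrite gE integral_nneseries// measure_semi_bigcup//; last exact: bigcupT_measurable.
    by apply: eq_eseriesr => n _; case: (QF n).
- move=> n eta nn; have Ln v : v \in Lam -> ((lvl v).+1 < n)%N by exact: n0P.
  have mc : measurable (cylinder (tball d n) eta) by exact: measurable_cylinder.
  have ZFL := ZF Lam uL.
  split=> //.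
    rewrite (_ : gamma _ _ _ _ _ = (fun tau => (wt Lam eta / fine (Zsum Lam eta) *
       \1_(cylinder (outside Lam n) eta) tau)%:E)); last first.
      by apply/funext => tau; rewrite gamma_cylinder.
    apply/measurable_EFinP; apply: measurable_funM => //.
    by apply: measurable_indic; exact: measurable_cylinder.
  rewrite int_gamma_cylinder//.
  rewrite -(fineK (Zsum_fin ZFL eta)) (ZE Lam n)//.
  have mo : mu (cylinder (outside Lam n) eta) \is a fin_num.
    by rewrite fin_num_measure//; exact: measurable_cylinder.
  have := fine_Zsum_gt0 ZFL eta; rewrite (ZE Lam n)//.
  rewrite -(fineK mo) -(fineK (mufin n eta)) -!EFinM /= => Z0.
  congr EFin; rewrite -[LHS]mulr1; move: (mupos n eta) (wt_gt0 Lam eta) Z0.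
  set x := fine _; set y := wt _ _; set z := fine _ => x0 y0 Z0.
  have z0 : z != 0 by apply: contraTneq Z0 => ->; rewrite mulr0 ltxx.
  by field; rewrite z0 !gt_eqF.
- split.
  + exact: measurable0.
  + rewrite (_ : gamma _ _ _ _ _ = cst 0%E); first exact: measurable_cst.
    by apply/funext => tau; rewrite gammaE setI0 esum_set0 mul0r.
  + rewrite measure0 integral0_eq// => tau _.
    by rewrite gammaE setI0 esum_set0 mul0r.
Qed.

End GibbsCriterion.

(** * Energy of a ball and the part of it outside a finite region *)

Section Energy.
Variables (R : realType) (d : nat) (S : pointedType).
Variables (Phi : S -> S -> R) (Psi : vertex d -> S -> R).
Implicit Types (Lam : seq (vertex d)) (eta : vertex d -> S).

Let ed eta w := Phi (eta (par w)) (eta w).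

Definition benergy (s : seq (vertex d)) eta :=
  \sum_(w <- s) ((if w == troot d then 0 else ed eta w) + Psi w (eta w)).

(** Each edge is filed under its lower end. An edge touching [Lam] either has its upper end there,
    or only its lower end; this counts every edge once. *)
Lemma HLamE Lam eta : HLam Phi Psi Lam eta =
  \sum_(w <- flatten (map (@children d) Lam)) ed eta w +
  \sum_(w <- Lam | (w != troot d) && (par w \notin Lam)) ed eta w +
  \sum_(w <- Lam) Psi w (eta w).
Proof.
rewrite big_flatten big_map (big_mkcond (fun w => _ && _)) -!big_split /=.
apply: eq_bigr => v _; congr (_ + _); rewrite nbrsE big_cat /=; congr (_ + _).
  rewrite big_seq_cond [RHS]big_seq; apply: congr_big => // w; last first.
    rewrite mem_children => /andP[/andP[w0 /eqP <-] _]; rewrite /edgeE -!/(lvl _) lvl_par.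
    by rewrite prednK ?lt0n ?w0 // leqnn.
  case: (boolP (w \in children v)) => //=.
  rewrite mem_children => /andP[w0 /eqP <-]; rewrite -!/(lvl _) lvl_par.
  by rewrite prednK ?lt0n// leqnn orbT.
rewrite lvl_eq0; case: eqP => [_|/eqP v0] /=; first by rewrite big_nil.
rewrite big_cons big_nil addr0 -!/(lvl _) lvl_par ltnNge leq_pred orbF.
by case: ifP => // _; rewrite /edgeE -!/(lvl _) lvl_par ltnNge leq_pred.
Qed.

(** The difference consists of the edges and sites of the ball that avoid [Lam]; no edge touching
    [Lam] leaves the ball. *)
Lemma energy_diff Lam n eta eta' : uniq Lam -> (forall v, v \in Lam -> (lvl v).+1 < n)%N ->
  agree Lam eta eta' ->
  benergy (tball d n) eta' - HLam Phi Psi Lam eta' =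
  benergy (tball d n) eta - HLam Phi Psi Lam eta.
Proof.
move=> uL Ln h.
have ub := tball_uniq d n.
suff E eta0 : benergy (tball d n) eta0 - HLam Phi Psi Lam eta0 =
    \sum_(w <- tball d n | [&& w != troot d, par w \notin Lam & w \notin Lam]) ed eta0 w +
    \sum_(w <- tball d n | w \notin Lam) Psi w (eta0 w).
  rewrite !E; congr (_ + _); apply: eq_bigr => w.
    by move=> /and3P[_ pL wL]; rewrite /ed !h.
  by move=> wL; rewrite h.
rewrite /benergy big_split /= HLamE.
have -> : \sum_(w <- tball d n) (if w == troot d then 0 else ed eta0 w) =
    \sum_(w <- tball d n | w != troot d) ed eta0 w.
  by rewrite [RHS]big_mkcond; apply: eq_bigr => w _; case: eqP.
rewrite (bigID (fun w => par w \in Lam)) /= (bigID (fun w => w \in Lam) (fun w => _ && (_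
  \notin _))) /=.
rewrite (bigID (fun w => w \in Lam) xpredT) /=.
have -> : \sum_(w <- tball d n | (w != troot d) && (par w \in Lam)) ed eta0 w =
   \sum_(w <- flatten (map (@children d) Lam)) ed eta0 w.
  rewrite -big_filter; apply: perm_big; apply: uniq_perm; first exact: filter_uniq.
    apply: uniq_flatten_map => // [x|x y z]; first exact: children_uniq.
    by rewrite !mem_children => /andP[_ /eqP <-] /andP[_ /eqP <-].
  move=> w; rewrite mem_filter mem_tball; apply/idP/flattenP.
    move=> /andP[/andP[w0 pL] _]; exists (children (par w)); first exact: map_f.
    by rewrite mem_children lvl_eq0 w0 eqxx.
  move=> [_ /mapP[v vL ->]]; rewrite mem_children lvl_eq0 => /andP[w0 /eqP pw].
  rewrite w0 pw vL /=; have := Ln v vL; rewrite -pw lvl_par prednK//.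
  by rewrite lt0n lvl_eq0.
have -> : \sum_(w <- tball d n | (w != troot d) && (par w \notin Lam) && (w \in Lam)) ed eta0 w =
   \sum_(w <- Lam | (w != troot d) && (par w \notin Lam)) ed eta0 w.
  rewrite -big_filter -[RHS]big_filter; apply: perm_big; apply: uniq_perm; rewrite ?filter_uniq//.
  move=> w; rewrite !mem_filter mem_tball; case: (boolP (w \in Lam)) => wL; rewrite ?andbF//.
  by rewrite !andbT (ltnW (Ln w wL)) andbT.
have -> : \sum_(w <- tball d n | w \in Lam) Psi w (eta0 w) = \sum_(w <- Lam) Psi w (eta0 w).
  rewrite -big_filter; apply: perm_big; apply: uniq_perm; rewrite ?filter_uniq//.
  move=> w; rewrite !mem_filter mem_tball; case: (boolP (w \in Lam)) => wL //=.
  by rewrite (ltnW (Ln w wL)).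
have -> : \sum_(w <- tball d n | (w != troot d) && (par w \notin Lam) && (w \notin Lam)) ed eta0 w =
   \sum_(w <- tball d n | [&& w != troot d, par w \notin Lam & w \notin Lam]) ed eta0 w.
  by apply: eq_bigl => w; rewrite andbA.
by ring.
Qed.

End Energy.

(** * Tree-indexed Markov chains *)

Section Chain.
Variables (R : realType) (d : nat) (S : pointedType) (code : S -> nat).
Hypothesis code_inj : injective code.
Hypothesis d_gt0 : (0 < d)%N.
Variables (Phi : S -> S -> R) (Psi : vertex d -> S -> R) (beta : R) (a : vertex d -> S).
Implicit Types (w v x : vertex d) (k l : S) (eta : vertex d -> S).

(* The root has no parent: its kernel ignores the spin [k], which makes
   [par (troot d) = troot d] harmless. *)
Definition phi0 w k l : R := if w == troot d then 1 else expR (- beta * Phi k l).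
Definition psi0 w l : R := expR (- beta * (Psi w l - Psi w (a w))).
Definition pa w : S := a (par w).

Lemma phi0_gt0 w k l : 0 < phi0 w k l.
Proof. by rewrite /phi0; case: ifP => // _; exact: expR_gt0. Qed.

Lemma psi0_gt0 w l : 0 < psi0 w l.
Proof. exact: expR_gt0. Qed.

Lemma psi0_a w : psi0 w (a w) = 1.
Proof. by rewrite /psi0 subrr mulr0 expR0. Qed.

Variable M : vertex d -> S -> R.
Hypothesis M_gt0 : forall w k, 0 < M w k.

Let bw := bweight (@children d) psi0 M.
Let bn := bnorm (@children d) phi0 psi0 M.

Hypothesis M_eq : forall w k, summ (fun l => phi0 w k l * bw w l) /\
  bn w k = M w k * bn w (pa w).

Lemma bw_gt0 w l : 0 < bw w l.
Proof. by rewrite /bw /bweight mulr_gt0 ?psi0_gt0// prodr_gt0. Qed.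

Lemma bn_gt0 w k : 0 < bn w k.
Proof.
rewrite /bn /bnorm; have [s _] := M_eq w k.
by apply: lt_le_trans (tot_term (a w) s); rewrite mulr_gt0 ?phi0_gt0 ?bw_gt0.
Qed.

Definition trans w k l : R := phi0 w k l * bw w l / bn w k.

Lemma trans_gt0 w k l : 0 < trans w k l.
Proof. by rewrite /trans divr_gt0 ?bn_gt0// mulr_gt0 ?phi0_gt0 ?bw_gt0. Qed.

Lemma trans_summ w k : summ (trans w k) /\ tot (trans w k) = 1.
Proof.
have [s _] := M_eq w k; have i0 : 0 <= (bn w k)^-1 by rewrite invr_ge0 ltW ?bn_gt0.
have [] := totZ i0 s; have -> : (fun l => (bn w k)^-1 * (phi0 w k l * bw w l)) = trans w k.
  by apply/funext => l; rewrite mulrC.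
by move=> ? ->; split=> //; rewrite mulVf// gt_eqF ?bn_gt0.
Qed.

Lemma trans_troot k k' : trans (troot d) k = trans (troot d) k'.
Proof.
by apply/funext => l; rewrite /trans /bn /bnorm /phi0 eqxx.
Qed.

Lemma M_troot k : M (troot d) k = 1.
Proof.
have [_ e] := M_eq (troot d) k.
have e2 : bn (troot d) k = bn (troot d) (pa (troot d)) by rewrite /bn /bnorm /phi0 eqxx.
have b0 : bn (troot d) (pa (troot d)) != 0 by rewrite gt_eqF ?bn_gt0.
by apply: (mulIf b0); rewrite mul1r -e e2.
Qed.

Definition kern n eta : S -> R := trans (venum d n) (eta (par (venum d n))).

Lemma kern_local n eta eta' : agreen n eta eta' -> kern n eta = kern n eta'.
Proof.
case: n => [_|n h]; first exact: trans_troot.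
by rewrite /kern; have [j jn <-] := venum_par d_gt0 (ltn0Sn n); rewrite h.
Qed.

Definition pprob (s : seq (vertex d)) eta : R := \prod_(w <- s) trans w (eta (par w)) (eta w).

Lemma chain_measure : exists mu : probability (ConfSpace d S) R,
  forall n eta, mu [set s | agreen n eta s] = (pprob (vprefix d n) eta)%:E.
Proof.
have [mu muE] := sequential_measure code_inj d_gt0 kern_local
  (fun n eta => (trans_summ (venum d n) (eta (par (venum d n)))).1)
  (fun n eta => (trans_summ (venum d n) (eta (par (venum d n)))).2).
exists mu => n eta; rewrite muE; congr EFin.
by rewrite /pprob /vprefix big_map /cprob -[in RHS](subn0 n) big_mkord.
Qed.

Lemma cylinder_agreen n eta : cylinder (vprefix d n) eta = [set s | agreen n eta s].
Proof.
apply/seteqP; split=> s h; first by move=> i ni; rewrite h// mem_vprefix.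
by move=> v /mapP[i]; rewrite mem_iota add0n => /andP[_ ni] ->; rewrite h.
Qed.

Lemma cylinder_next n eta k : cylinder (vprefix d n) eta `&` site (venum d n) k =
  cylinder (vprefix d n.+1) (upd eta (venum d n) k).
Proof.
rewrite cylinder_site ?mem_vprefix ?ltnn//; apply: eq_cylinder => x.
by rewrite vprefixS mem_cat !in_cons orbF orbC.
Qed.

Lemma pprob_local n eta eta' : agreen n eta eta' ->
  pprob (vprefix d n) eta = pprob (vprefix d n) eta'.
Proof.
move=> h; rewrite /pprob !big_map !big_seq; apply: eq_bigr => i.
rewrite mem_iota add0n => /andP[_ ni].
by have := kern_local (agreen_le (ltnW ni) h); rewrite /kern => ->; rewrite h.
Qed.

Lemma pprob_next n eta k : pprob (vprefix d n.+1) (upd eta (venum d n) k) =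
  pprob (vprefix d n) eta * kern n eta k.
Proof.
have ag := @agreen_upd d S d_gt0 n eta k.
rewrite vprefixS {1}/pprob big_cat /= big_cons big_nil mulr1 upd_eq.
rewrite -/(pprob _ _) (pprob_local ag); congr (_ * _).
by have := kern_local ag; rewrite /kern => ->.
Qed.

Lemma pprob_gt0 s eta : 0 < pprob s eta.
Proof. by apply: prodr_gt0 => w _; exact: trans_gt0. Qed.

(** By the boundary law each normalisation is the message [M w] times a constant. The message of [w]
    also occurs in the numerator at its parent, so all cancel except those sent from just outside
    the ball; the root's is 1. *)
Lemma pprob_telescope n eta : pprob (tball d n.+1) eta =
  expR (- beta * (benergy Phi Psi (tball d n.+1) eta - \sum_(w <- tball d n.+1) Psi w (a w)))
  / (\prod_(w <- tball d n.+1) bn w (pa w)) * \prod_(x <- lev d n.+1) M x (eta (par x)).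
Proof.
have e1 : \prod_(w <- tball d n.+1) (phi0 w (eta (par w)) (eta w) * psi0 w (eta w)) =
  expR (- beta * (benergy Phi Psi (tball d n.+1) eta - \sum_(w <- tball d n.+1) Psi w (a w))).
  rewrite /benergy -sumrB mulr_sumr expR_sum; apply: eq_bigr => w _.
  rewrite /phi0 /psi0; case: (w == troot d); first by rewrite mul1r add0r.
  by rewrite -expRD; congr expR; ring.
have e2 : \prod_(w <- tball d n.+1) \prod_(x <- children w) M x (eta w) =
    \prod_(w <- tball d n.+1) M w (eta (par w)) * \prod_(x <- lev d n.+1) M x (eta (par x)).
  have e3 : \prod_(x <- tball d n.+2) M x (eta (par x)) =
      \prod_(w <- tball d n.+1) M w (eta (par w)) * \prod_(x <- lev d n.+1) M x (eta (par x)).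
    by rewrite -big_cat.
  rewrite -e3 (tball_children d n.+1) big_cons M_troot mul1r big_flatten big_map;
    apply: eq_bigr => w _.
  by apply: eq_big_seq => x; rewrite mem_children => /andP[_ /eqP ->].
have p0 : \prod_(w <- tball d n.+1) M w (eta (par w)) != 0.
  by rewrite gt_eqF// prodr_gt0.
have b0 : \prod_(w <- tball d n.+1) bn w (pa w) != 0.
  by rewrite gt_eqF// prodr_gt0// => w _; exact: bn_gt0.
transitivity (\prod_(w <- tball d n.+1) (phi0 w (eta (par w)) (eta w) * psi0 w (eta w)) *
   \prod_(w <- tball d n.+1) \prod_(x <- children w) M x (eta w) /
   (\prod_(w <- tball d n.+1) M w (eta (par w)) * \prod_(w <- tball d n.+1) bn w (pa w))).
  rewrite -!big_split -prodfV -big_split /=; apply: eq_bigr => w _.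
  by rewrite /trans (M_eq w _).2 /bw /bweight mulrA.
by rewrite e1 e2; field; rewrite p0 b0.
Qed.

Lemma pprob_ratio Lam n eta eta' : uniq Lam -> (forall v, v \in Lam -> (lvl v).+1 < n)%N ->
  agree Lam eta eta' ->
  pprob (tball d n) eta' * wt Phi Psi beta Lam eta = pprob (tball d n) eta * wt Phi Psi beta
    Lam eta'.
Proof.
case: n => [|n] uL Ln h; first by rewrite /pprob !big_nil; case: Lam uL Ln h => [|v Lam] uL Ln h;
  [rewrite agree_nil /= in h; rewrite h|have := Ln v (mem_head _ _)].
(* The remaining messages read spins of level n, while [Lam] reaches at most level n - 1. *)
have eM : \prod_(x <- lev d n.+1) M x (eta' (par x)) = \prod_(x <- lev d n.+1) M x (eta (par x)).
  apply: eq_big_seq => x; rewrite mem_lev => /eqP xn; rewrite h//; apply/negP => /Ln.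
  by rewrite lvl_par xn ltnn.
have := energy_diff Phi Psi uL Ln h.
rewrite !pprob_telescope eM /wt.
set E := benergy _ _ _ eta; set E' := benergy _ _ _ eta'; set H := HLam _ _ _ eta.
set H' := HLam _ _ _ eta' => e.
have e' : expR (- beta * (E' - \sum_(w <- tball d n.+1) Psi w (a w))) * expR (- beta * H) =
          expR (- beta * (E - \sum_(w <- tball d n.+1) Psi w (a w))) * expR (- beta * H').
  rewrite -!expRD; congr expR; rewrite -!mulrDr; congr (_ * _); lra.
set X := expR _ in e' *; set Y := expR _ in e' *; set X' := expR _ in e' *;
  set Y' := expR _ in e' *.
by rewrite mulrAC [X / _ * _]mulrAC e' [RHS]mulrAC [X' / _ * _]mulrAC.
Qed.

Section ChainMeasure.
Variable mu : probability (ConfSpace d S) R.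
Hypothesis muE : forall n eta,
  mu [set s | agreen n eta s] = (pprob (vprefix d n) eta)%:E.

Lemma mu_vprefix n eta : mu (cylinder (vprefix d n) eta) = (pprob (vprefix d n) eta)%:E.
Proof. by rewrite cylinder_agreen muE. Qed.

Lemma mu_tball n eta : mu (cylinder (tball d n) eta) = (pprob (tball d n) eta)%:E.
Proof. by rewrite (tball_vprefix d_gt0) mu_vprefix. Qed.

Lemma chain_gibbs : is_gibbs Phi Psi beta mu /\
  forall Lam, uniq Lam -> forall tau, (Zsum Phi Psi beta Lam tau < +oo)%E.
Proof.
apply: (gibbs_criterion code_inj) => [n eta|Lam n eta eta' uL Ln h].
  by rewrite mu_tball lte_fin pprob_gt0.
by rewrite !mu_tball -!EFinM (pprob_ratio uL Ln h).
Qed.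

End ChainMeasure.
End Chain.

(** * Extremality *)

Lemma tot_average_dist (R : realType) (S : choiceType) (P f f' u : S -> R) :
  (forall k, 0 <= P k) -> (forall k, 0 <= u k) ->
  summ (fun k => P k * f k) -> summ (fun k => P k * f' k) -> summ (fun k => P k * u k) ->
  (forall k, `|f k - f' k| <= u k) ->
  `|tot (fun k => P k * f k) - tot (fun k => P k * f' k)| <= tot (fun k => P k * u k).
Proof.
move=> P0 u0 sf sf' su fu.
suff H (g g' : S -> R) : summ (fun k => P k * g k) -> summ (fun k => P k * g' k) ->
    (forall k, `|g k - g' k| <= u k) ->
    tot (fun k => P k * g k) <= tot (fun k => P k * g' k) + tot (fun k => P k * u k).
  have h1 := H f f' sf sf' fu; have h2 : tot (fun k => P k * f' k) <=
      tot (fun k => P k * f k) + tot (fun k => P k * u k).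
    by apply: H => // k; rewrite distrC.
  by rewrite ler_norml; apply/andP; split; lra.
move=> sg sg' gu; have [s <-] := totD sg' su.
have [] := summ_le sg.1 _ s => // k.
rewrite -mulrDr ler_wpM2l//.
by have := gu k; rewrite ler_norml => /andP[_]; lra.
Qed.

Section Extremality.
Variables (R : realType) (d : nat) (S : pointedType) (code : S -> nat).
Hypothesis code_inj : injective code.
Hypothesis d_gt0 : (0 < d)%N.
Variables (Phi : S -> S -> R) (Psi : vertex d -> S -> R) (beta : R) (a : vertex d -> S).
Variables (B : vertex d -> S -> R) (th : R).
Hypothesis B_gt0 : forall w k, 0 < B w k.
Hypothesis B_pa : forall w, B w (pa a w) = 1.
Hypothesis th_ge0 : 0 <= th.
Hypothesis th_small : 4 * d.+1%:R * th <= 1.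

Let p0 := phi0 (d := d) Phi beta.
Let g0 := psi0 Psi beta a.
Let bB := bweight (@children d) g0 B.

Hypothesis H2 : forall w k,
  summ (off (a w) (fun l => p0 w k l * bB w l)) /\
  tot (off (a w) (fun l => p0 w k l * bB w l)) <= th * B w k * p0 w (pa a w) (a w).

Variable M : vertex d -> S -> R.
Hypothesis M_bound : forall w k, 0 < M w k <= B w k.
Hypothesis M_pa : forall w, M w (pa a w) = 1.
Let bw := bweight (@children d) g0 M.
Let bn := bnorm (@children d) p0 g0 M.
Hypothesis M_eq : forall w k, summ (fun l => p0 w k l * bw w l) /\
  bn w k = M w k * bn w (pa a w).

Let M_gt0 w k : 0 < M w k. Proof. by case/andP: (M_bound w k). Qed.
Let tr := trans Phi Psi beta a M.
Let tr_gt0 w k l : 0 < tr w k l. Proof. exact: trans_gt0. Qed.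
Let tr_summ w k : summ (tr w k) /\ tot (tr w k) = 1. Proof. exact: trans_summ. Qed.

(* The weight in which the variation of the density contracts.  Averaging out the
   child y of w costs, by [drift], (d+1) th times the summand y of [Vfun w k], so
   that summing over the children of w reproduces [Vfun w k] with a factor at most
   1/2. *)
Definition Vfun w k : R := \sum_(y <- children w) B y k / M y k.

Lemma Vfun_ge1 w k : 1 <= Vfun w k.
Proof.
rewrite /Vfun (le_trans (y := \sum_(y <- children w) 1)) //.
  rewrite big_const_seq count_predT iter_addr addr0 size_children.
  by rewrite ler1n; case: ifP.
by apply: ler_sum => y _; rewrite ler_pdivlMr// mul1r; case/andP: (M_bound y k).
Qed.

Lemma Vfun_a w : Vfun w (a w) = (size (children w))%:R.
Proof.
rewrite /Vfun (eq_big_seq (fun=> 1)) ?big_const_seq ?count_predT ?iter_addr ?addr0//.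
move=> y; rewrite mem_children => /andP[_ /eqP yw].
by have -> : a w = pa a y; [rewrite /pa yw|rewrite B_pa M_pa divr1].
Qed.

Lemma Vfun_a_le w k : Vfun w (a w) <= Vfun w k.
Proof.
rewrite Vfun_a /Vfun (le_trans (y := \sum_(y <- children w) 1)) //.
  by rewrite big_const_seq count_predT iter_addr addr0.
by apply: ler_sum => y _; rewrite ler_pdivlMr// mul1r; case/andP: (M_bound y k).
Qed.

(** The factor [B y l / M y l] replaces one message by its bound, and the other messages are at most
    theirs; so each of the at most d+1 summands is bounded by the full product of bounds. *)
Lemma bw_Vfun w l : bw w l * Vfun w l <= d.+1%:R * bB w l.
Proof.
have g0l := psi0_gt0 Psi beta a w l.
rewrite /bw /bB /bweight mulrCA -mulrA ler_pM2l//.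
rewrite /Vfun mulr_sumr (le_trans (y := \sum_(y <- children w) \prod_(x <- children w) B x l))//.
  rewrite [leLHS]big_seq [leRHS]big_seq; apply: ler_sum => y yw.
  rewrite !(big_rem y yw) /=; have [m0 mB] := andP (M_bound y l).
  have -> (z : R) : M y l * z * (B y l / M y l) = B y l * z by field; rewrite gt_eqF.
  rewrite ler_wpM2l ?(ltW (B_gt0 _ _))//.
  by apply: ler_prod => x _; have /andP[x0 ->] := M_bound x l; rewrite ltW.
rewrite big_const_seq count_predT iter_addr addr0 -[leLHS]mulr_natl ler_wpM2r//.
  by apply: prodr_ge0 => x _; exact: ltW.
by rewrite ler_nat size_children; case: ifP.
Qed.

(** [H2] bounds the unnormalised sum; the normalisation [M w k * bn w (pa a w)] cancels the
    reference edge weight and leaves the ratio [B w k / M w k]. *)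
Lemma drift w k : summ (off (a w) (fun l => tr w k l * Vfun w l)) /\
  tot (off (a w) (fun l => tr w k l * Vfun w l)) <= d.+1%:R * th * (B w k / M w k).
Proof.
have [s1 t1] := H2 w k; have b0 : 0 < bn w k by exact: bn_gt0.
have c0 : 0 <= d.+1%:R / bn w k by rewrite divr_ge0// ltW.
have [s2 t2] := totZ c0 s1.
have V0 l : 0 <= Vfun w l by rewrite (le_trans ler01)// Vfun_ge1.
have [] := summ_le _ _ s2 (f := off (a w) (fun l => tr w k l * Vfun w l)).
- by move=> l; rewrite /off; case: ifP => // _; rewrite mulr_ge0// ltW.
- move=> l; rewrite /off; case: ifP => _; first by rewrite mulr0.
  rewrite /tr /trans -/p0 -/g0 -/bw -/bn.
  have -> : p0 w k l * bw w l / bn w k * Vfun w l = (p0 w k l / bn w k) * (bw w l * Vfun w l)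
    by ring.
  have -> : d.+1%:R / bn w k * (p0 w k l * bB w l) = (p0 w k l / bn w k) * (d.+1%:R * bB w l)
    by ring.
  by rewrite ler_wpM2l ?bw_Vfun// divr_ge0// ltW// phi0_gt0.
rewrite t2 => s3 t3; split=> //; apply: (le_trans t3).
have pp : 0 < p0 w (pa a w) (a w) by exact: phi0_gt0.
have bpa : p0 w (pa a w) (a w) <= bn w (pa a w).
  have [s4 _] := M_eq w (pa a w); apply: le_trans (tot_term (a w) s4).
  rewrite /bw (bweight_a (b := pa a))// ?mulr1// => [v|v x]; first exact: psi0_a.
  by rewrite mem_children => /andP[_ /eqP xv]; rewrite /pa xv.
rewrite (le_trans (ler_wpM2l c0 t1))// (M_eq w k).2.
have bp0 : 0 < bn w (pa a w) by exact: lt_le_trans bpa.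
have -> : d.+1%:R / (M w k * bn w (pa a w)) * (th * B w k * p0 w (pa a w) (a w)) =
  d.+1%:R * th * (B w k / M w k) * (p0 w (pa a w) (a w) / bn w (pa a w)).
  by field; rewrite !gt_eqF.
rewrite ler_piMr//; first by rewrite !mulr_ge0 ?invr_ge0 ?(ltW (B_gt0 _ _)) ?(ltW (M_gt0 _ _)).
by rewrite ler_pdivrMr// mul1r.
Qed.

Variable mu : probability (ConfSpace d S) R.
Hypothesis muE : forall n eta,
  mu [set s | agreen n eta s] = (pprob Phi Psi beta a M (vprefix d n) eta)%:E.
Variable mu1 : probability (ConfSpace d S) R.
Hypothesis mu1_gibbs : is_gibbs Phi Psi beta mu1.
Variable t : R.
Hypothesis t_gt0 : 0 < t.
Hypothesis mu1_le : forall A, measurable A -> (t%:E * mu1 A <= mu A)%E.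

Let p n eta := pprob Phi Psi beta a M (vprefix d n) eta.
Let q n eta := fine (mu1 (cylinder (vprefix d n) eta)).
Definition dens n eta : R := q n eta / p n eta.

Let p_gt0 n eta : 0 < p n eta. Proof. exact: pprob_gt0. Qed.
Let q_ge0 n eta : 0 <= q n eta. Proof. exact: fine_ge0. Qed.
Let qE n eta : mu1 (cylinder (vprefix d n) eta) = (q n eta)%:E.
Proof. by rewrite fineK// fin_num_measure//; exact: measurable_cylinder. Qed.

Lemma dens_bound n eta : 0 <= dens n eta <= t^-1.
Proof.
rewrite /dens divr_ge0 ?(ltW (p_gt0 _ _))//= ler_pdivrMr// ler_pdivlMl//.
have := mu1_le (measurable_cylinder (vprefix d n) eta).
by rewrite qE (mu_vprefix d_gt0 muE) -EFinM lee_fin.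
Qed.

Lemma dens_local n eta eta' : agreen n eta eta' -> dens n eta = dens n eta'.
Proof.
move=> h; rewrite /dens /q !(cylinder_agreen d_gt0); congr (fine (mu1 _) / _).
  by apply/seteqP; split=> s /= hs i ni; have := hs i ni; rewrite (h i ni).
exact: (pprob_local d_gt0).
Qed.

Lemma dens_step n eta : let k' := kern Phi Psi beta a M n eta in
  summ (fun k => k' k * dens n.+1 (upd eta (venum d n) k)) /\
  dens n eta = tot (fun k => k' k * dens n.+1 (upd eta (venum d n) k)).
Proof.
move=> k'; set w := venum d n.
have pE k : p n.+1 (upd eta w k) = p n eta * k' k by exact: (pprob_next d_gt0).
have qS : \esum_(k in [set: S]) (q n.+1 (upd eta w k))%:E = (q n eta)%:E.
  rewrite -qE (measure_split code_inj mu1 w); last exact: measurable_cylinder.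
  by apply: eq_esum => k _; rewrite -qE (cylinder_next d_gt0).
have [s tq] := summ_esum (fun k => q_ge0 n.+1 (upd eta w k)) qS.
have i0 : 0 <= (p n eta)^-1 by rewrite invr_ge0 ltW.
have [] := totZ i0 s; rewrite tq.
have -> : (fun k => (p n eta)^-1 * q n.+1 (upd eta w k)) =
  (fun k => k' k * dens n.+1 (upd eta (venum d n) k)).
  apply/funext => k; rewrite /dens pE; field.
  by rewrite !gt_eqF//; exact: trans_gt0.
by move=> s2 t2; split=> //; rewrite t2 /dens mulrC.
Qed.

Lemma dens_interior m x eta : (lvl x < m)%N ->
  dens (bsize d m.+1) (upd eta x (a x)) = dens (bsize d m.+1) eta.
Proof.
move=> xm; have [_ ZF] := chain_gibbs code_inj d_gt0 M_gt0 M_eq muE.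
have uL : uniq [:: x] by [].
have Ln v : v \in [:: x] -> ((lvl v).+1 < m.+1)%N by rewrite inE => /eqP ->.
have h : agree [:: x] eta (upd eta x (a x)) by move=> v; rewrite inE => vx; rewrite upd_neq.
have := gibbs_ratio (ZF _ uL) uL Ln mu1_gibbs h.
have := pprob_ratio M_gt0 M_eq uL Ln h.
rewrite (tball_vprefix d_gt0) -!/(p _ _) !qE => pE [qE'].
rewrite /dens; set w1 := wt _ _ _ _ eta in pE qE'; set w2 := wt _ _ _ _ _ in pE qE'.
have w10 : 0 < w1 by exact: wt_gt0.
have w20 : 0 < w2 by exact: wt_gt0.
have -> : q (bsize d m.+1) (upd eta x (a x)) = q (bsize d m.+1) eta * w2 / w1.
  by rewrite -qE' mulfK// gt_eqF.
have -> : p (bsize d m.+1) (upd eta x (a x)) = p (bsize d m.+1) eta * w2 / w1.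
  by rewrite -pE mulfK// gt_eqF.
by field; rewrite !gt_eqF.
Qed.

Definition osc n (U : vertex d -> S -> R) := forall eta x,
  `|dens n eta - dens n (upd eta x (a x))| <= U x (eta x).

(** Averaging out [w] lets the kernel depend on the spin at [par w]. There both densities are
    compared with their values at the reference spin of [w], at the price of one [E] each; at any
    other vertex the two averages use the same kernel. *)
Lemma osc_step n U (E : S -> R) : (0 < n)%N -> osc n.+1 U -> (forall x k, 0 <= U x k) ->
  (forall k, summ (off (a (venum d n)) (fun l => tr (venum d n) k l * U (venum d n) l)) /\
    tot (off (a (venum d n)) (fun l => tr (venum d n) k l * U (venum d n) l)) <= E k) ->
  osc n (fun x k => U x k + (x == par (venum d n))%:R * (E k + E (a x))).
Proof.
move=> n0 oU U0 EP; set w := venum d n in EP *.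
have E0 k : 0 <= E k.
  by apply: le_trans (EP k).2; apply: tot_ge0; exact: (EP k).1.1.
have wv : par w != w.
  rewrite /w; have [j jn <-] := venum_par d_gt0 n0.
  by apply: contraTneq jn => /(venum_inj d_gt0) ->; rewrite ltnn.
have avg eta : `|dens n eta - dens n.+1 (upd eta w (a w))| <= E (eta (par w)).
  have [s1 ->] := dens_step n eta; set P := kern _ _ _ _ _ _ _ in s1 *.
  have [sP tP] : summ P /\ tot P = 1 by exact: tr_summ.
  set c := dens n.+1 (upd eta w (a w)).
  have c0 : 0 <= c by case/andP: (dens_bound n.+1 (upd eta w (a w))).
  have [s2 t2] := totZ c0 sP.
  have cE : (fun k => c * P k) = (fun k => P k * c) by apply/funext => k; rewrite mulrC.
  rewrite cE in s2 t2.
  have -> : c = tot (fun k => P k * c) by rewrite t2 tP mulr1.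
  have [s3 t3] := EP (eta (par w)).
  have oE : off (a w) (fun l => tr w (eta (par w)) l * U w l) =
      (fun k => P k * (if k == a w then 0 else U w k)).
    by apply/funext => k; rewrite /off; case: ifP => _; rewrite ?mulr0.
  apply: le_trans t3; rewrite oE in s3 *.
  apply: tot_average_dist => // [k|k|k]; first exact: sP.1.
    by case: ifP.
  case: eqVneq => [->|ka]; first by rewrite subrr normr0.
  have := oU (upd eta w k) w; rewrite upd_eq.
  have -> // : upd (upd eta w k) w (a w) = upd eta w (a w).
  by apply/funext => y; rewrite /upd; case: (y == w).
move=> eta x; have [->|xw] := eqVneq x w.
  rewrite (@dens_local n (upd eta w (a w)) eta); last exact: agreen_upd.
  by rewrite subrr normr0 addr_ge0// mulr_ge0// addr_ge0.
have comm k : upd (upd eta x (a x)) w k = upd (upd eta w k) x (a x).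
  apply/funext => y; rewrite /upd; case: (eqVneq y w) => [->|//].
  by rewrite eq_sym (negPf xw).
have [xv|xv] := eqVneq x (par w).
  rewrite mul1r; have h1 := avg eta; have h2 := avg (upd eta x (a x)).
  have := oU (upd eta w (a w)) x; rewrite -comm upd_neq// => h3.
  rewrite -xv upd_eq in h1 h2.
  move: h1 h2 h3; rewrite !ler_norml => /andP[? ?] /andP[? ?] /andP[? ?].
  by apply/andP; split; lra.
rewrite mul0r addr0.
have [s1 ->] := dens_step n eta; have [s2 ->] := dens_step n (upd eta x (a x)).
have kE : kern Phi Psi beta a M n (upd eta x (a x)) = kern Phi Psi beta a M n eta.
  by rewrite /kern upd_neq// eq_sym.
rewrite kE in s2 *; set P := kern _ _ _ _ _ _ _ in s1 s2 *.
have [sP tP] : summ P /\ tot P = 1 by exact: tr_summ.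
have [s3 t3] := totZ (U0 x (eta x)) sP.
have cE : (fun k => U x (eta x) * P k) = (fun k => P k * U x (eta x)).
  by apply/funext => k; rewrite mulrC.
rewrite cE tP mulr1 in s3 t3; rewrite -t3.
apply: tot_average_dist => // [k|k]; first exact: sP.1.
by have := oU (upd eta w k) x; rewrite -comm upd_neq.
Qed.

(** Induction on J for all m at once: the bound at level m with one more halving comes from level
    m+1, which is averaged out. For J = 0 the bound [t^-1] on the density and [Vfun >= 1]
    suffice. *)
Lemma osc_level J m : osc (bsize d m.+1)
  (fun x k => if lvl x == m then t^-1 * (1/2) ^+ J * Vfun x k else 0).
Proof.
have out n x eta k : (n <= lvl x)%N ->
    dens (bsize d n) (upd eta x k) = dens (bsize d n) eta.
  move=> nx; apply: dens_local => i; rewrite (venum_lt_bsize d_gt0) => ni.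
  by rewrite upd_neq//; apply: contraTneq nx => <-; rewrite -ltnNge.
elim: J m => [|J IH] m eta x.
  rewrite expr0 mulr1; have [xm|xm|xm] := ltngtP (lvl x) m.
  - by rewrite dens_interior// subrr normr0.
  - by rewrite out// subrr normr0.
  - have /andP[h1 h2] := dens_bound (bsize d m.+1) eta.
    have /andP[h3 h4] := dens_bound (bsize d m.+1) (upd eta x (a x)).
    apply: (@le_trans _ _ t^-1); first by rewrite ler_norml; apply/andP; split; lra.
    by rewrite ler_peMr ?Vfun_ge1// invr_ge0 ltW.
set c := t^-1 * (1/2) ^+ J in IH.
have c0 : 0 <= c by rewrite mulr_ge0 ?invr_ge0 ?(ltW t_gt0)// exprn_ge0// divr_ge0.
pose G w k := c * (d.+1%:R * th * (B w k / M w k)).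
have G0 w k : 0 <= G w k.
  apply: mulr_ge0 => //; apply: mulr_ge0; first by rewrite mulr_ge0.
  by apply: divr_ge0; exact: ltW.

have V0 y l : 0 <= Vfun y l by rewrite (le_trans ler01)// Vfun_ge1.
(* Intermediate weight once the vertices of level m+1 with index at least n are averaged out: each
   has passed its cost [G] to its parent. *)
pose U n y k := (if lvl y == m.+1 then c * Vfun y k else 0) +
  \sum_(n <= i < bsize d m.+2) (y == par (venum d i))%:R * (G (venum d i) k + G (venum d i) (a y)).
have U0 n y k : 0 <= U n y k.
  rewrite addr_ge0//; first by case: ifP => // _; rewrite mulr_ge0.
  by apply: sumr_ge0 => i _; rewrite mulr_ge0// addr_ge0.
have bm : (bsize d m.+1 <= bsize d m.+2)%N by exact: bsize_mono.
have b0 : (0 < bsize d m.+1)%N by rewrite (leq_trans _ (size_tball d_gt0 m.+1)).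
have lev_i i : (bsize d m.+1 <= i < bsize d m.+2)%N -> lvl (venum d i) = m.+1.
  by rewrite leqNgt !(venum_lt_bsize d_gt0) -leqNgt ltnS => h; apply/eqP; rewrite eqn_leq andbC.
have oU j : (j <= bsize d m.+2 - bsize d m.+1)%N -> osc (bsize d m.+2 - j) (U (bsize d m.+2 - j)%N).
  elim: j => [_|j IHj jb].
    by rewrite subn0 => eta' y; rewrite /U big_geq// addr0; exact: IH.
  set n := (bsize d m.+2 - j.+1)%N.
  have nE : (bsize d m.+2 - j)%N = n.+1 by rewrite /n; lia.
  have nb : (bsize d m.+1 <= n < bsize d m.+2)%N by rewrite /n; lia.
  have ln := lev_i n nb.
  rewrite nE in IHj.
  (* Costs are passed to level m only, so the weight at a vertex of level m+1 is still the original
     one and [drift] applies. *)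
  have UwE l : U n.+1 (venum d n) l = c * Vfun (venum d n) l.
    rewrite /U ln eqxx big_nat big1 ?addr0// => i /andP[ni ib].
    rewrite (_ : _ == _ = false) ?mul0r//; apply/eqP => /(congr1 (@lvl d)).
    by rewrite lvl_par ln lev_i; lia.
  have UE : U n = fun y k => U n.+1 y k + (y == par (venum d n))%:R *
      (G (venum d n) k + G (venum d n) (a y)).
    apply/funext => y; apply/funext => k; rewrite /U -addrA; congr (_ + _).
    by rewrite big_ltn 1?addrC//; case/andP: nb.
  rewrite UE; apply: osc_step => //; first by case/andP: nb => h _; exact: leq_trans h.
    by apply: IHj; lia.
  move=> k; have [s1 t1] := drift (venum d n) k.
  have [s2 t2] := totZ c0 s1.
  have oE : (fun l => c * off (a (venum d n)) (fun l => tr (venum d n) k l * Vfun (venum d n) l) l)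
     = off (a (venum d n)) (fun l => tr (venum d n) k l * U n.+1 (venum d n) l).
    by apply/funext => l; rewrite /off UwE; case: ifP; rewrite ?mulr0// mulrCA.
  by rewrite -oE t2; split=> //; rewrite ler_wpM2l.
have := oU _ (leqnn _); rewrite subKn// => {}oU.
have [xm|xm] := eqVneq (lvl x) m; last first.
  have [xm'|xm'] := ltnP (lvl x) m; first by rewrite dens_interior// subrr normr0.
  by rewrite out// ?subrr ?normr0// ltn_neqAle eq_sym xm.
apply: (le_trans (oU eta x)); rewrite /U xm (ltn_eqF (ltnSn m)) add0r.
have -> : \sum_(bsize d m.+1 <= i < bsize d m.+2) (x == par (venum d i))%:R *
     (G (venum d i) (eta x) + G (venum d i) (a x)) =
   \sum_(y <- children x) (G y (eta x) + G y (a x)).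
  rewrite (eq_bigr (fun i => if x == par (venum d i) then
     G (venum d i) (eta x) + G (venum d i) (a x) else 0)); last first.
    by move=> i _; case: ifP; rewrite ?mul1r ?mul0r.
  rewrite -big_mkcond /= -[LHS](big_map (venum d) (fun y => x == par y)
    (fun y => G y (eta x) + G y (a x))) -big_filter; apply: perm_big.
  apply: uniq_perm; rewrite ?children_uniq//.
    by rewrite filter_uniq// map_inj_uniq ?iota_uniq//; exact: venum_inj.
  move=> y; rewrite mem_filter mem_children eq_sym andbC.
  case: (eqVneq (par y) x) => [yx|]; rewrite ?andbF ?andbT//.
  have ly : lvl y = m.+1 <-> lvl y != 0%N.
    by rewrite -xm -yx lvl_par; split; [lia|move=> h; rewrite prednK// lt0n].
  apply/mapP/idP => [[i]|/ly lE].
    by rewrite mem_index_iota => /lev_i li ->; rewrite li.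
  have [i ib iy] := venum_index d_gt0 (ltnSn (lvl y)); exists i => //.
  rewrite mem_index_iota -lE ib andbT leqNgt (venum_lt_bsize d_gt0) iy lE.
  by rewrite ltnn.
(* The children contribute [Vfun] at the actual and at the reference spin, both times [(d+1) th].
   The second is no larger than the first, and [4 (d+1) th <= 1] leaves one half. *)
rewrite big_split /= /G -!mulr_sumr -/(Vfun _ _) -/(Vfun _ _) exprS.
have := Vfun_a_le x (eta x); have := V0 x (a x); move: (V0 x (eta x)).
move: (Vfun x (eta x)) (Vfun x (a x)) => V1 V2 V10 V20 V21.
have -> : t^-1 * (1 / 2 * (1 / 2) ^+ J) * V1 = c * (V1 / 2).
  by rewrite /c; field; rewrite gt_eqF.
rewrite -mulrDr ler_wpM2l// -mulrDr.
have D0 : 0 <= d.+1%:R * th by rewrite mulr_ge0.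
have := ler_wpM2l D0 V21; have := ler_wpM2r V10 th_small; lra.
Qed.

Lemma dens_const m x eta : dens (bsize d m.+1) (upd eta x (a x)) = dens (bsize d m.+1) eta.
Proof.
apply/eqP; rewrite eq_sym -subr_eq0 -normr_le0; apply: (@le_half_expr _ (t^-1 * Vfun x (eta
  x))) => J.
apply: (le_trans (osc_level J m eta x)); have V0 : 0 <= Vfun x (eta x) by rewrite (le_trans
  ler01)// Vfun_ge1.
have t0 : 0 <= t^-1 by rewrite invr_ge0 ltW.
case: ifP => _; last by rewrite mulr_ge0 ?mulr_ge0// exprn_ge0// divr_ge0.
by rewrite mulrAC.
Qed.

Lemma dens_ref m eta : dens (bsize d m.+1) eta = dens (bsize d m.+1) a.
Proof.
pose mix (s : seq (vertex d)) : vertex d -> S := fun v => if v \in s then a v else eta v.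
have -> : dens (bsize d m.+1) eta = dens (bsize d m.+1) (mix (vprefix d (bsize d m.+1))).
  elim: (vprefix d _) => [|x s ->]; first by congr dens; apply/funext.
  rewrite -(dens_const m x (mix s)); congr dens; apply/funext => v.
  by rewrite /upd /mix in_cons; case: eqVneq => [->|].
by apply: dens_local => i ib; rewrite /mix (mem_vprefix d_gt0) ib.
Qed.

(** Averaging keeps a constant, down to the empty prefix, where both measures have mass 1. *)
Lemma dens1 m eta : dens (bsize d m.+1) eta = 1.
Proof.
rewrite dens_ref; set c := dens _ a.
have cE j : (j <= bsize d m.+1)%N -> forall eta, dens (bsize d m.+1 - j) eta = c.
  elim: j => [_ eta0|j IHj jb eta0]; first by rewrite subn0 dens_ref.
  set n := (bsize d m.+1 - j.+1)%N.
  have nE : (bsize d m.+1 - j)%N = n.+1 by rewrite /n; lia.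
  have [_ ->] := dens_step n eta0.
  have [sP tP] := tr_summ (venum d n) (eta0 (par (venum d n))).
  have c0 : 0 <= c by case/andP: (dens_bound (bsize d m.+1) a).
  have [_ t2] := totZ c0 sP; rewrite tP mulr1 in t2; rewrite -[RHS]t2; apply: eq_tot => k.
  by rewrite -nE IHj 1?mulrC//; exact: ltnW.
have := cE _ (leqnn _) eta; rewrite subnn => <-.
rewrite /dens /p /q /pprob /vprefix big_nil divr1 cylinder_nil.
by rewrite -[RHS]/(fine 1%E); congr fine; exact: probability_setT.
Qed.

Lemma dominated_gibbs_eq A : measurable A -> mu1 A = mu A.
Proof.
move=> mA; apply: (@conf_measure_unique _ _ _ _ code_inj mu1 mu 1%N) => // -[//|m] eta _.
rewrite (tball_vprefix d_gt0) qE (mu_vprefix d_gt0 muE).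
by have := dens1 m eta; rewrite /dens => /divr1_eq ->.
Qed.

End Extremality.

(** * Localisation *)

(* [Bd w v k] bounds the message from [w] to its neighbour [v] at spin [k], in
   either direction.  Only messages towards the root define the measure; the
   others serve to bound its marginals. *)
Section LocalizedGibbs.
Variables (R : realType) (d : nat) (S : pointedType) (code : S -> nat).
Hypothesis code_inj : injective code.
Hypothesis d_gt0 : (0 < d)%N.
Variables (Phi : S -> S -> R) (Psi : vertex d -> S -> R) (beta : R) (a : vertex d -> S).
Variables (Bd : vertex d -> vertex d -> S -> R) (th : R).

Definition eweight (v w : vertex d) k l : R :=
  expR (- beta * (if (lvl v < lvl w)%N then Phi k l else Phi l k)).

Let g0 := psi0 Psi beta a.

Hypothesis Bd_gt0 : forall w v k, 0 < Bd w v k.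
Hypothesis Bd_a : forall w v, Bd w v (a v) = 1.
Hypothesis th_ge0 : 0 <= th.
Hypothesis th_small : 4 * d.+1%:R * th <= 1.
Hypothesis Bd_edge : forall v w k, w \in nbrs v -> k != a v ->
  eweight v w k (a w) <= (1 - th) * Bd w v k * eweight v w (a v) (a w).
Hypothesis Bd_sum : forall v w k, w \in nbrs v ->
  let f := off (a w) (fun l => eweight v w k l *
    (g0 w l * \prod_(x <- [seq x <- nbrs w | x != v]) Bd x w l)) in
  summ f /\ tot f <= th * Bd w v k * eweight v w (a v) (a w).
Hypothesis Bd_site : forall v,
  let f := off (a v) (fun l => g0 v l * \prod_(x <- nbrs v) Bd x v l) in
  summ f /\ tot f <= th.

Let p0 := phi0 (d := d) Phi beta.

(* The value 2 at the root is arbitrary: the root sends no message, but it has to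
   satisfy the same hypotheses as the other vertices. *)
Definition Bdown w k : R :=
  if w == troot d then (if k == a w then 1 else 2) else Bd w (par w) k.

Let Bdown_gt0 w k : 0 < Bdown w k.
Proof. by rewrite /Bdown; case: ifP => // _; case: ifP. Qed.

Let Bdown_pa w : Bdown w (pa a w) = 1.
Proof. rewrite /Bdown /pa; case: (eqVneq w (troot d)) => [->|_]; last exact: Bd_a.
by rewrite par_root eqxx. Qed.

Let th_quarter : th <= 1 / 4.
Proof.
have : 4 * th <= 4 * d.+1%:R * th by rewrite ler_wpM2r// ler_peMr// ler1n.
by move=> /le_trans /(_ th_small); lra.
Qed.

Let p0E w k l : w != troot d -> p0 w k l = eweight (par w) w k l.
Proof.
rewrite /p0 /phi0 /eweight => w0; rewrite (negPf w0) lvl_par.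
by rewrite prednK ?leqnn// lt0n lvl_eq0.
Qed.

Let p0E' w k l : w != troot d -> p0 w k l = eweight w (par w) l k.
Proof.
rewrite /p0 /phi0 /eweight => w0; rewrite (negPf w0) lvl_par.
by rewrite ltnNge leq_pred.
Qed.

Let bweight_down w l : bweight (@children d) g0 Bdown w l =
  g0 w l * \prod_(x <- children w) Bd x w l.
Proof.
rewrite /bweight; congr (_ * _); apply: eq_big_seq => x.
by rewrite mem_children lvl_eq0 /Bdown => /andP[/negPf -> /eqP ->].
Qed.

Let Bdown_edge w k : k != pa a w ->
  p0 w k (a w) <= (1 - th) * Bdown w k * p0 w (pa a w) (a w).
Proof.
rewrite /pa => kw; have [w0|w0] := eqVneq w (troot d); last first.
  rewrite !p0E// /Bdown (negPf w0); apply: Bd_edge => //.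
  by rewrite nbrs_sym par_nbrs.
rewrite /p0 /phi0 /Bdown w0 eqxx; rewrite w0 par_root in kw.
by rewrite (negPf kw); have := th_quarter; lra.
Qed.

Let Bdown_sum w k :
  summ (off (a w) (fun l => p0 w k l * bweight (@children d) g0 Bdown w l)) /\
  tot (off (a w) (fun l => p0 w k l * bweight (@children d) g0 Bdown w l))
    <= th * Bdown w k * p0 w (pa a w) (a w).
Proof.
have [w0|w0] := eqVneq w (troot d); last first.
  have := @Bd_sum (par w) w k; rewrite nbrs_sym par_nbrs// => /(_ isT) /=.
  rewrite rest_par// /Bdown (negPf w0) /pa (p0E _ _ w0).
  have -> // : (fun l => p0 w k l * bweight (@children d) g0 Bdown w l) =
    (fun l => eweight (par w) w k l * (g0 w l * \prod_(x <- children w) Bd x w l)).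
  by apply/funext => l; rewrite p0E// bweight_down.
(* At the root the edge factor is 1 and all neighbours are children, so the single-site bound takes
   the place of the edge bound. *)
have := Bd_site w; rewrite /= {2 4}w0 nbrsE lvl_eq0 w0 eqxx cats0.
have -> : (fun l => p0 (troot d) k l * bweight (@children d) g0 Bdown (troot d) l) =
  (fun l => g0 (troot d) l * \prod_(x <- children (troot d)) Bd x (troot d) l).
  by apply/funext => l; rewrite /p0 /phi0 eqxx mul1r bweight_down.
move=> [s1 t1]; split=> //; rewrite (le_trans t1)// /p0 /phi0 eqxx mulr1 ler_peMr//.
by rewrite /Bdown eqxx; case: ifP => // _; lra.
Qed.

Section Marginals.
Variable M : vertex d -> S -> R.
Hypothesis M_bound : forall w k, 0 < M w k <= Bdown w k.
Hypothesis M_pa : forall w, M w (pa a w) = 1.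
Let bw := bweight (@children d) g0 M.
Let bn := bnorm (@children d) p0 g0 M.
Hypothesis M_eq : forall w k, summ (fun l => p0 w k l * bw w l) /\
  bn w k = M w k * bn w (pa a w).
Let M_gt0 w k : 0 < M w k. Proof. by case/andP: (M_bound w k). Qed.
Variable mu : probability (ConfSpace d S) R.
Hypothesis muE : forall n eta,
  mu [set s | agreen n eta s] = (pprob Phi Psi beta a M (vprefix d n) eta)%:E.
Let tr := trans Phi Psi beta a M.

(** The prefix enumerated before [w] contains its parent, and there the identity is the construction
    of the chain. The spins of the prefix are then summed out one at a time. *)
Lemma mu_edge w k l : w != troot d ->
  (mu (site (par w) k `&` site w l) = (tr w k l)%:E * mu (site (par w) k))%E.
Proof.
move=> w0; have [n _ wE] := venum_index d_gt0 (ltnSn (lvl w)).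
have n0 : (0 < n)%N.
  by rewrite lt0n; apply: contra w0 => /eqP n0; rewrite -wE n0.
have [i ni iE] := venum_par d_gt0 n0; rewrite wE in iE.
have ms v k' : measurable (site v k' : set (ConfSpace d S)) by exact: measurable_site.
suff H j : (j <= n)%N -> forall eta,
  (mu (cylinder (vprefix d (n - j)) eta `&` (site (par w) k `&` site w l)) =
   (tr w k l)%:E * mu (cylinder (vprefix d (n - j)) eta `&` site (par w) k))%E.
  by have := H n (leqnn _) (fun=> point); rewrite subnn /vprefix cylinder_nil !setTI.
elim: j => [_ eta|j IH jn eta].
  rewrite subn0; have [ev|ev] := eqVneq (eta (par w)) k; last first.
    have -> : cylinder (vprefix d n) eta `&` (site (par w) k `&` site w l) = set0.
      apply/seteqP; split=> // s [h [/= h1 _]]; move/eqP: ev; apply.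
      by rewrite -h1 h// -iE (mem_vprefix d_gt0).
    have -> : cylinder (vprefix d n) eta `&` site (par w) k = set0.
      apply/seteqP; split=> // s [h /= h1]; move/eqP: ev; apply.
      by rewrite -h1 h// -iE (mem_vprefix d_gt0).
    by rewrite measure0 mule0.
  have e1 : cylinder (vprefix d n) eta `&` site (par w) k = cylinder (vprefix d n) eta.
    apply/seteqP; split=> s; first by case.
    by move=> h; split=> //; rewrite /site /= -ev h// -iE (mem_vprefix d_gt0).
  rewrite setIA e1 -wE (cylinder_next d_gt0) !(mu_vprefix d_gt0 muE) (pprob_next d_gt0) mulrC EFinM.
  by rewrite /kern wE ev.
set m := (n - j.+1)%N; have mE : (n - j)%N = m.+1 by rewrite /m; lia.
rewrite mE in IH.
have mc A : measurable A -> measurable (cylinder (vprefix d m) eta `&` A).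
  by move=> mA; apply: measurableI => //; exact: measurable_cylinder.
rewrite (measure_split code_inj mu (venum d m)); last by apply: mc; exact: measurableI.
rewrite (measure_split code_inj mu (venum d m) (mc _ (ms _ _))).
rewrite -esumZl//; last by rewrite ltW// trans_gt0.
apply: eq_esum => k' _.
by rewrite setIAC (cylinder_next d_gt0) [in RHS]setIAC (cylinder_next d_gt0); apply: IH;
  exact: ltnW.
Qed.

Definition Bup v k : R := if v == troot d then 1 else Bd (par v) v k.

Let prod_nbrs v k : \prod_(x <- nbrs v) Bd x v k = \prod_(x <- children v) Bd x v k * Bup v k.
Proof.
rewrite nbrsE big_cat /= /Bup lvl_eq0; case: ifP => _; first by rewrite big_nil.
by rewrite big_seq1.
Qed.

Let Bup_gt0 v k : 0 < Bup v k.
Proof. by rewrite /Bup; case: ifP. Qed.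

Let M_child v x k : x \in children v -> 0 < M x k <= Bd x v k.
Proof.
rewrite mem_children lvl_eq0 => /andP[x0 /eqP xv]; have := M_bound x k.
by rewrite /Bdown (negPf x0) xv.
Qed.

Let bw_a v : bw v (a v) = 1.
Proof.
rewrite /bw (bweight_a (b := pa a))// => [w|w x]; first exact: psi0_a.
by rewrite mem_children => /andP[_ /eqP xw]; rewrite /pa xw.
Qed.

Let bn_ge w k : p0 w k (a w) <= bn w k.
Proof.
have [s _] := M_eq w k; apply: le_trans (tot_term (a w) s).
by rewrite bw_a mulr1.
Qed.

(** Induction from the root. The parent is at its reference spin, with probability at most 1, or
    excited and bounded by induction. [Bd_edge] and [Bd_sum], read from [w] towards its parent, add
    up to the bound for the downward message, although no such message is constructed. *)
Lemma marginal_le v k : k != a v -> (mu (site v k) <= (bw v k * Bup v k)%:E)%E.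
Proof.
move En : (lvl v) => n; elim: n v En k => [|n IH] v vn k ka.
  have v0 : v = troot d by apply/eqP; rewrite -lvl_eq0 vn.
  have e : site v k = cylinder (vprefix d 1) (upd (fun=> point) v k) :> set (ConfSpace d S).
    have := cylinder_next d_gt0 0 (fun=> point) k; rewrite {1}/vprefix /= cylinder_nil setTI.
    by rewrite v0.
  rewrite e (mu_vprefix d_gt0 muE) /vprefix /= /pprob big_cons big_nil mulr1 lee_fin.
  rewrite v0 upd_eq /trans -/p0 -/g0 -/bw -/bn /p0 /phi0 eqxx mul1r /Bup eqxx mulr1.
  rewrite ler_pdivrMr ?(bn_gt0 M_gt0 M_eq)// ler_peMr ?(ltW (bw_gt0 _ _ _ M_gt0 _ _))//.
  by apply: le_trans (bn_ge _ _); rewrite /p0 /phi0 eqxx.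
have w0 : v != troot d by rewrite -lvl_eq0 vn.
move: v vn w0 ka => w vn w0 ka; move: k ka => l la; set v := par w.
have vw : v \in nbrs w by exact: par_nbrs.
have wv : w \in children v by rewrite mem_children lvl_eq0 w0 eqxx.
have lv : lvl v = n by rewrite lvl_par vn.
have [s1 t1] := Bd_sum l vw; have h1 := Bd_edge vw la.
pose f k := eweight w v l k * (g0 v k * \prod_(x <- [seq x <- nbrs v | x != w]) Bd x v k).
have fa : f (a v) = eweight w v l (a v).
  rewrite /f /g0 psi0_a mul1r big1 ?mulr1// => x _; exact: Bd_a.
have f0 : 0 <= f (a v) by rewrite fa ltW// expR_gt0.
have [sf tf] : summ f /\ tot f = f (a v) + tot (off (a v) f) := tot_split s1 f0.
(* [c * f k] will bound the joint mass of [k] at the parent and [l] at [w]: the [1 / M w k] in the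
   transition cancels the message of [w] inside [bw v k]. *)
set c := bw w l / p0 w (a v) (a w).
have c0 : 0 <= c by rewrite divr_ge0// ltW ?phi0_gt0 ?(bw_gt0 _ _ _ M_gt0).
have [sc tc] := totZ c0 sf.
have ms v' k' : measurable (site v' k' : set (ConfSpace d S)) by exact: measurable_site.
rewrite (measure_split code_inj mu v)//.
apply: (@le_trans _ _ (\esum_(k in [set: S]) (c * f k)%:E)).
  apply: le_esum => k _; apply: (@le_trans _ _ ((tr w k l)%:E * mu (site v k))%E).
    by rewrite setIC le_eqVlt; apply/orP; left; apply/eqP; exact: mu_edge.
  have trE : tr w k l = c * (p0 w k l * (p0 w (a v) (a w) / (M w k * bn w (a v)))).
    rewrite /tr /trans -/p0 -/g0 -/bw -/bn (M_eq w k).2 /c /pa -/v; field.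
    by rewrite !gt_eqF ?M_gt0 ?(bn_gt0 M_gt0 M_eq) ?phi0_gt0.
  have ler : p0 w (a v) (a w) / (M w k * bn w (a v)) <= (M w k)^-1.
    rewrite ler_pdivrMr ?mulr_gt0 ?M_gt0 ?(bn_gt0 M_gt0 M_eq)//.
    by rewrite mulKf ?bn_ge// gt_eqF.
  have pp : 0 <= p0 w k l by rewrite ltW// phi0_gt0.
  have trle : tr w k l <= c * (p0 w k l / M w k).
    by rewrite trE ler_wpM2l// ler_wpM2l.
  have [kv|kv] := eqVneq k (a v).
    rewrite kv in trle *; have M1 : M w (a v) = 1 by exact: M_pa.
    apply: (@le_trans _ _ (tr w (a v) l)%:E).
      rewrite -[leRHS]mule1 lee_pmul2l ?lte_fin ?trans_gt0//.
      exact: probability_le1.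
    by rewrite lee_fin (le_trans trle)// M1 divr1 fa -(p0E' _ _ w0).
  have muk := IH v lv k kv.
  apply: (@le_trans _ _ ((tr w k l)%:E * (bw v k * Bup v k)%:E)%E).
    by rewrite lee_pmul2l ?lte_fin ?trans_gt0.
  rewrite -EFinM lee_fin.
  have bU : 0 <= bw v k * Bup v k by rewrite mulr_ge0 ?(ltW (Bup_gt0 _ _)) ?(ltW (bw_gt0 _ _ _
    M_gt0 _ _)).
  apply: (le_trans (ler_wpM2r bU trle)).
  rewrite -mulrA ler_wpM2l// /f -(p0E' _ _ w0) -mulrA ler_wpM2l//.
  rewrite ler_pdivrMl ?M_gt0//.
  have gv : 0 <= g0 v k by rewrite ltW// psi0_gt0.
  rewrite /bw /bweight -mulrA [leRHS]mulrCA ler_wpM2l//.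
  rewrite -(rem_filter _ (nbrs_uniq v)).
  have -> : \prod_(x <- rem w (nbrs v)) Bd x v k = \prod_(x <- rem w (children v)) Bd x v k *
    Bup v k.
    have wn : w \in nbrs v by rewrite nbrs_sym.
    have := prod_nbrs v k; rewrite (big_rem w wn) (big_rem w wv) /= -mulrA.
    by move/mulfI; apply; rewrite gt_eqF.
  rewrite (big_rem w wv) /= mulrA -!mulrA ler_wpM2l ?(ltW (M_gt0 _ _))//.
  rewrite ler_wpM2r ?(ltW (Bup_gt0 _ _))//.
  rewrite big_seq [leRHS]big_seq; apply: ler_prod => x /mem_rem xv.
  by have /andP[x0 ->] := M_child k xv; rewrite ltW.
rewrite (esum_tot sc) lee_fin tc tf fa /Bup (negPf w0) -/v.
have pp : 0 < p0 w (a v) (a w) by exact: phi0_gt0.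
have pE : eweight w v (a w) (a v) = p0 w (a v) (a w) by rewrite p0E'.
rewrite pE in h1 t1.
have -> : bw w l * Bd v w l = c * (Bd v w l * p0 w (a v) (a w)).
  by rewrite /c; field; rewrite gt_eqF.
by rewrite ler_wpM2l//; lra.
Qed.

Lemma site_le v k : k != a v ->
  (mu (site v k) <= (g0 v k * \prod_(x <- nbrs v) Bd x v k)%:E)%E.
Proof.
move=> ka; apply: (le_trans (marginal_le ka)); rewrite lee_fin prod_nbrs mulrA.
rewrite ler_wpM2r ?(ltW (Bup_gt0 _ _))// /bw /bweight ler_wpM2l//.
  by rewrite ltW// psi0_gt0.
rewrite big_seq [leRHS]big_seq; apply: ler_prod => x xv.
by have /andP[x0 ->] := M_child k xv; rewrite ltW.
Qed.

End Marginals.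

Theorem localized_gibbs : exists mu : probability (ConfSpace d S) R,
  extremal_gibbs Phi Psi beta mu /\
  forall v k, k != a v ->
    (mu (site v k) <= (g0 v k * \prod_(x <- nbrs v) Bd x v k)%:E)%E.
Proof.
have ch_b w x : x \in children w -> pa a x = a w.
  by rewrite mem_children => /andP[_ /eqP xw]; rewrite /pa xw.
have sz w : (size (children (d := d) w) <= d.+1)%N by rewrite size_children; case: ifP.
have [M [M_bound M_pa M_eq]] := boundary_law (phi0_gt0 Phi beta) (psi0_gt0 Psi beta a)
  (psi0_a Psi beta a) Bdown_gt0 Bdown_pa ch_b sz th_ge0 th_small Bdown_edge Bdown_sum.
have M_gt0 w k : 0 < M w k by case/andP: (M_bound w k).
have [mu muE] := chain_measure code_inj d_gt0 M_gt0 M_eq.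
exists mu; split; last by move=> v k; exact: (site_le M_bound M_pa M_eq muE).
have [G _] := chain_gibbs code_inj d_gt0 M_gt0 M_eq muE.
split=> // mu1 mu2 t G1 G2 /andP[t0 t1] muD A mA.
have eq1 := dominated_gibbs_eq code_inj d_gt0 Bdown_gt0 Bdown_pa th_ge0 th_small Bdown_sum
  M_bound M_pa M_eq muE.
have t1' : 0 < 1 - t by rewrite subr_gt0.
split.
  apply: (eq1 mu1 G1 t t0) => // A' mA'; rewrite (muD A' mA') leeDl//.
  by rewrite mule_ge0// lee_fin ltW.
apply: (eq1 mu2 G2 (1 - t) t1') => // A' mA'; rewrite (muD A' mA') leeDr//.
by rewrite mule_ge0// lee_fin ltW.
Qed.

End LocalizedGibbs.

(* [e1 z k] and [e2 z k] bound from below the cost of the spin [k] instead of [z],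
   as seen by a neighbour whose reference spin is [z], resp. differs from [z];
   [e2] may be negative. *)
Section GroundStateFamily.
Variables (R : realType) (d : nat) (S : pointedType) (code : S -> nat).
Hypothesis code_inj : injective code.
Hypothesis d_gt0 : (0 < d)%N.
Variables (Phi : S -> S -> R) (Psi : vertex d -> S -> R) (beta eps kappa : R).
Hypothesis beta_ge0 : 0 <= beta.
Hypothesis Psi_osc : forall v k l, `|Psi v k - Psi v l| <= eps.
Variables (e1 e2 D : S -> S -> R) (G : (vertex d -> S) -> Prop).

Definition edge_energy (v w : vertex d) k l : R :=
  if (lvl v < lvl w)%N then Phi k l else Phi l k.

Definition nbr_cost (y z k : S) : R := if y == z then e1 z k else e2 z k.

Definition list_cost (a : vertex d -> S) (s : seq (vertex d)) (z l : S) : R :=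
  \sum_(x <- s) nbr_cost (a x) z l.

Hypothesis edge_cost : forall a, G a -> forall v w k, w \in nbrs v -> k != a v ->
  nbr_cost (a w) (a v) k + edge_energy v w (a v) (a w) <= edge_energy v w k (a w).
Hypothesis subtree_cost : forall a, G a -> forall v w k l, w \in nbrs v -> l != a w ->
  kappa * D (a w) l + (if k == a v then 0 else nbr_cost (a w) (a v) k)
    + edge_energy v w (a v) (a w) <=
  edge_energy v w k l + list_cost a [seq x <- nbrs w | x != v] (a w) l - eps.
Hypothesis site_cost : forall a, G a -> forall v l, l != a v ->
  kappa * D (a v) l <= list_cost a (nbrs v) (a v) l - eps.

(** Each of the at most d+1 messages entering a vertex contributes the 2 of [msg_bound]. *)
Definition site_bound z l : R := 2 ^+ d.+1 * expR (- (beta * kappa * D z l)).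

Let th : R := (4 * d.+1%:R)^-1.

Hypothesis site_bound_sum : forall z, summ (off z (site_bound z)) /\
  tot (off z (site_bound z)) <= th.

Let th_gt0 : 0 < th. Proof. by rewrite invr_gt0 mulr_gt0. Qed.

Let th_quarter : th <= 1 / 4.
Proof. by rewrite /th invfM mulrC ler_pM2r ?invr_gt0// invf_le1// ler1n. Qed.

Let site_bound_ge0 z l : 0 <= site_bound z l.
Proof. by rewrite mulr_ge0 ?exprn_ge0 ?expR_ge0. Qed.

Section Fixed.
Variable a : vertex d -> S.
Hypothesis Ga : G a.

(** The exponential alone would cover the neighbour's reference spin with nothing to spare; because
    of the 2 and [(1 - th) * 2 >= 1], a share [th] is left for its excited spins. *)
Definition msg_bound (x v : vertex d) k : R :=
  if k == a v then 1 else 2 * expR (- beta * nbr_cost (a x) (a v) k).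

Let msg_bound_gt0 x v k : 0 < msg_bound x v k.
Proof. by rewrite /msg_bound; case: ifP => // _; rewrite mulr_gt0 ?expR_gt0. Qed.

Let msg_prod (s : seq (vertex d)) v l : l != a v -> (size s <= d.+1)%N ->
  psi0 Psi beta a v l * \prod_(x <- s) msg_bound x v l <=
  2 ^+ d.+1 * expR (- beta * (list_cost a s (a v) l - eps)).
Proof.
move=> lv sd; have -> : \prod_(x <- s) msg_bound x v l =
    2 ^+ size s * expR (- beta * list_cost a s (a v) l).
  rewrite /list_cost; elim: (s) => [|x s' IH].
    by rewrite !big_nil expr0 mulr0 expR0 mulr1.
  by rewrite !big_cons IH mulrDr expRD /= exprS /msg_bound (negPf lv); ring.
rewrite mulrCA; apply: ler_pM.
- by rewrite exprn_ge0.
- by rewrite mulr_ge0 ?expR_ge0.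
- by rewrite ler_weXn2l// ler1n.
rewrite /psi0 -expRD ler_expR -mulrDr.
have := Psi_osc v l (a v); rewrite ler_norml => /andP[h _].
by rewrite !mulNr lerN2 ler_wpM2l//; lra.
Qed.

Let msg_edge v w k : w \in nbrs v -> k != a v ->
  eweight Phi beta v w k (a w) <= (1 - th) * msg_bound w v k * eweight Phi beta v w (a v) (a w).
Proof.
move=> wv kv; rewrite /msg_bound (negPf kv).
have := edge_cost Ga wv kv; rewrite /eweight -!/(edge_energy _ _ _ _) => h.
rewrite -!mulrA -expRD mulrA; apply: (@le_trans _ _ (1 * expR (- beta * edge_energy v w k (a w)))).
  by rewrite mul1r.
apply: ler_pM; rewrite ?expR_ge0//; first by have := th_quarter; lra.
by rewrite ler_expR -mulrDr !mulNr lerN2 ler_wpM2l.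
Qed.

(** The conditional term of [subtree_cost] is the exponent of the message at [k]. What is left over
    is the decay [kappa * D], summed by [site_bound_sum]. *)
Let msg_sum v w k : w \in nbrs v ->
  let f := off (a w) (fun l => eweight Phi beta v w k l *
    (psi0 Psi beta a w l * \prod_(x <- [seq x <- nbrs w | x != v]) msg_bound x w l)) in
  summ f /\ tot f <= th * msg_bound w v k * eweight Phi beta v w (a v) (a w).
Proof.
move=> wv f; have [s1 t1] := site_bound_sum (a w).
set c := msg_bound w v k * eweight Phi beta v w (a v) (a w).
have c0 : 0 <= c by rewrite mulr_ge0 ?expR_ge0// ltW.
have [s2 t2] := totZ c0 s1.
have [] := summ_le _ _ s2 (f := f).
- move=> l; rewrite /f /off; case: ifP => // _.
  rewrite !mulr_ge0 ?expR_ge0//.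
  by apply: prodr_ge0 => x _; exact: ltW.
- move=> l; rewrite /f /off; case: ifPn => lw; first by rewrite mulr0.
  have sz : (size [seq x <- nbrs w | x != v] <= d.+1)%N.
    by rewrite size_filter (leq_trans (count_size _ _))// size_nbrs.
  have e0 : 0 <= eweight Phi beta v w k l by exact: expR_ge0.
  apply: (le_trans (ler_wpM2l e0 (msg_prod lw sz))).
  rewrite mulrCA /site_bound [leRHS]mulrCA ler_wpM2l ?exprn_ge0//.
  have := subtree_cost Ga k wv lw; rewrite /c /msg_bound /eweight -!/(edge_energy _ _ _ _).
  case: eqP => _ h; last first.
    rewrite -[leLHS]mul1r -!mulrA ler_pM ?mulr_ge0 ?expR_ge0 ?ler1n//.
    by rewrite -!expRD ler_expR; have := ler_wpM2l beta_ge0 h; lra.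
  by rewrite mul1r -!expRD ler_expR; have := ler_wpM2l beta_ge0 h; lra.
rewrite t2 => sf tf; split=> //; apply: (le_trans tf).
by rewrite -mulrA mulrC ler_wpM2r.
Qed.

Let msg_site v :
  let f := off (a v) (fun l => psi0 Psi beta a v l * \prod_(x <- nbrs v) msg_bound x v l) in
  summ f /\ tot f <= th.
Proof.
move=> f; have [s1 t1] := site_bound_sum (a v).
have [] := summ_le _ _ s1 (f := f).
- move=> l; rewrite /f /off; case: ifP => // _; rewrite mulr_ge0 ?expR_ge0//.
  by apply: prodr_ge0 => x _; exact: ltW.
- move=> l; rewrite /f /off; case: ifPn => lv //.
  apply: (le_trans (msg_prod lv _)); first by rewrite size_nbrs.
  rewrite /site_bound ler_wpM2l ?exprn_ge0// ler_expR.
  by have := ler_wpM2l beta_ge0 (site_cost Ga lv); lra.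
by move=> sf tf; split=> //; apply: le_trans t1.
Qed.

Lemma ground_state_measure : exists mu : probability (ConfSpace d S) R,
  [/\ extremal_gibbs Phi Psi beta mu,
    forall v k, k != a v -> (mu (site v k) <= (site_bound (a v) k)%:E)%E &
    forall v, ((1 - tot (off (a v) (site_bound (a v))))%:E <= mu (site v (a v)))%E].
Proof.
have msg_a w v : msg_bound w v (a v) = 1 by rewrite /msg_bound eqxx.
have th_small : 4 * d.+1%:R * th <= 1 by rewrite /th mulfV// mulf_neq0.
have [mu [mu_ext mu_le]] := localized_gibbs code_inj d_gt0 msg_bound_gt0 msg_a
  (ltW th_gt0) th_small msg_edge msg_sum msg_site.
have mu_site v k : k != a v -> (mu (site v k) <= (site_bound (a v) k)%:E)%E.
  move=> kv; apply: (le_trans (mu_le v k kv)); rewrite lee_fin.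
  apply: (le_trans (msg_prod kv _)); first by rewrite size_nbrs.
  rewrite /site_bound ler_wpM2l ?exprn_ge0// ler_expR.
  by have := ler_wpM2l beta_ge0 (site_cost Ga kv); lra.
exists mu; split=> // v.
pose m k := fine (mu (site v k)).
have mE k : mu (site v k) = (m k)%:E.
  by rewrite fineK// fin_num_measure//; exact: measurable_site.
have m0 k : 0 <= m k by exact: fine_ge0.
have m1 : \esum_(k in [set: S]) (m k)%:E = 1%:E.
  rewrite -[RHS](probability_setT mu) (measure_split code_inj mu v); last exact: measurableT.
  by apply: eq_esum => k _; rewrite setTI; exact: esym (mE k).
have [sm tm] := summ_esum m0 m1.
have som := summ_off (a v) sm.
have [_ tE] := tot_split som (m0 (a v)).
have [ss _] := site_bound_sum (a v).
have [] := summ_le som.1 _ ss => [k|_ ts].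
  rewrite /off; case: ifPn => // kv.
  by rewrite -lee_fin -mE mu_site.
by rewrite mE lee_fin; rewrite tm in tE; lra.
Qed.

End Fixed.

Theorem ground_state_family :
  exists mu : (vertex d -> S) -> probability (ConfSpace d S) R,
  [/\ forall a, G a -> extremal_gibbs Phi Psi beta (mu a),
    forall a a', G a -> G a' -> a <> a' -> distinct_measures (mu a) (mu a'),
    forall a, G a -> forall v k, k != a v -> (mu a (site v k) <= (site_bound (a v) k)%:E)%E &
    forall a, G a -> forall v,
      ((1 - tot (off (a v) (site_bound (a v))))%:E <= mu a (site v (a v)))%E].
Proof.
have /choice[mu muP] : forall a, exists mu : probability (ConfSpace d S) R, G a ->
  [/\ extremal_gibbs Phi Psi beta mu,
    forall v k, k != a v -> (mu (site v k) <= (site_bound (a v) k)%:E)%E &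
    forall v, ((1 - tot (off (a v) (site_bound (a v))))%:E <= mu (site v (a v)))%E].
  move=> a; case: (pselect (G a)) => [Ga|nGa]; last by exists point.
  by have [mu muP] := ground_state_measure Ga; exists mu.
exists mu; split; try by move=> a /muP[].
move=> a a' Ga Ga' aa'.
have [v /eqP av] : exists v, a v <> a' v.
  by apply: contrapT => /forallNP h; apply: aa'; apply/funext => v; apply: contrapT; exact: h.
(* The first measure gives this event mass at least 3/4, the second at most 1/4. *)
exists (site v (a v)); split; first exact: measurable_site.
have [_ _ /(_ v) h1] := muP a Ga; have [_ /(_ v (a v) av) h2 _] := muP a' Ga'.
move=> e; rewrite -e in h2; have := le_trans h1 h2; rewrite lee_fin.
have [_ t1] := site_bound_sum (a v); have [s2 t2] := site_bound_sum (a' v).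
have := tot_term (a v) s2; rewrite {1}/off (negPf av) => t3 t4.
by have := th_quarter; lra.
Qed.

End GroundStateFamily.

(** * The finite-spin model *)

Lemma tot_single (R : realType) (S : choiceType) (i : S) (c : R) : 0 <= c ->
  summ (fun k => if k == i then c else 0) /\ tot (fun k => if k == i then c else 0) = c.
Proof.
move=> c0; have e : off i (fun k => if k == i then c else 0) = fun=> 0.
  by apply/funext => k; rewrite /off; case: (k == i).
have [s0 t0] := @summ0 R S; rewrite -e in s0 t0.
have f0 : 0 <= (fun k => if k == i then c else 0) i by rewrite eqxx.
by have [? ->] := tot_split s0 f0; rewrite t0 eqxx addr0.
Qed.

Lemma tot_ord_le (R : realType) n (f : 'I_n -> R) (c : R) :
  0 <= c -> (forall k, 0 <= f k <= c) -> summ f /\ tot f <= n%:R * c.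
Proof.
move=> c0 fc.
have [s t] := @tot_sum R 'I_n 'I_n (enum 'I_n) (fun i k => if k == i then c else 0)
  (fun i _ => (tot_single i c0).1).
have [] := summ_le _ _ s (f := f).
- by move=> k; case/andP: (fc k).
- move=> k; rewrite big_enum /= (bigD1 k)//= eqxx big1 ?addr0; first by case/andP: (fc k).
  by move=> i; rewrite eq_sym => /negPf ->.
move=> sf tf; split=> //; apply: (le_trans tf); rewrite t.
under eq_bigr do rewrite (tot_single _ c0).2.
by rewrite big_const_seq count_predT iter_addr addr0 size_enum_ord mulr_natl.
Qed.

Lemma list_cost_count (R : realType) (d : nat) (S : pointedType) (e1 e2 : S -> S -> R)
    (a : vertex d -> S) (s : seq (vertex d)) z l :
  list_cost e1 e2 a s z l =
  (size s)%:R * e1 z l + (count (fun x => a x != z) s)%:R * (e2 z l - e1 z l).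
Proof.
rewrite /list_cost; elim: s => [|x s IH]; first by rewrite big_nil !mul0r addr0.
rewrite big_cons IH /nbr_cost /=; case: eqP => _ /=; rewrite ?add0n ?add1n !mulrSr; ring.
Qed.

(** The broken edge saved when [v] and [w] disagree pays for the ground-state energy of the edge
    between them. *)
Lemma count_rest (d : nat) (S : eqType) (a : vertex d -> S) v w dmax :
  broken_deg_le dmax a -> w \in nbrs v ->
  (count (fun x => (a x != a w)) [seq x <- nbrs w | x != v] + (a v != a w) <= dmax)%N.
Proof.
move=> br wv; apply: leq_trans (br w); rewrite nbrs_sym in wv.
have := perm_to_rem wv => /permP /(_ (fun x => a x != a w)) -> /=.
by rewrite addnC (rem_filter _ (nbrs_uniq w)).
Qed.

Lemma expRN_le (R : realType) (x : R) : 0 < x -> expR (- x) <= x^-1.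
Proof.
move=> x0; rewrite expRN lef_pV2 ?posrE ?expR_gt0//.
by have := expR_ge1Dx x; lra.
Qed.

Section FiniteSpin.
Variables (R : realType) (q d dmax : nat) (u : 'I_q.+2 -> 'I_q.+2 -> R).
Hypothesis u_ge0 : forall k l, 0 <= u k l.
Hypothesis u_diag : forall k, u k k = 0.
Hypothesis peierls : (d%:R - 1) * umin u > dmax%:R * (Umax u + umin u).

Lemma Umax_ge k l : u k l <= Umax u.
Proof.
apply: (@le_trans _ _ (\big[Num.max/0]_l u k l)).
  exact: (le_bigmax 0 (fun l => u k l) l).
exact: (le_bigmax 0 (fun k => \big[Num.max/0]_l u k l) k).
Qed.

Lemma Umax_ge0 : 0 <= Umax u.
Proof. exact: le_trans (u_ge0 ord0 ord0) (Umax_ge _ _). Qed.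

Lemma umin_le k l : k != l -> umin u <= u k l.
Proof.
move=> kl; apply: (@le_trans _ _ (\big[Num.min/Umax u]_(l | l != k) u k l)).
  exact: (bigmin_le (Umax u) k (fun k => \big[Num.min/Umax u]_(l | l != k) u k l)).
by apply: (bigmin_le_cond (Umax u)); rewrite eq_sym.
Qed.

Lemma umin_ge0 : 0 <= umin u.
Proof.
apply: le_bigmin => [|k _]; first exact: Umax_ge0.
by apply: le_bigmin => [|l _]; [exact: Umax_ge0|exact: u_ge0].
Qed.

Lemma finite_spin_family : exists eps : R, 0 < eps /\
     forall Psi : vertex d -> 'I_q.+2 -> R,
       (forall (v : vertex d) (k l : 'I_q.+2), `|Psi v k - Psi v l| <= eps) ->
       exists beta0 c C : R, 0 < c /\ 0 < C /\
       forall beta : R, beta0 <= beta ->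
       exists mu : (vertex d -> 'I_q.+2) -> probability (ConfSpace d 'I_q.+2) R,
         (forall om0, G0q dmax om0 ->
            extremal_gibbs u Psi beta (mu om0)) /\
         (forall om0 om1, G0q dmax om0 -> G0q dmax om1 -> om0 <> om1 ->
            distinct_measures (mu om0) (mu om1)) /\
         (forall om0, G0q dmax om0 -> forall v : vertex d,
            (mu om0 [set s : ConfSpace d 'I_q.+2 | s v = om0 v]
              >= (1 - C * expR (- (c * beta)))%R%:E)%E).
Proof.
have U0 := Umax_ge0; have u0 := umin_ge0.
set um := umin u in u0; set Um := Umax u in U0.
pose gap := (d%:R - 1) * um - dmax%:R * (Um + um).
have gap0 : 0 < gap by rewrite subr_gt0.
have d_gt0 : (0 < d)%N.
  rewrite lt0n; apply: contraTneq gap0 => d0; rewrite -leNgt /gap d0.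
  have : 0 <= dmax%:R * (Um + um) by rewrite mulr_ge0// addr_ge0.
  by lra.
(* The same number serves as bound on the potentials and as rate of decay, each taking half of the
   gap. *)
pose kap := gap / 2; have kap0 : 0 < kap by rewrite divr_gt0.
exists kap; split=> // Psi Psi_osc.
pose C : R := q.+2%:R * 2 ^+ d.+1.
have C0 : 0 < C by rewrite mulr_gt0// exprn_gt0.
pose th : R := (4 * d.+1%:R)^-1.
have th0 : 0 < th by rewrite invr_gt0 mulr_gt0.
(* By [expRN_le] this threshold forces [C * expR (- (beta * kap)) <= th]. *)
exists (C / (th * kap)), kap, C; do 2 split=> //; move=> beta betaP.
have beta0 : 0 < beta by apply: lt_le_trans betaP; rewrite divr_gt0// mulr_gt0.
have bk0 : 0 < beta * kap by rewrite mulr_gt0.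
have small : C * expR (- (beta * kap)) <= th.
  apply: (le_trans (ler_wpM2l (ltW C0) (expRN_le bk0))).
  rewrite ler_pdivrMr//; move: betaP; rewrite ler_pdivrMr ?mulr_gt0//.
  by rewrite [X in _ -> _ <= X]mulrCA.
(* An unbroken edge penalises a change of spin by at least u, a broken edge can
   favour it by at most U. *)
pose e1 (z k : 'I_q.+2) := um; pose e2 (z k : 'I_q.+2) := - Um.
pose D (z k : 'I_q.+2) : R := 1.
have sum z : summ (off z (site_bound d beta kap D z)) /\
    tot (off z (site_bound d beta kap D z)) <= C * expR (- (beta * kap)).
  have [|k|s t] := @tot_ord_le _ _ (off z (site_bound d beta kap D z))
      (2 ^+ d.+1 * expR (- (beta * kap))); first by rewrite mulr_ge0 ?expR_ge0// exprn_ge0.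
    rewrite /off /site_bound /D mulr1; case: ifP => _;
      rewrite ?lexx ?andbT ?mulr_ge0 ?expR_ge0 ?exprn_ge0//.
  by split=> //; rewrite -mulrA.
have code_inj : injective (fun k : 'I_q.+2 => nat_of_ord k) by exact: val_inj.
have ee0 (v w : vertex d) k l : 0 <= edge_energy u v w k l.
  by rewrite /edge_energy; case: ifP.
have eeU (v w : vertex d) k l : edge_energy u v w k l <= Um.
  by rewrite /edge_energy; case: ifP => _; exact: Umax_ge.
have eeu (v w : vertex d) k l : k != l -> um <= edge_energy u v w k l.
  by rewrite /edge_energy; case: ifP => _ kl; apply: umin_le; rewrite // eq_sym.
have ee_diag (v w : vertex d) k : edge_energy u v w k k = 0.
  by rewrite /edge_energy u_diag if_same.
have [] // := @ground_state_family R d 'I_q.+2 _ code_inj d_gt0 u Psi beta kap kap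
   (ltW beta0) Psi_osc e1 e2 D (@G0q q.+2 d dmax).
- move=> a br v w k wv kv; rewrite /nbr_cost /e1 /e2.
  have [awv|awv] := eqVneq (a w) (a v); first by rewrite awv ee_diag addr0 eeu.
  by have := ee0 v w k (a w); have := eeU v w (a v) (a w); lra.
(* With an unbroken edge to [v], one of the d contributions [um] is spent on the message at [k],
   whence d - 1 in the hypothesis. With a broken one, at most [dmax - 1] of the d other edges are
   broken, and the [Um + um] saved covers the edge energy. *)
- move=> a br v w k l wv lw; rewrite list_cost_count size_rest ?(nbrs_sym w)//.
  have := count_rest br wv; set b := count _ _.
  rewrite /nbr_cost /D /e1 /e2 mulr1; have k0 := ee0 v w k l; have kU := eeU v w (a v) (a w).
  have [awv|awv] := eqVneq (a w) (a v).
    rewrite awv ee_diag /= addn0 -(ler_nat R) => bd.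
    have := ler_wpM2r (addr_ge0 U0 u0) bd.
    by case: ifP => _; move: gap0; rewrite /kap /gap; lra.
  rewrite /= addn1 -(ler_nat R) mulrSr => bd.
  have := ler_wpM2r (addr_ge0 U0 u0) bd.
  by case: ifP => _; move: gap0; rewrite /kap /gap; lra.
- move=> a br v l lv; rewrite list_cost_count size_nbrs.
  have := br v; rewrite -(ler_nat R) => bd.
  have := ler_wpM2r (addr_ge0 U0 u0) bd.
  by rewrite /D /e1 /e2 mulrSr; move: gap0; rewrite /kap /gap; lra.
- by move=> z; have [s t] := sum z; split=> //; apply: le_trans t small.
move=> mu [mu1 mu2 _ mu4]; exists mu; split=> //; split=> // a Ga v.
apply: le_trans (mu4 a Ga v); rewrite lee_fin lerB//.
by rewrite (mulrC kap); exact: (sum _).2.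
Qed.
End FiniteSpin.

(** * The p-SOS model *)

Section SosCost.
Variables (R : realType) (p : R).
Hypothesis p_gt0 : 0 < p.

Lemma c_p_gt0 : 0 < c_p p.
Proof. by rewrite /c_p lt_min powR_gt0 ?ltr01. Qed.

Lemma c_p_le1 : c_p p <= 1.
Proof. by rewrite /c_p ge_min lexx orbT. Qed.

Lemma powR_quasi_triangle (x y : R) : 0 <= x -> 0 <= y ->
  c_p p * (x + y) `^ p <= x `^ p + y `^ p.
Proof.
move=> x0 y0; have [p1|p1] := leP 1 p.
  have h : (2^-1 * x + 2^-1 * y) `^ p <= 2^-1 * x `^ p + 2^-1 * y `^ p.
    rewrite {2 4}(_ : 2^-1 = 1 - 2^-1); last by field.
    by apply: (convex_powR p1 (Itv01 _ _)) => //=;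
      rewrite ?inE/= ?in_itv/= ?x0 ?y0 ?invr_ge0// invf_le1 ?ler1n.
  rewrite -mulrDr powRM ?addr_ge0 ?invr_ge0// in h.
  have c2 : c_p p <= 2 * (2^-1 `^ p).
    rewrite /c_p ge_min; apply/orP; left.
    rewrite powRB; last by rewrite pnatr_eq0 implybT.
    have -> : (2^-1 : R) `^ p = (2 `^ p)^-1 by rewrite -powR_inv1// -powRrM mulN1r powRN.
    by rewrite powRr1.
  apply: (le_trans (ler_wpM2r (powR_ge0 _ _) c2)); lra.
have [s0|s0] := eqVneq (x + y) 0.
  by rewrite s0 powR0 ?gt_eqF// mulr0 addr_ge0// powR_ge0.
have sp : 0 < x + y by rewrite lt_neqAle eq_sym s0 addr_ge0.
apply: (@le_trans _ _ ((x + y) `^ p)).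
  by rewrite -[leRHS]mul1r ler_wpM2r ?powR_ge0 ?c_p_le1.
have key (z : R) : 0 <= z -> z <= x + y -> z / (x + y) * (x + y) `^ p <= z `^ p.
  move=> z0 zs; have [->|zn0] := eqVneq z 0; first by rewrite !mul0r powR_ge0.
  have zp : 0 < z by rewrite lt_neqAle eq_sym zn0.
  have -> : z `^ p = (z / (x + y)) `^ p * (x + y) `^ p.
    by rewrite -powRM ?divr_ge0 ?(ltW sp)// divfK.
  rewrite ler_wpM2r ?powR_ge0//; apply: ger1_powR; last exact: ltW.
  by rewrite divr_gt0//= ler_pdivrMr// mul1r.
have hx := key x x0; have hy := key y y0.
have -> : (x + y) `^ p = x / (x + y) * (x + y) `^ p + y / (x + y) * (x + y) `^ p.
  by rewrite -mulrDl -mulrDl divff// mul1r.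
by apply: lerD; [apply: hx|apply: hy]; rewrite ?lerDl ?lerDr.
Qed.

Definition nrm (i : int) : R := (`|i%:~R| : R) `^ p.

Lemma nrm0 : nrm 0 = 0.
Proof. by rewrite /nrm normr0 powR0// gt_eqF. Qed.

Lemma nrm_ge0 i : 0 <= nrm i.
Proof. exact: powR_ge0. Qed.

Lemma nrmN i : nrm (- i) = nrm i.
Proof. by rewrite /nrm mulrNz normrN. Qed.

Lemma norm_int_ge1 (i : int) : i != 0 -> 1 <= (`|i%:~R| : R).
Proof. by move=> i0; rewrite -intr_norm ler1z; lia. Qed.

Lemma nrm_ge1 i : i != 0 -> 1 <= nrm i.
Proof.
move=> i0; have -> : 1 = 1 `^ p :> R by rewrite powR1.
apply: ge0_ler_powR; rewrite ?nnegrE//; first exact: ltW.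
exact: norm_int_ge1.
Qed.

Lemma nrm_quasi_triangle i j : c_p p * nrm (i + j) <= nrm i + nrm j.
Proof.
rewrite /nrm; apply: le_trans (powR_quasi_triangle (normr_ge0 _) (normr_ge0 _)).
rewrite ler_wpM2l ?(ltW c_p_gt0)//; apply: ge0_ler_powR; rewrite ?nnegrE ?addr_ge0//;
  first exact: ltW.
by rewrite intrD ler_normD.
Qed.

Lemma nrm_le i (M : nat) : (absz i <= M)%N -> nrm i <= M%:R `^ p.
Proof.
move=> iM; rewrite /nrm; apply: ge0_ler_powR; rewrite ?nnegrE//; first exact: ltW.
by rewrite -intr_norm -abszE -pmulrn ler_nat.
Qed.

End SosCost.

(** * Inverse squares over the integers *)

Section IntSum.
Variable R : realType.

Let sq (i : int) : R := if i == 0 then 0 else (i%:~R ^+ 2)^-1.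

Let sq_ge0 i : 0 <= sq i.
Proof. by rewrite /sq; case: ifP => // _; rewrite invr_ge0 sqr_ge0. Qed.

Lemma sum_inv_sqr n : \sum_(0 <= k < n) ((k.+1%:R : R) ^+ 2)^-1 <= 2.
Proof.
case: n => [|n]; first by rewrite big_geq.
suff : \sum_(0 <= k < n.+1) ((k.+1%:R : R) ^+ 2)^-1 <= 2 - (n.+1%:R)^-1.
  by move=> /le_trans; apply; rewrite gerBl invr_ge0.
elim: n => [|n IH]; first by rewrite big_nat1 expr1n invr1; lra.
rewrite big_nat_recr //=; apply: (le_trans (lerD IH (lexx _))).
have n0 : 0 <= n%:R :> R by [].
have -> : (n.+2%:R : R) = n%:R + 2 by rewrite -addn2 natrD.
have -> : (n.+1%:R : R) = n%:R + 1 by rewrite -addn1 natrD.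
rewrite -subr_ge0; set x : R := n%:R in n0 *.
have -> : 2 - (x + 2)^-1 - (2 - (x + 1)^-1 + ((x + 2) ^+ 2)^-1) =
  1 / ((x + 1) * (x + 2) ^+ 2).
  by field; rewrite !gt_eqF//; lra.
by rewrite divr_ge0// mulr_ge0 ?sqr_ge0//; lra.
Qed.

Lemma tot_inv_sqr : summ sq /\ tot sq <= 4.
Proof.
have part (e : nat -> int) : injective e ->
    (forall n, \sum_(0 <= k < n) sq (e k) <= 2) ->
    (\esum_(i in range e) (sq i)%:E <= 2%:E)%E.
  move=> einj e2; rewrite (esum_image _ e) => [|x y _ _]; last exact: einj.
  rewrite -nneseries_esumT => [|n]; last by rewrite lee_fin.
  apply: lime_le; first by apply: is_cvg_nneseries => n _; rewrite lee_fin.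
  by apply: nearW => n; rewrite sumEFin lee_fin.
have pos : (\esum_(i in range Posz) (sq i)%:E <= 2%:E)%E.
  apply: part => [x y []//|[|n]]; first by rewrite big_geq.
  rewrite big_nat_recl// /sq eqxx add0r; exact: sum_inv_sqr.
have neg : (\esum_(i in ~` range Posz) (sq i)%:E <= 2%:E)%E.
  have -> : ~` range Posz = range Negz.
    apply/seteqP; split=> [[n|n] //= h|_ [n _ <-] [m _]//]; last by exists n.
    by case: h; exists n.
  apply: part => [x y []//|n].
  under eq_bigr do rewrite /sq /= NegzE mulrNz sqrrN.
  exact: sum_inv_sqr.
apply: summ_bound => //; rewrite (esumID (range Posz)) => [|i _]; last by rewrite lee_fin.
rewrite !setTI (_ : 4 = 2 + 2) ?EFinD; last by rewrite -natrD.
exact: leeD.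
Qed.

End IntSum.

(** * Summability of the SOS weights *)

Section SosSum.
Variables (R : realType) (p : R).
Hypothesis p_gt0 : 0 < p.

Lemma expRN_nrm_le : exists K : R, 0 < K /\ forall (b : R) (i : int), 1 <= b -> i != 0 ->
  expR (- (b * nrm p i)) <= K / b * (i%:~R ^+ 2)^-1.
Proof.
(* Degree m+1 makes the Taylor term of the exponential at least of order [i ^ 2], however small p
   is; this gives decay like inverse squares. *)
pose m := Num.bound (2 / p).
have m2 : 2 <= p * m.+1%:R.
  have : 2 / p < m%:R by apply: archi_boundP; rewrite divr_ge0// ltW.
  by rewrite ltr_pdivrMr// mulrC => /ltW /le_trans; apply; rewrite ler_wpM2l ?ler_nat// ltW.
exists (m.+1)`!%:R; split=> [|b i b1 i0]; first by rewrite ltr0n fact_gt0.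
have b0 : 0 < b by exact: lt_le_trans b1.
have n1 := nrm_ge1 p_gt0 i0.
have x0 : 0 < b * nrm p i by rewrite mulr_gt0// (lt_le_trans ltr01).
have f0 : 0 < (m.+1)`!%:R :> R by rewrite ltr0n fact_gt0.
have i2 : 0 < i%:~R ^+ 2 :> R by rewrite exprn_even_gt0//= intr_eq0.
have low : b * i%:~R ^+ 2 <= (b * nrm p i) ^+ m.+1.
  rewrite exprMn ler_pM ?sqr_ge0 ?(ltW b0)//; first by rewrite ler_eXnr.
  rewrite /nrm -(@real_normK _ i%:~R) ?num_real// -!powR_mulrn ?powR_ge0// -powRrM.
  apply: ler_powR => //.
  exact: norm_int_ge1.
have := expR_ge1Dxn m (ltW x0) => h.
rewrite expRN -mulrA -invfM -[leRHS]invrK lef_pV2 ?posrE ?expR_gt0//; last first.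
  by rewrite invr_gt0 divr_gt0// mulr_gt0.
rewrite invf_div; apply: le_trans h; apply: (@le_trans _ _ ((b * nrm p i) ^+ m.+1 / (m.+1)`!%:R)).
  by rewrite ler_wpM2r// invr_ge0 ltW.
by rewrite lerDr.
Qed.

(** Translation reduces to [z = 0]; the factor [1 / b] makes the excited mass small at low
    temperature, uniformly in the reference spin. *)
Lemma tot_expRN_nrm : exists K : R, 0 < K /\ forall (b : R) (z : int), 1 <= b ->
  summ (off z (fun l => expR (- (b * nrm p (l - z))))) /\
  tot (off z (fun l => expR (- (b * nrm p (l - z))))) <= K / b.
Proof.
have [K [K0 KP]] := expRN_nrm_le; exists (K * 4); split=> [|b z b1]; first by rewrite mulr_gt0.
have b0 : 0 < b by exact: lt_le_trans b1.
have [s t] := tot_inv_sqr R.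
have Kb : 0 <= K / b by rewrite divr_ge0// ltW.
have [s2 t2] := totZ Kb s.
have e : \esum_(l in [set: int]) (off z (fun l => expR (- (b * nrm p (l - z)))) l)%:E =
   \esum_(i in [set: int]) (off 0 (fun i => expR (- (b * nrm p i))) i)%:E.
  rewrite (reindex_esum [set: int] [set: int] (fun i => i + z)).
    by apply: eq_esum => i _; rewrite /off addrK -[X in _ == X]add0r (inj_eq (addIr z)).
  split=> // [x y _ _|y _]; first exact: addIr.
  by exists (y - z) => //; rewrite subrK.
have off0 c (f : int -> R) i : (forall i, 0 <= f i) -> 0 <= off c f i.
  by move=> f0; rewrite /off; case: ifP.
apply: summ_bound => [l|]; first by apply: off0 => i; exact: expR_ge0.
rewrite e mulrAC -[leRHS]/((K / b * 4)%:E).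
apply: (@le_trans _ _ (\esum_(i in [set: int]) (K / b *
   (if i == 0 then 0 else (i%:~R ^+ 2)^-1))%:E)).
  apply: le_esum => i _; rewrite lee_fin /off; case: ifPn => i0; first by rewrite mulr0.
  exact: KP.
by rewrite (esum_tot s2) lee_fin t2 ler_wpM2l.
Qed.

End SosSum.

(** * Peierls costs for the SOS model *)

Section SosModel.
Variables (R : realType) (p : R) (M dmax d : nat).
Hypothesis p_gt0 : 0 < p.
Hypothesis d_large : (d_threshold p M dmax <= d%:Z)%R.

Let c : R := c_p p.
Let m : R := M%:R `^ p.

(** [1 + floor X] exceeds [X], so the integer threshold gives a strict inequality; multiplying by
    [c ^+ 2] clears the inverse powers. *)
Lemma sos_gap : 1 + (1 + c) * dmax%:R * m < d%:R * c ^+ 2.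
Proof.
have c0 : 0 < c by exact: c_p_gt0.
set X : R := c ^- 2 + (c^-1 + c ^- 2) * dmax%:R * m.
have Xd : X < d%:R.
  have := d_large; rewrite /d_threshold -/c -/m -/X => h.
  apply: (lt_le_trans (floorD1_gt X)).
  by rewrite addrC -[leRHS]/((d%:Z)%:~R) ler_int.
have c2 : 0 < c ^+ 2 by rewrite exprn_gt0.
have : X * c ^+ 2 < d%:R * c ^+ 2 by rewrite ltr_pM2r.
have -> // : X * c ^+ 2 = 1 + (1 + c) * dmax%:R * m.
by rewrite /X; field; rewrite gt_eqF.
Qed.

Lemma sos_family : exists eps : R, 0 < eps /\
     forall Psi : vertex d -> int -> R,
       (forall (v : vertex d) (k l : int), `|Psi v k - Psi v l| <= eps) ->
       exists beta0 c C : R, 0 < c /\ 0 < C /\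
       forall beta : R, beta0 <= beta ->
       exists mu : (vertex d -> int) -> probability (ConfSpace d int) R,
         (forall om0, G0 dmax M om0 ->
            extremal_gibbs (sosPhi p) Psi beta (mu om0)) /\
         (forall om0 om1, G0 dmax M om0 -> G0 dmax M om1 -> om0 <> om1 ->
            distinct_measures (mu om0) (mu om1)) /\
         (forall om0, G0 dmax M om0 -> forall (v : vertex d) (k : int),
            (mu om0 [set s : ConfSpace d int | (s v - om0 v = k)%R]
              <= (C * expR (- (c * beta * ((`|k%:~R| : R) `^ p))))%R%:E)%E).
Proof.
have c0 : 0 < c by exact: c_p_gt0.
have c1 : c <= 1 by exact: c_p_le1.
have m0 : 0 <= m by exact: powR_ge0.
have gapP := sos_gap.
pose gap := d%:R * c ^+ 2 - (1 + (1 + c) * dmax%:R * m).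
have gap0 : 0 < gap by rewrite subr_gt0.
have d_gt0 : (0 < d)%N.
  rewrite lt0n; apply: contraTneq gap0 => d0; rewrite -leNgt /gap d0 mul0r.
  have : 0 <= (1 + c) * dmax%:R * m by rewrite !mulr_ge0// addr_ge0// ltW.
  by lra.
pose kap := gap / 2; have kap0 : 0 < kap by rewrite divr_gt0.
exists kap; split=> // Psi Psi_osc.
pose th : R := (4 * d.+1%:R)^-1.
have th0 : 0 < th by rewrite invr_gt0 mulr_gt0.
have [K [K0 KP]] := tot_expRN_nrm p_gt0.
pose C : R := 2 ^+ d.+1.
have C0 : 0 < C by rewrite exprn_gt0.
have C1 : 1 <= C by rewrite exprn_ege1// ler1n.
(* The first summand ensures [1 <= beta * kap], as the summation estimate requires, the second that
   the excited mass is at most [th]. *)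
exists (kap^-1 + C * K / (th * kap)), kap, C; do 2 split=> //; move=> beta betaP.
have r0 : 0 < C * K / (th * kap) by rewrite divr_gt0 ?mulr_gt0.
have k0 : 0 < kap^-1 by rewrite invr_gt0.
have beta0 : 0 < beta by apply: lt_le_trans betaP; rewrite addr_gt0.
have bk1 : 1 <= beta * kap.
  rewrite -ler_pdivrMr// mul1r; apply: le_trans betaP; by rewrite lerDl ltW.
have bk0 : 0 < beta * kap by exact: lt_le_trans bk1.
have small : C * (K / (beta * kap)) <= th.
  rewrite mulrA ler_pdivrMr// (mulrC th) -mulrA -ler_pdivrMr ?mulr_gt0//.
  by rewrite (mulrC kap); apply: le_trans betaP; rewrite lerDr ltW.
pose n := nrm p.
(* Each use of the quasi-triangle inequality costs a factor c; a broken edge costs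
   at most m in the ground state. *)
pose e1 (z k : int) := c * n (k - z).
pose e2 (z k : int) := c ^+ 2 * n (k - z) - (1 + c) * m.
pose D (z k : int) := n (k - z).
have sum z : summ (off z (site_bound d beta kap D z)) /\
    tot (off z (site_bound d beta kap D z)) <= th.
  have [s t] := KP (beta * kap) z bk1; have [s2 t2] := totZ (ltW C0) s.
  have -> : off z (site_bound d beta kap D z) =
     (fun k => C * off z (fun l => expR (- (beta * kap * nrm p (l - z)))) k).
    by apply/funext => k; rewrite /off; case: ifP; rewrite ?mulr0.
  by split=> //; rewrite t2; apply: le_trans small; rewrite ler_wpM2l// ltW.
have code_inj : injective (@choice.pickle int) by exact: pcan_inj choice.pickleK.
have n0 i : 0 <= n i by exact: nrm_ge0.
have nN i : n (- i) = n i by exact: nrmN.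
have n1 i : i != 0 -> 1 <= n i by exact: nrm_ge1.
have ntri i j k : c * n (i - k) <= n (i - j) + n (j - k).
  by have := nrm_quasi_triangle p_gt0 (i - j) (j - k); rewrite addrA subrK.
have nM (a : vertex d -> int) v w : G0 dmax M a -> w \in nbrs v -> n (a v - a w) <= m.
  by move=> [_ h] wv; apply: nrm_le => //; exact: h.
have eeE (v w : vertex d) k l : edge_energy (sosPhi p) v w k l = n (k - l).
  by rewrite /edge_energy /sosPhi; case: ifP => // _; rewrite -/(nrm p _) -/n -nN opprB.
(* The 1 will pay for a triangle inequality, [2 * kap] for potential and decay. Since [n >= 1] off
   0, the constant losses of [dmax] broken edges are absorbed into multiples of [n]; those not
   incurred are kept for a broken edge to [v]. *)
have cost s b z l : l != z -> (d <= s)%N -> 0 <= b -> b <= dmax%:R -> b <= s%:R ->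
    (1 + 2 * kap) * n (l - z) + (dmax%:R - b) * ((1 + c) * m) <=
    s%:R * e1 z l + b * (e2 z l - e1 z l).
  move=> lz ds b0 bd bs; have nl : 1 <= n (l - z) by apply: n1; rewrite subr_eq0.
  have c2 : c ^+ 2 <= c by rewrite expr2 ler_piMr// ltW.
  have sd : d%:R <= s%:R :> R by rewrite ler_nat.
  rewrite /e1 /e2; move: (n (l - z)) nl => N N1.
  have h1 : (1 + 2 * kap) + (1 + c) * dmax%:R * m = d%:R * c ^+ 2 by rewrite /kap /gap; field.
  have A0 : 0 <= (1 + c) * m by rewrite mulr_ge0// addr_ge0// ltW.
  have h2 : 0 <= (s%:R - b) * (c - c ^+ 2) by rewrite mulr_ge0 ?subr_ge0.
  have h3 : 0 <= (s%:R - d%:R) * c ^+ 2 by rewrite mulr_ge0 ?subr_ge0 ?sqr_ge0.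
  have h4 : 0 <= dmax%:R * ((1 + c) * m) * (N - 1) by rewrite mulr_ge0 ?subr_ge0// mulr_ge0.
  have N0 : 0 <= N by lra.
  have h5 := mulr_ge0 (addr_ge0 h2 h3) N0.
  rewrite -subr_ge0; set X := (X in 0 <= X).
  have -> : X = ((s%:R - b) * (c - c ^+ 2) + (s%:R - d%:R) * c ^+ 2) * N +
     dmax%:R * ((1 + c) * m) * (N - 1) +
     (d%:R * c ^+ 2 - ((1 + 2 * kap) + (1 + c) * dmax%:R * m)) * N.
    by rewrite /X; ring.
  by rewrite h1 subrr mul0r addr0 addr_ge0.
have [] // := @ground_state_family R d int _ code_inj d_gt0 (sosPhi p) Psi beta kap kap
   (ltW beta0) Psi_osc e1 e2 D (@G0 d dmax M).
- move=> a Ga v w k wv kv; rewrite /nbr_cost !eeE /e1 /e2.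
  have [awv|awv] := eqVneq (a w) (a v).
    by rewrite awv subrr /n nrm0// addr0 -/n ler_piMl.
  have := nM a v w Ga wv; have := ntri k (a w) (a v); rewrite -(nN (a w - a v)) opprB => h1 h2.
  have := ler_wpM2l (ltW c0) h1; have : c * n (k - a w) <= n (k - a w) by rewrite ler_piMl.
  have : c * n (a v - a w) <= c * m by rewrite ler_wpM2l// ltW.
  by rewrite expr2; lra.
(* The message at [k] is paid by [n (k - l)] and one [n (l - a w)]. Going from [k] through [l] to
   [a w] costs one factor [c]; going on to [a v] across a broken edge costs the second, and
   [c * m]. *)
- move=> a Ga v w k l wv lw; rewrite list_cost_count !eeE.
  have := count_rest Ga.1 wv; set s := [seq _ <- _ | _]; set b := count _ s => bd.
  have sd : size s = d by rewrite /s size_rest// nbrs_sym.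
  have bs : b%:R <= (size s)%:R :> R by rewrite ler_nat count_size.
  have b0 : 0 <= b%:R :> R by [].
  have bd' : b%:R <= dmax%:R :> R by rewrite ler_nat (leq_trans (leq_addr _ _) bd).
  have := cost (size s) b%:R (a w) l lw _ b0 bd' bs; rewrite {1}sd => /(_ (leqnn _)).
  have : 1 <= n (l - a w) by apply: n1; rewrite subr_eq0.
  rewrite /nbr_cost /D; set X := _ * e1 _ _ + _ => N1 hX.
  have kN : kap <= kap * n (l - a w) by rewrite ler_peMr// ltW.
  have A0 : 0 <= (1 + c) * m by rewrite mulr_ge0// addr_ge0// ltW.
  have cm : 0 <= c * m by rewrite mulr_ge0// ltW.
  have [awv|awv] := eqVneq (a w) (a v).
    have hA : 0 <= (dmax%:R - b%:R) * ((1 + c) * m) by rewrite mulr_ge0 ?subr_ge0.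
    rewrite -awv subrr /n nrm0// -/n /e1 awv; have := ntri k l (a v); rewrite -awv.
    by case: ifP => _; have := n0 (k - l); lra.
  have hA : (1 + c) * m <= (dmax%:R - b%:R) * ((1 + c) * m).
    rewrite ler_peMl// lerBrDr addrC natr1 ler_nat.
    by move: bd; rewrite eq_sym awv addn1.
  have h1 := nM a v w Ga wv; have h2 := n0 (k - l); have h3 := ntri k l (a w).
  case: eqP => _; first by lra.
  have h4 := ntri k (a w) (a v); rewrite -(nN (a w - a v)) opprB in h4.
  have := ler_wpM2l (ltW c0) h4; have : c * n (a v - a w) <= c * m by rewrite ler_wpM2l// ltW.
  by rewrite /e2 expr2; lra.
- move=> a Ga v l lv; rewrite list_cost_count size_nbrs.
  set b := count _ _; have bd : b%:R <= dmax%:R :> R by rewrite ler_nat; exact: Ga.1.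
  have bs : b%:R <= d.+1%:R :> R by rewrite ler_nat -[X in (_ <= X)%N](size_nbrs v) count_size.
  have b0 : 0 <= b%:R :> R by [].
  have := cost d.+1 b%:R (a v) l lv (leqnSn d) b0 bd bs.
  have : 1 <= n (l - a v) by apply: n1; rewrite subr_eq0.
  rewrite /D; set X := _ * e1 _ _ + _ => N1 hX.
  have kN : kap <= kap * n (l - a v) by rewrite ler_peMr// ltW.
  have A0 : 0 <= (dmax%:R - b%:R) * ((1 + c) * m).
    by rewrite mulr_ge0 ?subr_ge0// mulr_ge0// addr_ge0// ltW.
  by lra.
move=> mu [mu1 mu2 mu3 _]; exists mu; split=> //; split=> // a Ga v k.
have -> : [set s : ConfSpace d int | s v - a v = k] = site v (a v + k).
  by apply/seteqP; split=> s /= => [<-|->]; rewrite ?subrKC ?addrK// addrC ?addKr ?subrK.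
(* The Peierls bound covers excited spins only; at 0 the claim is trivial because [1 <= C]. *)
have [->|k0'] := eqVneq k 0.
  rewrite normr0 powR0 ?gt_eqF// mulr0 oppr0 expR0 mulr1.
  by apply: le_trans (probability_le1 _ _) _; [exact: measurable_site|rewrite lee_fin].
apply: le_trans (mu3 a Ga v (a v + k) _) _; first by rewrite -subr_eq0 addrC addKr.
rewrite lee_fin /site_bound /D /C /n /nrm (mulrC kap).
by rewrite (addrC (a v)) addrK.
Qed.

End SosModel.

Theorem theorem7 :
  (* case (a): Z-valued p-SOS model *)
  (forall (R : realType) (p : R) (M dmax d : nat),
     0 < p -> (d_threshold p M dmax <= d%:Z)%R ->
     exists eps : R, 0 < eps /\
     forall Psi : vertex d -> int -> R,
       (forall (v : vertex d) (k l : int), `|Psi v k - Psi v l| <= eps) ->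
       exists beta0 c C : R, 0 < c /\ 0 < C /\
       forall beta : R, beta0 <= beta ->
       exists mu : (vertex d -> int) -> probability (ConfSpace d int) R,
         (forall om0, G0 dmax M om0 ->
            extremal_gibbs (sosPhi p) Psi beta (mu om0)) /\
         (forall om0 om1, G0 dmax M om0 -> G0 dmax M om1 -> om0 <> om1 ->
            distinct_measures (mu om0) (mu om1)) /\
         (forall om0, G0 dmax M om0 -> forall (v : vertex d) (k : int),
            (mu om0 [set s : ConfSpace d int | (s v - om0 v = k)%R]
              <= (C * expR (- (c * beta * ((`|k%:~R| : R) `^ p))))%R%:E)%E))
  /\
  (* case (b): Z_q-valued finite-spin model *)
  (forall (R : realType) (q d dmax : nat) (u : 'I_q.+2 -> 'I_q.+2 -> R),
     (forall k l, 0 <= u k l) -> (forall k, u k k = 0) ->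
     (d%:R - 1) * umin u > dmax%:R * (Umax u + umin u) ->
     exists eps : R, 0 < eps /\
     forall Psi : vertex d -> 'I_q.+2 -> R,
       (forall (v : vertex d) (k l : 'I_q.+2), `|Psi v k - Psi v l| <= eps) ->
       exists beta0 c C : R, 0 < c /\ 0 < C /\
       forall beta : R, beta0 <= beta ->
       exists mu : (vertex d -> 'I_q.+2) -> probability (ConfSpace d 'I_q.+2) R,
         (forall om0, G0q dmax om0 ->
            extremal_gibbs u Psi beta (mu om0)) /\
         (forall om0 om1, G0q dmax om0 -> G0q dmax om1 -> om0 <> om1 ->
            distinct_measures (mu om0) (mu om1)) /\
         (forall om0, G0q dmax om0 -> forall v : vertex d,
            (mu om0 [set s : ConfSpace d 'I_q.+2 | s v = om0 v]
              >= (1 - C * expR (- (c * beta)))%R%:E)%E)).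
Proof.
split.
  move=> R p M dmax d p0 dP; exact: sos_family.
move=> R q d dmax u u0 ud h; exact: finite_spin_family.
Qed.
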